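(* Let $M=\mathbb{C}$ or $M=S^2$ and let $f:M\to\mathbb{C}P^2$ be a rotationally equivariant minimal Lagrangian immersion. Then $f$ has vanishing cubic Hopf differential, and therefore $f$ is totally geodesic in $\mathbb{C}P^2$ and its image is, up to isometries of $\mathbb{C}P^2$, contained in $\mathbb{R}P^2$.
   Context: $\mathbb{C}P^2$ carries the Fubini–Study metric and $\mathbb{R}P^2=\{[x]:x\in\mathbb{R}^3\setminus\{0\}\}\subset\mathbb{C}P^2$. An immersion $f:M\to\mathbb{C}P^2$ (conformal with respect to the complex structure of $M$) is rotationally equivariant if there is a one-parameter group $R(t)$ of isometries of $\mathbb{C}P^2$ with $f(\gamma_t\cdot p)=R(t)f(p)$ for all $p\in M$, $t\in\mathbb{R}$, where $\gamma_t$ is the group of rotations $z\mapsto e^{it}z$ of $\mathbb{C}$ about the origin (respectively the group of rotations of $S^2$ about the $z$-axis). The cubic Hopf differential is $\Psi=\psi\,dz^3$, $\psi=F_{zz}\cdot\overline{F_{\bar z}}$, where $z$ is a local conformal coordinate, $F$ is a local horizontal lift of $f$ to $S^5(1)\subset\mathbb{C}^3$ (i.e. $F_z\cdot\overline{F}=F_{\bar z}\cdot\overline F=0$), and $u\cdot\overline v=\sum u_k\overline{v_k}$; $\Psi$ does not depend on the lift and is globally defined on $M$. *)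

(* Defs.v *)
From mathcomp Require Export all_boot all_order all_algebra complex.
From mathcomp Require Export all_classical all_reals all_analysis.
From mathcomp Require Import ring.
Set Implicit Arguments.
Unset Strict Implicit.
Unset Printing Implicit Defensive.
Import Order.TTheory GRing.Theory Num.Theory numFieldNormedType.Exports.
Local Open Scope classical_set_scope.
Local Open Scope ring_scope.
Local Open Scope complex_scope.

Local Notation Re := complex.Re.
Local Notation Im := complex.Im.

(* Hermitian product [u . conj v] on C^3, linear in the first variable. *)
Notation "''[' u , v ]" := (@dotmx _ 3 u v)
  (at level 0, format "''[' u ,  v ]") : ring_scope.

Section ProjectivePlane.
Variable R : realType.
Local Notation C := R[i].
Local Notation V := 'rV[C]_3.

Definition CP2 : Type := {L : {vspace V} | \dim L == 1%N}.

Definition RP2 (L : CP2) : Prop :=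
  exists2 x : 'rV[R]_3, x != 0 & sval L = <[map_mx (real_complex R) x]>%VS.

(* Geodesic distance of the Fubini-Study metric for which the Hopf projection
   from the unit sphere S^5 is a Riemannian submersion. The value does not
   depend on the spanning vectors [vpick L], which need not be unit vectors. *)
Definition fs_dist (K L : CP2) : R :=
  let u := vpick (sval K) in let v := vpick (sval L) in
  acos (Re `|'[u, v]| / Num.sqrt (Re '[u, u] * Re '[v, v])).

Definition fs_isometry (Phi : CP2 -> CP2) : Prop :=
  set_bij setT setT Phi /\
  forall K L, fs_dist (Phi K) (Phi L) = fs_dist K L.

Definition one_parameter_group (T : R -> CP2 -> CP2) : Prop :=
  [/\ forall t, fs_isometry (T t),
      forall L, T 0 L = L,
      forall s t L, T (s + t) L = T s (T t L) &
      forall L s, fs_dist (T t L) (T s L) @[t --> s] --> (0 : R)].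

End ProjectivePlane.

Section Calculus.
Variable R : realType.
Local Notation C := R[i].
Local Notation V := 'rV[C]_3.
Local Notation plane := (R * R)%type.
Implicit Types (p v : plane) (U : set plane).

(* C^oo on an open set: every iterated directional derivative is
   differentiable. *)
Definition smooth_on U (u : plane -> R) : Prop :=
  forall (vs : seq plane) p, U p ->
    differentiable (foldr (fun v (h : plane -> R) => 'D_v h) u vs) p.

Definition vsmooth_on U (F : plane -> V) : Prop :=
  forall k, smooth_on U (fun q => Re (F q 0 k)) /\
            smooth_on U (fun q => Im (F q 0 k)).

Definition e1 : plane := (1, 0).
Definition e2 : plane := (0, 1).

Definition vderive v (F : plane -> V) p : V :=
  \row_k ('D_v (fun q => Re (F q 0 k)) p +i* 'D_v (fun q => Im (F q 0 k)) p).

(* Wirtinger derivatives with respect to z = x + i y. *)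
Definition dz (F : plane -> V) p : V :=
  2^-1 *: (vderive e1 F p - (0 +i* 1) *: vderive e2 F p).
Definition dzbar (F : plane -> V) p : V :=
  2^-1 *: (vderive e1 F p + (0 +i* 1) *: vderive e2 F p).

End Calculus.
Arguments e1 {R}.
Arguments e2 {R}.

(* Maps g from a coordinate plane to CP^2. *)
Section LocalGeometry.
Variable R : realType.
Local Notation C := R[i].
Local Notation V := 'rV[C]_3.
Local Notation plane := (R * R)%type.
Implicit Types (p v w : plane) (U : set plane) (F : plane -> V).
Implicit Types (g : plane -> CP2 R) (X Y Z : V).

Definition local_lift g U F : Prop :=
  [/\ open U, vsmooth_on U F &
      forall p, U p -> '[F p, F p] = 1 /\ sval (g p) = <[F p]>%VS].

Definition smooth_map g : Prop :=
  forall p, exists U F, U p /\ local_lift g U F.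

(* Projection onto the orthogonal complement of the complex line of a unit
   vector a. *)
Definition hor (a X : V) : V := X - '[X, a] *: a.

(* T_L CP^2 = Hom(L, L^perp): a unit vector F p of the line L = g p identifies
   T_L CP^2 with the complement of L, the Fubini-Study metric being the real
   part and the Kaehler form the imaginary part of the Hermitian product.
   [dlift v F p] is the image of dg(v) in this identification. *)
Definition dlift v F p : V := hor (F p) (vderive v F p).

(* The Levi-Civita connection of CP^2 is the connection of Hom(L, L^perp)
   induced by the orthogonal projections of the flat connection of C^3:
   (nabla_v xi)(F) = nabla_v (xi F) - xi (nabla_v F). [cov v w F p] is
   nabla_v dg(w); if F is horizontal the last term vanishes. *)
Definition cov v w F p : V :=
  hor (F p) (vderive v (dlift w F) p) - '[vderive v F p, F p] *: dlift w F p.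

Definition fs_metric X Y : R := Re '[X, Y].
Definition kaehler X Y : R := Im '[X, Y].

Definition gE F p := fs_metric (dlift e1 F p) (dlift e1 F p).
Definition gF F p := fs_metric (dlift e1 F p) (dlift e2 F p).
Definition gG F p := fs_metric (dlift e2 F p) (dlift e2 F p).
Definition gdet F p := gE F p * gG F p - gF F p ^+ 2.

(* Component of Z normal to the surface: Z minus its orthogonal projection on
   the real span of dg(e1), dg(e2). *)
Definition normal_part F p Z : V :=
  let X := dlift e1 F p in let Y := dlift e2 F p in
  let a := (gG F p * fs_metric Z X - gF F p * fs_metric Z Y) / gdet F p in
  let b := (gE F p * fs_metric Z Y - gF F p * fs_metric Z X) / gdet F p in
  Z - (a%:C *: X + b%:C *: Y).

Definition second_fundamental_form v w F p : V :=
  normal_part F p (cov v w F p).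

(* Half the trace of the second fundamental form for the induced metric. *)
Definition mean_curvature F p : V :=
  ((2 * gdet F p)^-1)%:C *:
    ((gG F p)%:C *: second_fundamental_form e1 e1 F p
     - (2 * gF F p)%:C *: second_fundamental_form e1 e2 F p
     + (gE F p)%:C *: second_fundamental_form e2 e2 F p).

(* Used only for conditions P that are unchanged when F is multiplied by a
   smooth function with values in the unit circle. *)
Definition pointwise (P : (plane -> V) -> plane -> Prop) g : Prop :=
  forall U F p, local_lift g U F -> U p -> P F p.

Definition immersive : (plane -> CP2 R) -> Prop :=
  pointwise (fun F p => forall v, dlift v F p = 0 -> v = 0).

Definition conformal : (plane -> CP2 R) -> Prop :=
  pointwise (fun F p => gE F p = gG F p /\ gF F p = 0).

Definition isotropic : (plane -> CP2 R) -> Prop :=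
  pointwise (fun F p => forall v w, kaehler (dlift v F p) (dlift w F p) = 0).

Definition zero_mean_curvature : (plane -> CP2 R) -> Prop :=
  pointwise (fun F p => mean_curvature F p = 0).

Definition zero_second_fundamental_form : (plane -> CP2 R) -> Prop :=
  pointwise (fun F p => forall v w, second_fundamental_form v w F p = 0).

Definition horizontal_lift g U F : Prop :=
  local_lift g U F /\
  forall p, U p -> '[dz F p, F p] = 0 /\ '[dzbar F p, F p] = 0.

(* [c] is the value at [p] of psi = F_zz . conj (F_zbar). *)
Definition hopf_coefficient g p (c : C) : Prop :=
  exists U F, [/\ horizontal_lift g U F, U p &
                  c = '[dz (dz F) p, dzbar F p]].

(* The equivalence also asserts that horizontal lifts exist near every
   point. *)
Definition zero_hopf_differential g : Prop :=
  forall p c, hopf_coefficient g p c <-> c = 0.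

End LocalGeometry.

Section Surfaces.
Variable R : realType.

(* A surface covered by the images of conformal parametrizations (inverses of
   charts) [param i], each defined on the whole (x, y)-plane with complex
   coordinate x + i y, and a family of rotations. *)
Record rot_surface := RotSurface {
  carrier :> Type;
  chart : Type;
  param : chart -> R * R -> carrier;
  rotation : R -> carrier -> carrier }.

Definition complex_plane : rot_surface :=
  @RotSurface R[i] unit (fun _ p => p.1 +i* p.2)
    (fun t z => (cos t +i* sin t) * z).

Definition S2 : Type :=
  {q : R * R * R | q.1.1 ^+ 2 + q.1.2 ^+ 2 + q.2 ^+ 2 == 1}.

Definition stereo_coords (s : bool) (x y : R) : R * R * R :=
  let d := 1 + x ^+ 2 + y ^+ 2 in
  (2 * x / d, (-1) ^+ s * (2 * y / d),
   (-1) ^+ s * ((x ^+ 2 + y ^+ 2 - 1) / d)).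

Lemma stereo_subproof (s : bool) (x y : R) :
  let q := stereo_coords s x y in
  q.1.1 ^+ 2 + q.1.2 ^+ 2 + q.2 ^+ 2 == 1.
Proof.
rewrite /stereo_coords /= ![((-1) ^+ s * _) ^+ 2]exprMn !sqrr_sign !mul1r.
have d0 : 1 + x ^+ 2 + y ^+ 2 != 0.
  by rewrite lt0r_neq0// -addrA ltr_pwDl// addr_ge0// sqr_ge0.
by apply/eqP; field.
Qed.

(* [stereo false] is the inverse stereographic projection from the north pole,
   [stereo true] the one from the south pole composed with conjugation; the
   transition map is z |-> 1 / z. *)
Definition stereo (s : bool) (p : R * R) : S2 :=
  exist _ (stereo_coords s p.1 p.2) (stereo_subproof s p.1 p.2).

Definition rotz_coords (t : R) (q : R * R * R) : R * R * R :=
  (cos t * q.1.1 - sin t * q.1.2, sin t * q.1.1 + cos t * q.1.2, q.2).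

Lemma rotz_subproof (t : R) (q : S2) :
  let r := rotz_coords t (sval q) in
  r.1.1 ^+ 2 + r.1.2 ^+ 2 + r.2 ^+ 2 == 1.
Proof.
case: q => [[[x y] z]] /= /eqP <-; apply/eqP.
rewrite -[x ^+ 2 + _]mul1r -(cos2Dsin2 t); ring.
Qed.

Definition rotz (t : R) (q : S2) : S2 :=
  exist _ (rotz_coords t (sval q)) (rotz_subproof t q).

Definition round_sphere : rot_surface := @RotSurface S2 bool stereo rotz.

End Surfaces.

Section Maps.
Variables (R : realType) (M : rot_surface R).
Implicit Type f : M -> CP2 R.

Definition conformal_immersion f : Prop :=
  forall i : chart M, [/\ smooth_map (f \o param i), immersive (f \o param i) &
                          conformal (f \o param i)].

(* M is a surface, so isotropic immersions into CP^2 are Lagrangian. *)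
Definition lagrangian f : Prop := forall i : chart M, isotropic (f \o param i).

Definition minimal f : Prop :=
  forall i : chart M, zero_mean_curvature (f \o param i).

Definition totally_geodesic f : Prop :=
  forall i : chart M, zero_second_fundamental_form (f \o param i).

Definition vanishing_cubic_hopf_differential f : Prop :=
  forall i : chart M, zero_hopf_differential (f \o param i).

Definition rotationally_equivariant f : Prop :=
  exists2 T : R -> CP2 R -> CP2 R, one_parameter_group T &
    forall t p, f (rotation t p) = T t (f p).

End Maps.

(* Main.v *)
(** A local unit lift [F] carries the covariant derivative [nab F], whose
    curvature is the Kaehler form pulled back by the surface; it vanishes since
    the surface is Lagrangian, so that lifts need not be horizontal. With [P]
    and [Q] the covariant derivatives of [F] along [z] and [conj z], the triple
    [F, P, Q] is an orthogonal basis of C^3, minimality reads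
    [nab_zbar P = - <P, P> F], and [psi = <nab_z P, Q>] is holomorphic and
    independent of the lift.

    By Wigner's theorem every isometry of CP^2 is unitary or antiunitary. The
    members of a one-parameter group are squares, hence unitary, so equivariance
    gives [e^{3it} psi (e^{it} z) = psi z]. Thus [z^3 psi] is holomorphic and
    constant along circles: its gradient vanishes, it equals its value [0] at
    the origin, and [psi = 0].

    When [psi = 0] the second fundamental form vanishes and the symmetric matrix
    [S = F F^T + (P Q^T + Q P^T) / <P, P>] is constant up to a phase. Writing
    [S = M^T M] with [M] unitary at one point, [conj F S = F] says that the
    coordinates of [F] in the rows of [M] are real up to a common phase. Dividing
    by that phase provides the horizontal lifts in the definition of the Hopf
    differential. On the sphere both stereographic charts are treated this way
    and the last pole is reached by continuity. *)
From HB Require Import structures.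
Require Import Defs.
From mathcomp Require Import ring lra.
Set Implicit Arguments.
Unset Strict Implicit.
Unset Printing Implicit Defensive.
Import Order.TTheory GRing.Theory Num.Theory numFieldNormedType.Exports.
Local Open Scope classical_set_scope.
Local Open Scope ring_scope.
Local Open Scope complex_scope.

Local Notation Re := complex.Re.
Local Notation Im := complex.Im.

(** * Complex-valued calculus on the plane *)

Section ComplexCalculus.
Variable R : realType.
Local Notation C := R[i].
Local Notation plane := (R * R)%type.
Implicit Types (u w : plane -> C) (U : set plane) (p v : plane).

(** Lifts are local and determined up to a phase. What becomes global are phase-invariant
    expressions: [psi], and the products [S_jk conj S_lm], in which the squared phase carried by [S]
    cancels. They glue to functions on the whole plane, whose derivatives are read off any local
    lift. Producing horizontal lifts directly would mean integrating a flat connection; covariant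
    derivatives postpone this until the real form of the image yields such lifts algebraically. The
    exponent 3 counts derivatives: [psi] involves two derivatives along z and the conjugate of one
    along conj z, and each contributes a factor e^{it}. For the gradient of the invariant function,
    the Cauchy-Riemann equation and rotational invariance are two linear equations with determinant
    z. The matrix [S] comes from the expected answer: a copy of RP^2 is the fixed set of an
    antiunitary involution [v -> conj v S] with [S] symmetric and unitary. The [S] chosen fixes [F]
    and exchanges [P] and [Q], that is, it fixes the real tangent plane spanned by [P + Q] and
    [i (P - Q)]. *)

Definition cdiff u p :=
  differentiable (fun q => Re (u q)) p /\ differentiable (fun q => Im (u q)) p.

Definition cD v u p : C :=
  'D_v (fun q => Re (u q)) p +i* 'D_v (fun q => Im (u q)) p.

Lemma cReM (x y : C) : Re (x * y) = Re x * Re y - Im x * Im y.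
Proof. by case: x; case: y. Qed.

Lemma cImM (x y : C) : Im (x * y) = Re x * Im y + Im x * Re y.
Proof. by case: x => a b; case: y => c d /=; rewrite addrC; congr (_ + _); rewrite mulrC. Qed.

Lemma cReD (x y : C) : Re (x + y) = Re x + Re y.
Proof. by case: x; case: y. Qed.

Lemma cImD (x y : C) : Im (x + y) = Im x + Im y.
Proof. by case: x; case: y. Qed.

Lemma complex_ext (x y : C) : Re x = Re y -> Im x = Im y -> x = y.
Proof. by case: x => a b; case: y => c d /= -> ->. Qed.

Lemma cReJ (x : C) : Re (conjc x) = Re x. Proof. by case: x. Qed.
Lemma cImJ (x : C) : Im (conjc x) = - Im x. Proof. by case: x. Qed.

Lemma derive_mul_sub (f g h k : plane -> R) v p :
  derivable f p v -> derivable g p v -> derivable h p v -> derivable k p v ->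
  'D_v (fun q => f q * g q - h q * k q) p =
  (f p * 'D_v g p + g p * 'D_v f p) - (h p * 'D_v k p + k p * 'D_v h p).
Proof.
move=> df dg dh dk; have dfg := derivableM df dg; have dhk := derivableM dh dk.
have -> : (fun q => f q * g q - h q * k q) = (f * g) - (h * k) by [].
by rewrite (deriveB dfg dhk) (deriveM df dg) (deriveM dh dk).
Qed.

Lemma derive_mul_add (f g h k : plane -> R) v p :
  derivable f p v -> derivable g p v -> derivable h p v -> derivable k p v ->
  'D_v (fun q => f q * g q + h q * k q) p =
  (f p * 'D_v g p + g p * 'D_v f p) + (h p * 'D_v k p + k p * 'D_v h p).
Proof.
move=> df dg dh dk; have dfg := derivableM df dg; have dhk := derivableM dh dk.
have -> : (fun q => f q * g q + h q * k q) = (f * g) + (h * k) by [].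
by rewrite (deriveD dfg dhk) (deriveM df dg) (deriveM dh dk).
Qed.

Lemma cdiff_cst (c : C) p : cdiff (fun=> c) p.
Proof. by split; exact: differentiable_cst. Qed.

Lemma cD_cst (c : C) v p : cD v (fun=> c) p = 0.
Proof. by rewrite /cD !derive_cst. Qed.

Lemma cdiffD u w p : cdiff u p -> cdiff w p -> cdiff (fun q => u q + w q) p.
Proof.
move=> [a b] [c d]; split.
- under eq_fun do rewrite cReD; exact: differentiableD.
- under eq_fun do rewrite cImD; exact: differentiableD.
Qed.

Lemma cDD v u w p : cdiff u p -> cdiff w p ->
  cD v (fun q => u q + w q) p = cD v u p + cD v w p.
Proof.
move=> [a b] [c d]; rewrite /cD; apply: complex_ext; rewrite ?cReD ?cImD /=.
- under eq_fun do rewrite cReD; rewrite deriveD //; exact: diff_derivable.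
- under eq_fun do rewrite cImD; rewrite deriveD //; exact: diff_derivable.
Qed.

Lemma cdiffM u w p : cdiff u p -> cdiff w p -> cdiff (fun q => u q * w q) p.
Proof.
move=> [a b] [c d]; split.
- under eq_fun do rewrite cReM; by apply: differentiableB; apply: differentiableM.
- under eq_fun do rewrite cImM; by apply: differentiableD; apply: differentiableM.
Qed.

Lemma cDM v u w p : cdiff u p -> cdiff w p ->
  cD v (fun q => u q * w q) p = cD v u p * w p + u p * cD v w p.
Proof.
move=> [/(@diff_derivable _ _ _ _ _ v) a /(@diff_derivable _ _ _ _ _ v) b].
move=> [/(@diff_derivable _ _ _ _ _ v) c /(@diff_derivable _ _ _ _ _ v) d].
rewrite /cD; apply: complex_ext; rewrite ?cReD ?cImD ?cReM ?cImM /=.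
- under eq_fun do rewrite cReM.
  rewrite derive_mul_sub //.
  move: ('D_v _ p) ('D_v _ p) ('D_v _ p) ('D_v _ p) (Re _) (Re _) (Im _) (Im _).
  by move=> *; ring.
- under eq_fun do rewrite cImM.
  rewrite derive_mul_add //.
  move: ('D_v _ p) ('D_v _ p) ('D_v _ p) ('D_v _ p) (Re _) (Re _) (Im _) (Im _).
  by move=> *; ring.
Qed.

Lemma cdiffJ u p : cdiff u p -> cdiff (fun q => conjc (u q)) p.
Proof.
move=> [a b]; split.
- by under eq_fun do rewrite cReJ.
- under eq_fun do rewrite cImJ; exact: differentiableN.
Qed.

Lemma cDJ v u p : cdiff u p -> cD v (fun q => conjc (u q)) p = conjc (cD v u p).
Proof.
move=> [/(@diff_derivable _ _ _ _ _ v) a /(@diff_derivable _ _ _ _ _ v) b].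
rewrite /cD; apply: complex_ext; rewrite ?cReJ ?cImJ /=.
- by under eq_fun do rewrite cReJ.
- by under eq_fun do rewrite cImJ; rewrite deriveN.
Qed.

Lemma cD_near v u w p : (\near p, u p = w p) -> cD v u p = cD v w p.
Proof.
move=> uw; rewrite /cD; congr (_ +i* _).
- have [->|v0] := eqVneq v 0; first by rewrite !derive0.
  by apply: near_eq_derive => //; near do congr Re.
- have [->|v0] := eqVneq v 0; first by rewrite !derive0.
  by apply: near_eq_derive => //; near do congr Im.
Unshelve. all: by end_near. Qed.

(** Differentiability depends on the germ only: the affine approximation of [f] also serves [g], and
    [diff_unique] identifies its linear part with ['d g p]. *)
Lemma differentiable_near (f g : plane -> R) p : (\near p, f p = g p) ->
  differentiable f p -> differentiable g p.
Proof.
move=> fg df.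
have E : g \o shift p = cst (g p) + 'd f p +o_ (0 : plane) id.
  have /eqaddoP H := diff_locally df.
  apply/eqaddoP => e e0; have := H e e0.
  have : \forall h \near (0 : plane), f (h + p) = g (h + p).
    by move: fg; rewrite (near_shift 0) subr0.
  move=> A B; near=> h.
  have -> : (g \o shift p - (cst (g p) + 'd f p)) h =
           (f \o shift p - (cst (f p) + 'd f p)) h.
    rewrite /GRing.add /GRing.opp /= -(nbhs_singleton fg).
    by rewrite (near A h).
  exact: (near B h).
apply/diff_locallyP.
have -> : 'd g p = 'd f p :> (plane -> R).
  by apply: diff_unique => //; exact: diff_continuous.
by split=> //; exact: diff_continuous.
Unshelve. all: by end_near. Qed.



End ComplexCalculus.

(** * Symmetry of second derivatives *)

Section Schwarz.
Variable R : realType.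
Local Notation plane := (R * R)%type.
Implicit Types (p v w : plane).

Lemma line_quotient (f : plane -> R) p v (s : R) :
  (fun h : R => h^-1 *: (((fun t : R => f (p + t *: v)) \o shift s) (h *: (1 : R))
     - f (p + s *: v))) =
  (fun h : R => h^-1 *: ((f \o shift (p + s *: v)) (h *: v) - f (p + s *: v))).
Proof.
apply/funext => h; congr (_ *: (f _ - _)).
by rewrite /= [_ *: (1 : R)]mulr1 scalerDl addrCA.
Qed.

Lemma line_is_derive (f : plane -> R) p v (s : R) :
  differentiable f (p + s *: v) ->
  is_derive s (1 : R) (fun t => f (p + t *: v)) ('D_v f (p + s *: v)).
Proof.
move=> /(@diff_derivable _ _ _ _ _ v) df; apply: DeriveDef.
  by rewrite /derivable line_quotient.
by rewrite /derive line_quotient.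
Qed.

Lemma second_difference_bound (h e K a b x0 x1 x2 dv dw : R) :
  0 < h -> 0 < K -> 0 < e ->
  `|x2 - (x0 + (dv + h * dw))| <= e / K * b ->
  `|x1 - (x0 + dv)| <= e / K * a -> a + b <= h * K ->
  `|(x2 - x1) * h - h ^+ 2 * dw| <= e * h ^+ 2.
Proof.
move=> h0 K0 e0 s2 s1 ab.
have -> : (x2 - x1) * h - h ^+ 2 * dw =
   h * ((x2 - (x0 + (dv + h * dw))) - (x1 - (x0 + dv))) by ring.
rewrite normrM gtr0_norm // expr2 mulrCA ler_pM2l //.
apply: le_trans (ler_normB _ _) _; apply: le_trans (lerD s2 s1) _.
rewrite -mulrDr addrC; apply: le_trans (_ : e / K * (h * K) <= _).
  by rewrite ler_pM2l // divr_gt0.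
by rewrite [h * K]mulrC mulrA divfK // gt_eqF.
Qed.

(** The mean value theorem in direction [v] turns the second difference into an increment of
    ['D_v f], which is expanded by differentiability at the single point [p]. This order of
    operations singles out ['D_w ('D_v f)]. *)
Lemma second_difference (f : plane -> R) p v w :
  (\near p, differentiable f p) -> differentiable ('D_v f) p ->
  forall e, 0 < e -> \forall h \near 0^'+,
    `|f (p + h *: v + h *: w) - f (p + h *: v) - f (p + h *: w) + f p
      - h ^+ 2 * 'D_w ('D_v f) p| <= e * h ^+ 2.
Proof.
move=> df dDf e e0.
pose D := 'D_v f.
(* The norms of the displacements [c v] and [c v + h w] add up to at most [h (2|v| + |w|)]; the
   summand [1] keeps [K] positive when both vectors vanish. *)
pose K := (`|v| + `|w| + `|v| + 1).
have K0 : 0 < K by rewrite ltr_wpDl // !addr_ge0.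
have eK : 0 < e / K by rewrite divr_gt0.
have /eqaddoP/(_ _ eK) H := diff_locally dDf.
have /nbhs_ballP[d /= d0 Hd] : \forall k \near (0 : plane),
    `|D (k + p) - (D p + 'd D p k)| <= e / K * `|k| /\ differentiable f (k + p).
  near=> k; split; first exact: (near H k).
  near: k; move: df; rewrite (near_shift 0) subr0; exact.
have small (k : plane) : `|k| < d ->
    `|D (p + k) - (D p + 'd D p k)| <= e / K * `|k| /\ differentiable f (p + k).
  move=> kd; rewrite [p + k]addrC; apply: Hd.
  by rewrite -ball_normE /= sub0r normrN.
near=> h.
have h0 : 0 < h by near: h; exact: nbhs_right_gt.
have hd : h * K < d.
  rewrite -ltr_pdivlMr //; near: h; apply: nbhs_right_lt; exact: divr_gt0.
have bnd (c : R) : 0 <= c -> c <= h -> `|c *: v| <= h * `|v| /\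
    `|c *: v + h *: w| <= h * (`|v| + `|w|).
  move=> c0 ch; have cv : `|c *: v| <= h * `|v|.
    by rewrite normrZ ger0_norm // ler_wpM2r.
  split => //; rewrite mulrDr (le_trans (ler_normD _ _)) // lerD //.
  by rewrite normrZ gtr0_norm.
have lt1 : h * `|v| < d.
  by apply: le_lt_trans hd; rewrite ler_pM2l // /K -!addrA lerDl !addr_ge0.
have lt2 : h * (`|v| + `|w|) < d.
  by apply: le_lt_trans hd; rewrite ler_pM2l // /K -addrA lerDl addr_ge0.
pose phi (s : R) := f ((p + h *: w) + s *: v) - f (p + s *: v).
have dphi (s : R) : 0 <= s -> s <= h ->
    is_derive s (1 : R) phi ('D_v f (p + h *: w + s *: v) - 'D_v f (p + s *: v)).
  move=> s0 sh; have [b1 b2] := bnd s s0 sh.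
  apply: is_deriveB; apply: line_is_derive.
  - rewrite -addrA [h *: w + _]addrC; apply: (small _ _).2; exact: le_lt_trans b2 lt2.
  - apply: (small _ _).2; exact: le_lt_trans b1 lt1.
have [||c c0h] := @MVT _ phi
   (fun s => 'D_v f (p + h *: w + s *: v) - 'D_v f (p + s *: v)) 0 h h0.
- move=> s; rewrite in_itv /= => /andP[s0 sh]; apply: dphi; exact: ltW.
- apply: derivable_within_continuous => s; rewrite in_itv /= => /andP[s0 sh].
  by have [] := dphi s s0 sh.
move: c0h; rewrite in_itv /= => /andP[c0 ch].
rewrite subr0 /phi !scale0r !addr0 => E.
have [b1 b2] := bnd c (ltW c0) (ltW ch).
have -> : f (p + h *: v + h *: w) - f (p + h *: v) - f (p + h *: w) + f p =
   f (p + h *: w + h *: v) - f (p + h *: v) - (f (p + h *: w) - f p).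
  by rewrite -!addrA [h *: w + _]addrC; ring.
rewrite E (_ : p + h *: w + c *: v = p + (c *: v + h *: w)); last first.
  by rewrite -addrA [h *: w + _]addrC.
have [s1 _] := small _ (le_lt_trans b1 lt1).
have [s2 _] := small _ (le_lt_trans b2 lt2).
rewrite -/D (_ : 'D_w D p = 'd D p w); last by rewrite deriveE.
have L : 'd D p (c *: v + h *: w) = 'd D p (c *: v) + h * 'd D p w.
  by rewrite linearD [X in _ + X]linearZ.
rewrite L in s2.
apply: (second_difference_bound h0 K0 e0 s2 s1).
apply: le_trans (lerD b1 b2) _.
rewrite -mulrDr ler_pM2l // /K; lra.
Unshelve. all: by end_near. Qed.

Lemma close_of_second_difference (h e a b c d x y : R) : 0 < h ->
  `|a - b - c + d - h ^+ 2 * x| <= e / 2 * h ^+ 2 ->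
  `|a - c - b + d - h ^+ 2 * y| <= e / 2 * h ^+ 2 -> `|x - y| <= e.
Proof.
move=> h0 X Y; rewrite -(ler_pM2l (exprn_gt0 2 h0)).
rewrite -{1}(gtr0_norm (exprn_gt0 2 h0)) -normrM.
have -> : h ^+ 2 * (x - y) =
    (a - c - b + d - h ^+ 2 * y) - (a - b - c + d - h ^+ 2 * x) by ring.
apply: le_trans (ler_normB _ _) _; apply: le_trans (lerD Y X) _.
by rewrite -mulrDl -splitr mulrC.
Qed.

(** The second difference is symmetric in [v] and [w], whereas its expansion yields either mixed
    derivative, according to the direction in which the mean value theorem is applied. *)
Lemma derive_comm (f : plane -> R) p v w :
  (\near p, differentiable f p) -> differentiable ('D_v f) p ->
  differentiable ('D_w f) p -> 'D_w ('D_v f) p = 'D_v ('D_w f) p.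
Proof.
move=> df dv dw; apply/eqP; rewrite -subr_eq0 -normr_le0; apply/ler_addgt0Pl => e e0.
rewrite addr0; have e2 : 0 < e / 2 by rewrite divr_gt0.
have A := second_difference w df dv e2; have B := second_difference v df dw e2.
near (0:R)^'+ => h.
have h0 : 0 < h by near: h; exact: nbhs_right_gt.
have : `|f (p + h *: v + h *: w) - f (p + h *: v) - f (p + h *: w) + f p
      - h ^+ 2 * 'D_w ('D_v f) p| <= e / 2 * h ^+ 2 by exact: (near A h).
have : `|f (p + h *: w + h *: v) - f (p + h *: w) - f (p + h *: v) + f p
      - h ^+ 2 * 'D_v ('D_w f) p| <= e / 2 * h ^+ 2 by exact: (near B h).
rewrite -[p + h *: w + h *: v]addrA [h *: w + _]addrC [p + (_ + _)]addrA.
move=> Y X; exact: (close_of_second_difference h0 X Y).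
Unshelve. all: by end_near. Qed.

End Schwarz.


(** * Smooth complex-valued functions and Wirtinger derivatives *)

Section Smooth.
Variable R : realType.
Local Notation C := R[i].
Local Notation plane := (R * R)%type.
Implicit Types (u w : plane -> C) (U : set plane) (p v : plane).

Lemma cD_linear u p v : cdiff u p ->
  cD v u p = (v.1)%:C * cD e1 u p + (v.2)%:C * cD e2 u p.
Proof.
have E (f : plane -> R) : differentiable f p ->
    'D_v f p = v.1 * 'D_e1 f p + v.2 * 'D_e2 f p.
  move=> df; rewrite !deriveE //.
  have -> : v = v.1 *: (e1 : plane) + v.2 *: (e2 : plane).
    by case: v => a b; congr pair; rewrite /= /GRing.scale /= ?mulr1 ?mulr0 ?addr0 ?add0r.
  rewrite linearD [X in X + _]linearZ [X in _ + X]linearZ /=.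
  by rewrite /GRing.scale /= !mulr1 !mulr0 !addr0 !add0r.
move=> [/E a /E b]; rewrite /cD a b.
move: ('D_e1 _ _) ('D_e2 _ _) ('D_e1 _ _) ('D_e2 _ _) => a1 a2 b1 b2.
by apply: complex_ext; rewrite /= ?mul0r ?subr0 ?addr0.
Qed.

(** Smoothness graded by the number of derivatives: closure under sums, products and conjugation is
    then an induction on [n], for which the lists of directions in [smooth_on] are less suited. *)
Fixpoint sm n U u : Prop :=
  (forall p, U p -> cdiff u p) /\
  if n is m.+1 then forall v, sm m U (cD v u) else True.

Lemma sm_cdiff n U u p : sm n U u -> U p -> cdiff u p.
Proof. by case: n => [|n] [+ _]; apply. Qed.

Lemma smW n U u : sm n.+1 U u -> sm n U u.
Proof.
elim: n u => [|n IH] u [du Du]; first by split.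
by split=> // v; apply: IH; apply: Du.
Qed.

Lemma sm_subset n U U' u : U' `<=` U -> sm n U u -> sm n U' u.
Proof.
move=> UU; elim: n u => [|n IH] u [du Du]; split=> //; try by move=> p /UU; apply: du.
by move=> v; apply: IH; apply: Du.
Qed.

Lemma near_of_open U (P : plane -> Prop) p : open U -> U p ->
  (forall q, U q -> P q) -> \near p, P p.
Proof.
move=> oU Up H; have : \forall q \near p, U q by exact: open_nbhs_nbhs.
by apply: filterS.
Qed.

Lemma cD_eq_on U u w : open U -> (forall p, U p -> u p = w p) ->
  forall v p, U p -> cD v u p = cD v w p.
Proof. by move=> oU uw v p Up; apply: cD_near; exact: near_of_open uw. Qed.

(** The Leibniz formulas are available only at points of [U]. Since [U] is open, derivatives there
    see only the values on [U], so such formulas may replace the derivative. *)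
Lemma sm_eq n U u w : open U -> (forall p, U p -> u p = w p) ->
  sm n U u -> sm n U w.
Proof.
move=> oU; elim: n u w => [|n IH] u w uw [du Du].
  split=> // p Up; have [a b] := du p Up; split.
    by apply: differentiable_near a; apply: near_of_open (Up) _ => // q Uq; rewrite uw.
  by apply: differentiable_near b; apply: near_of_open (Up) _ => // q Uq; rewrite uw.
split=> [p Up|v].
  have [a b] := du p Up; split.
    by apply: differentiable_near a; apply: near_of_open (Up) _ => // q Uq; rewrite uw.
  by apply: differentiable_near b; apply: near_of_open (Up) _ => // q Uq; rewrite uw.
apply: (IH (cD v u)) => [p Up|]; [exact: (cD_eq_on oU uw)|exact: Du].
Qed.

Lemma sm_cst n U c : sm n U (fun=> c).
Proof.
elim: n c => [|n IH] c; first by split=> // p _; exact: cdiff_cst.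
split=> [p _|v]; first exact: cdiff_cst.
have -> : cD v (fun=> c) = (fun=> 0) by apply/funext => p; rewrite cD_cst.
exact: IH.
Qed.

Lemma smD n U u w : open U -> sm n U u -> sm n U w -> sm n U (fun q => u q + w q).
Proof.
move=> oU; elim: n u w => [|n IH] u w [du Du] [dw Dw].
  by split=> // p Up; apply: cdiffD; [exact: du|exact: dw].
split=> [p Up|v]; first by apply: cdiffD; [exact: du|exact: dw].
apply: (@sm_eq _ _ (fun q => cD v u q + cD v w q)) => //; last exact: (IH _ _ (Du v) (Dw v)).
by move=> p Up; rewrite cDD //; [exact: du|exact: dw].
Qed.

Lemma smM n U u w : open U -> sm n U u -> sm n U w -> sm n U (fun q => u q * w q).
Proof.
move=> oU; elim: n u w => [|n IH] u w su sw.
  split=> // p Up; apply: cdiffM; [exact: sm_cdiff su Up|exact: sm_cdiff sw Up].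
split=> [p Up|v].
  by apply: cdiffM; [exact: sm_cdiff su Up|exact: sm_cdiff sw Up].
apply: (@sm_eq _ _ (fun q => cD v u q * w q + u q * cD v w q)) => //.
  by move=> p Up; rewrite cDM //; [exact: sm_cdiff su Up|exact: sm_cdiff sw Up].
have su' := smW su; have sw' := smW sw; case: su => _ Du; case: sw => _ Dw.
by apply: smD => //; apply: IH => //; [exact: Du|exact: Dw].
Qed.

Lemma smJ n U u : open U -> sm n U u -> sm n U (fun q => conjc (u q)).
Proof.
move=> oU; elim: n u => [|n IH] u [du Du].
  by split=> // p Up; apply: cdiffJ; exact: du.
split=> [p Up|v]; first by apply: cdiffJ; exact: du.
apply: (@sm_eq _ _ (fun q => conjc (cD v u q))) => //; last exact: (IH _ (Du v)).
by move=> p Up; rewrite cDJ //; exact: du.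
Qed.

Lemma smooth_onP U (f g : plane -> R) :
  smooth_on U f /\ smooth_on U g <-> forall n, sm n U (fun q => f q +i* g q).
Proof.
have d (f' g' : plane -> R) : smooth_on U f' -> smooth_on U g' ->
    forall p, U p -> cdiff (fun q => f' q +i* g' q) p.
  by move=> sf sg p Up; split; [exact: (sf [::])|exact: (sg [::])].
split=> [[sf sg] n|H].
  elim: n f g sf sg => [|n IH] f g sf sg; first by split=> //; exact: d.
  split=> [|v]; first exact: d.
  (* [foldr] applies the last direction of the list innermost, while [sm] differentiates from the
     inside out; hence [rcons]. *)
  apply: IH => vs p Up.
    by have := sf (rcons vs v) p Up; rewrite foldr_rcons.
  by have := sg (rcons vs v) p Up; rewrite foldr_rcons.
suff E vs : forall f g, (forall n, sm n U (fun q => f q +i* g q)) ->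
    forall p, U p -> cdiff (fun q => foldr (fun v (h : plane -> R) => 'D_v h) f vs q
      +i* foldr (fun v (h : plane -> R) => 'D_v h) g vs q) p.
  by split=> vs p Up; have [] := E vs f g H p Up.
elim/last_ind: vs => [|vs v IH] f' g' H' p Up; first by case: (H' 0%N) => + _; apply.
rewrite !foldr_rcons; apply: IH => // n.
by case: (H' n.+1) => _ /(_ v).
Qed.

End Smooth.


Section Csm.
Variable R : realType.
Local Notation C := R[i].
Local Notation plane := (R * R)%type.
Implicit Types (u w : plane -> C) (U : set plane) (p v : plane) (s : C).

Definition csm U u := forall n, sm n U u.

Lemma csm_cst U c : csm U (fun=> c).
Proof. by move=> n; exact: sm_cst. Qed.

Lemma csmD U u w : open U -> csm U u -> csm U w -> csm U (fun q => u q + w q).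
Proof. by move=> oU su sw n; apply: smD. Qed.

Lemma csmM U u w : open U -> csm U u -> csm U w -> csm U (fun q => u q * w q).
Proof. by move=> oU su sw n; apply: smM. Qed.

Lemma csmJ U u : open U -> csm U u -> csm U (fun q => conjc (u q)).
Proof. by move=> oU su n; apply: smJ. Qed.

Lemma csmN U u : open U -> csm U u -> csm U (fun q => - u q).
Proof.
move=> oU su; under eq_fun do rewrite -mulN1r.
by apply: csmM => //; exact: csm_cst.
Qed.

Lemma csm_eq U u w : open U -> (forall p, U p -> u p = w p) -> csm U u -> csm U w.
Proof. by move=> oU uw su n; apply: sm_eq uw _. Qed.

Lemma csm_cD U u v : csm U u -> csm U (cD v u).
Proof. by move=> su n; case: (su n.+1) => _; apply. Qed.

Lemma csm_cdiff U u p : csm U u -> U p -> cdiff u p.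
Proof. by move=> su; exact: (sm_cdiff (su 0%N)). Qed.

Lemma csm_subset U U' u : U' `<=` U -> csm U u -> csm U' u.
Proof. by move=> UU su n; exact: sm_subset UU (su n). Qed.

Lemma csm_sum U (I : Type) (r : seq I) (u : I -> plane -> C) : open U ->
  (forall i, csm U (u i)) -> csm U (fun q => \sum_(i <- r) u i q).
Proof.
move=> oU su; elim: r => [|i r IH].
  by under eq_fun do rewrite big_nil; exact: csm_cst.
by under eq_fun do rewrite big_cons; exact: csmD.
Qed.

Lemma cD_comm U u v v' p : open U -> csm U u -> U p ->
  cD v (cD v' u) p = cD v' (cD v u) p.
Proof.
move=> oU su Up; have du : \near p, cdiff u p.
  by apply: near_of_open Up _ => // q Uq; exact: csm_cdiff su Uq.
have [a b] := csm_cdiff (csm_cD v su) Up; have [c d] := csm_cdiff (csm_cD v' su) Up.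
have dR : \near p, differentiable (fun q => Re (u q)) p by apply: filterS du => q [].
have dI : \near p, differentiable (fun q => Im (u q)) p by apply: filterS du => q [].
have ER := @derive_comm R (fun q => Re (u q)) p v' v dR c a.
have EI := @derive_comm R (fun q => Im (u q)) p v' v dI d b.
exact: (congr2 (@Complex R) ER EI).
Qed.

Definition ii {R : realType} : R[i] := 0 +i* 1.

(* [ds (- ii)] and [ds ii] are the Wirtinger derivatives. *)
Definition ds s u p : C := 2^-1 * (cD e1 u p + s * cD e2 u p).

Lemma csm_ds U s u : open U -> csm U u -> csm U (ds s u).
Proof.
move=> oU su; apply: csmM => //; first exact: csm_cst.
by apply: csmD => //; [|apply: csmM => //; first exact: csm_cst]; exact: csm_cD.
Qed.

Lemma ds_cst s c p : ds s (fun=> c) p = 0.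
Proof. by rewrite /ds !cD_cst mulr0 addr0 mulr0. Qed.

Lemma dsD U s u w p : csm U u -> csm U w -> U p ->
  ds s (fun q => u q + w q) p = ds s u p + ds s w p.
Proof.
move=> su sw Up; have du := csm_cdiff su Up; have dw := csm_cdiff sw Up.
rewrite /ds !cDD //; move: (cD _ u _) (cD _ u _) (cD _ w _) (cD _ w _) => *.
by ring.
Qed.

Lemma dsM U s u w p : csm U u -> csm U w -> U p ->
  ds s (fun q => u q * w q) p = ds s u p * w p + u p * ds s w p.
Proof.
move=> su sw Up; have du := csm_cdiff su Up; have dw := csm_cdiff sw Up.
rewrite /ds !cDM //; move: (cD _ u _) (cD _ u _) (cD _ w _) (cD _ w _) (u p) (w p).
by move=> *; ring.
Qed.

Lemma conjM (x y : C) : conjc (x * y) = conjc x * conjc y.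
Proof. exact: rmorphM. Qed.

Lemma conjD (x y : C) : conjc (x + y) = conjc x + conjc y.
Proof. exact: rmorphD. Qed.

Lemma conj2V : conjc (2^-1 : C) = 2^-1.
Proof. by rewrite conjc_inv conjc_nat. Qed.

Lemma dsJ U s u p : csm U u -> U p ->
  ds s (fun q => conjc (u q)) p = conjc (ds (conjc s) u p).
Proof.
move=> su Up; have du := csm_cdiff su Up.
by rewrite /ds !cDJ // conjM conjD conjM conjcK conj2V.
Qed.

Lemma ds_eq U s u w p : open U -> (forall p, U p -> u p = w p) -> U p ->
  ds s u p = ds s w p.
Proof. by move=> oU uw Up; rewrite /ds !(cD_eq_on oU uw). Qed.

Lemma ds_comm U s t u p : open U -> csm U u -> U p ->
  ds s (ds t u) p = ds t (ds s u) p.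
Proof.
move=> oU su Up; have c v := csm_cD v su.
have E (a b : C) : ds a (ds b u) p =
   2^-1 * (2^-1 * (cD e1 (cD e1 u) p + b * cD e1 (cD e2 u) p
      + a * cD e2 (cD e1 u) p + a * b * cD e2 (cD e2 u) p)).
  rewrite (dsM a (csm_cst U 2^-1) (csmD oU (c e1) (csmM oU (csm_cst U b) (c e2))) Up).
  rewrite ds_cst (dsD a (c e1) (csmM oU (csm_cst U b) (c e2)) Up).
  rewrite (dsM a (csm_cst U b) (c e2) Up) ds_cst /ds.
  have I (h x0 y0 x y z k : C) : 0 * (x0 + b * y0) +
     h * (h * (x + a * y) + (0 * y0 + b * (h * (z + a * k)))) =
     h * (h * (x + b * z + a * y + a * b * k)) by ring.
  exact: I.
have I (h x y z : C) : h * (h * (x + t * z + s * z + s * t * y)) =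
   h * (h * (x + s * z + t * z + t * s * y)) by ring.
by rewrite !E (cD_comm e1 e2 oU su Up) I.
Qed.

Lemma ds_sum U s (I : Type) (r : seq I) (u : I -> plane -> C) p : open U ->
  (forall i, csm U (u i)) -> U p ->
  ds s (fun q => \sum_(i <- r) u i q) p = \sum_(i <- r) ds s (u i) p.
Proof.
move=> oU su Up; elim: r => [|i r IH].
  by under eq_fun do rewrite big_nil; rewrite ds_cst big_nil.
under eq_fun do rewrite big_cons; rewrite big_cons -IH.
exact: (dsD s (su i) (csm_sum r oU su) Up).
Qed.

Lemma cD_ds u p : cD e1 u p = ds ii u p + ds (- ii) u p /\
  cD e2 u p = - ii * (ds ii u p - ds (- ii) u p).
Proof.
have i2 : ii * ii = -1 :> C by rewrite -expr2 sqr_i.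
have h2 : 2^-1 * 2 = 1 :> C by rewrite mulVf // pnatr_eq0.
rewrite /ds; move: (cD e1 u p) (cD e2 u p) h2 => a b; move: (2^-1) => h h2.
split.
  have -> : h * (a + ii * b) + h * (a + - ii * b) = h * 2 * a.
    by move: (ii : C) => j; ring.
  by rewrite h2 mul1r.
have -> : - ii * (h * (a + ii * b) - h * (a + - ii * b)) =
    - (ii * ii) * (h * 2) * b by move: (ii : C) => j; ring.
by rewrite i2 h2 opprK !mul1r.
Qed.

(** It serves twice: its square is the smooth reciprocal of a positive function, and it rescales a
    nonvanishing function to a phase. *)
Definition rsqrt u q : C := ((Num.sqrt (Re (u q)))^-1)%:C.

Lemma derive_rsqrt (f : plane -> R) p : differentiable f p -> 0 < f p ->
  let r := (fun q => (Num.sqrt (f q))^-1) in differentiable r p /\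
  forall v, 'D_v r p = - 2^-1 * 'D_v f p * (r p) ^+ 3.
Proof.
move=> df f0 r; pose g (x : R) := (Num.sqrt x)^-1.
have sf0 : Num.sqrt (f p) != 0 by rewrite gt_eqF // sqrtr_gt0.
have dg : is_derive (f p) 1 g (- 2^-1 * g (f p) ^+ 3).
  have [dS DS] := is_derive1_sqrt f0; apply: DeriveDef; first exact: derivableV.
  rewrite deriveV // DS /g /GRing.scale /=; move: (Num.sqrt _) sf0 => z z0.
  by field.
have dg' : differentiable g (f p) by apply/derivable1_diffP; case: dg.
split=> [|v]; first exact: (differentiable_comp df dg').
have dr : differentiable r p := differentiable_comp df dg'.
rewrite (deriveE _ dr) (_ : r = g \o f) // diff_comp //= deriv1E; last by case: dg.
rewrite derive1E (@derive_val _ _ _ _ _ _ _ dg) -deriveE //.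
by rewrite /GRing.scale /= mulrCA mulrA.
Qed.

(** The derivative of an inverse square root is a multiple of [cD v u] times its own cube, so
    smoothness of order [n] gives order [n.+1]. *)
Lemma csm_rsqrt U u : open U -> csm U u ->
  (forall p, U p -> 0 < Re (u p) /\ Im (u p) = 0) -> csm U (rsqrt u).
Proof.
move=> oU su u0; elim=> [|n IH].
  split=> // p Up; have [du _] := csm_cdiff su Up; have [u1 _] := u0 p Up.
  by split; [exact: (derive_rsqrt du u1).1|exact: differentiable_cst].
have E v p : U p -> - 2^-1 * cD v u p * (rsqrt u p * (rsqrt u p * rsqrt u p)) =
    cD v (rsqrt u) p.
  move=> Up; have [du _] := csm_cdiff su Up; have [u1 _] := u0 p Up.
  have -> : cD v (rsqrt u) p = ('D_v (fun q => (Num.sqrt (Re (u q)))^-1) p)%:C.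
    by rewrite /cD /rsqrt /= derive_cst.
  rewrite (derive_rsqrt du u1).2 /rsqrt.
  have -> : cD v u p = ('D_v (fun q => Re (u q)) p)%:C.
    rewrite [LHS](cD_eq_on oU _ v Up (w := fun q => (Re (u q))%:C)).
      by rewrite /cD /= derive_cst.
    by move=> q Uq; apply: complex_ext; rewrite //= (u0 q Uq).2.
  have -> : - 2^-1 = (- 2^-1 : R)%:C :> C by rewrite rmorphN fmorphV rmorph_nat.
  by rewrite -3!rmorphM -rmorphM !exprS expr0 mulr1.
split=> [p Up|v].
  exact: (sm_cdiff IH Up).
apply: (sm_eq oU (E v)); apply: smM => //; last by apply: smM => //; apply: smM.
by apply: smM => //; [exact: sm_cst|exact: csm_cD].
Qed.

End Csm.

(** * The connection of a unit lift *)


(* Sealed, for otherwise unification unfolds products. *)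
HB.lock Definition dot (R : realType) (X Y : 'rV[R[i]]_3) : R[i] :=
  \sum_k X 0 k * conjc (Y 0 k).
Notation "⟨ u , v ⟩" := (dot u v) (at level 0, format "⟨ u ,  v ⟩") : ring_scope.

HB.lock Definition dv (R : realType) (s : R[i]) (Z : R * R -> 'rV[R[i]]_3) (p : R * R) :
  'rV[R[i]]_3 := \row_k ds s (fun q => Z q 0 k) p.

(* When F is a local lift of unit length, this is the covariant derivative
   induced by the connection form [<dF, F>]; it makes every formula below
   insensitive to the phase of the lift, so that lifts need not be horizontal. *)
HB.lock Definition nab (R : realType) (F : R * R -> 'rV[R[i]]_3) (s : R[i])
    (Z : R * R -> 'rV[R[i]]_3) (p : R * R) : 'rV[R[i]]_3 :=
  dv s Z p - ⟨dv s F p, F p⟩ *: Z p.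

Section VectorCalculus.
Variable R : realType.
Local Notation C := R[i].
Local Notation V := 'rV[C]_3.
Local Notation plane := (R * R)%type.
Implicit Types (c : plane -> C) (F Z W : plane -> V) (U : set plane).
Implicit Types (p : plane) (s t : C) (X Y : V).

Lemma dotE X Y : ⟨X, Y⟩ = \sum_k X 0 k * conjc (Y 0 k).
Proof. by rewrite dot.unlock. Qed.

Lemma dotmx_dot X Y : @dotmx _ 3 X Y = ⟨X, Y⟩.
Proof. by rewrite dotE dotmxE !mxE; apply: eq_bigr => k _; rewrite !mxE. Qed.

Lemma dotDl X X' Y : ⟨X + X', Y⟩ = ⟨X, Y⟩ + ⟨X', Y⟩.
Proof. by rewrite !dotE -big_split; apply: eq_bigr => k _; rewrite mxE mulrDl. Qed.

Lemma dotZl a X Y : ⟨a *: X, Y⟩ = a * ⟨X, Y⟩.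
Proof. by rewrite !dotE mulr_sumr; apply: eq_bigr => k _; rewrite mxE mulrA. Qed.

Lemma dotJ X Y : conjc ⟨X, Y⟩ = ⟨Y, X⟩.
Proof.
rewrite !dotE raddf_sum; apply: eq_bigr => k _ /=.
by rewrite conjM conjcK mulrC.
Qed.

Lemma dotDr X Y Y' : ⟨X, Y + Y'⟩ = ⟨X, Y⟩ + ⟨X, Y'⟩.
Proof. by rewrite -(dotJ (Y + Y') X) dotDl conjD 2!dotJ. Qed.

Lemma dotZr a X Y : ⟨X, a *: Y⟩ = conjc a * ⟨X, Y⟩.
Proof. by rewrite -(dotJ (a *: Y) X) dotZl conjM dotJ. Qed.

Lemma dotNl X Y : ⟨- X, Y⟩ = - ⟨X, Y⟩.
Proof. by rewrite -scaleN1r dotZl mulN1r. Qed.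

Lemma dotNr X Y : ⟨X, - Y⟩ = - ⟨X, Y⟩.
Proof. by rewrite -(dotJ (- Y) X) dotNl rmorphN /= dotJ. Qed.

Lemma dot_hor a X Y : ⟨a, a⟩ = 1 ->
  ⟨X - ⟨X, a⟩ *: a, Y - ⟨Y, a⟩ *: a⟩ = ⟨X, Y⟩ - ⟨X, a⟩ * ⟨a, Y⟩.
Proof.
move=> F1; rewrite dotDl (dotDr X) dotNl dotNr (dotDr (_ *: a)) dotNr.
rewrite (dotZl _ a Y) (dotZl _ a (_ *: a)) (dotZr _ X a) (dotZr _ a a) dotJ F1.
by move: ⟨X, Y⟩ ⟨X, a⟩ ⟨a, Y⟩ => x y z; ring.
Qed.

Lemma dot0l Y : ⟨0, Y⟩ = 0.
Proof. by rewrite -(scale0r 0) dotZl mul0r. Qed.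

Lemma dot0r Y : ⟨Y, 0⟩ = 0.
Proof. by rewrite -dotJ dot0l conjc0. Qed.

Lemma dot_real X : Im ⟨X, X⟩ = 0.
Proof.
have /(congr1 (fun x => Im x)) := dotJ X X; rewrite cImJ => /eqP.
by rewrite eq_sym -addr_eq0 -mulr2n mulrn_eq0 => /eqP.
Qed.

Lemma dot_eq0 X : ⟨X, X⟩ = 0 -> X = 0.
Proof.
move=> X0; apply/eqP; apply: contraTT isT => /(@dotmx_is_dotmx _ 3).
by rewrite dotmx_dot X0 ltxx.
Qed.

Lemma dvE s Z p k : dv s Z p 0 k = ds s (fun q => Z q 0 k) p.
Proof. by rewrite dv.unlock mxE. Qed.

Definition vsm U Z := forall k, csm U (fun q => Z q 0 k).

Lemma vsmP U Z : vsmooth_on U Z <-> vsm U Z.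
Proof.
split=> H k.
  have /smooth_onP E := H k; move=> n; move: (E n); congr sm.
  by apply/funext => q; case: (Z q 0 k).
apply/smooth_onP => n; move: (H k n); congr sm.
by apply/funext => q; case: (Z q 0 k).
Qed.

Lemma dzE Z : dz Z = dv (- ii) Z.
Proof.
apply/funext => p; apply/rowP => k; rewrite /dz /vderive !(mxE, dvE) /ds /cD.
by rewrite mulNr.
Qed.

Lemma dzbarE Z : dzbar Z = dv ii Z.
Proof. by apply/funext => p; apply/rowP => k; rewrite /dzbar /vderive !(mxE, dvE). Qed.

Lemma vsm_subset U U' Z : U' `<=` U -> vsm U Z -> vsm U' Z.
Proof. by move=> UU sZ k; exact: csm_subset UU (sZ k). Qed.

Lemma vsm_eq U Z W : open U -> (forall p, U p -> Z p = W p) -> vsm U Z -> vsm U W.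
Proof. by move=> oU ZW sZ k; apply: csm_eq (sZ k) => // p Up; rewrite ZW. Qed.

Lemma vsmD U Z W : open U -> vsm U Z -> vsm U W -> vsm U (fun q => Z q + W q).
Proof. by move=> oU sZ sW k; under eq_fun do rewrite mxE; exact: csmD. Qed.

Lemma vsmZ U c Z : open U -> csm U c -> vsm U Z -> vsm U (fun q => c q *: Z q).
Proof. by move=> oU sc sZ k; under eq_fun do rewrite mxE; exact: csmM. Qed.

Lemma vsm_dv U s Z : open U -> vsm U Z -> vsm U (dv s Z).
Proof. by move=> oU sZ k; under eq_fun do rewrite dvE; exact: csm_ds. Qed.

Lemma csm_dot U Z W : open U -> vsm U Z -> vsm U W -> csm U (fun q => ⟨Z q, W q⟩).
Proof.
move=> oU sZ sW; under eq_fun do rewrite dotE; apply: csm_sum => // k.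
by apply: csmM => //; apply: csmJ.
Qed.

Lemma vsm_mulmx U Z (A : 'M[C]_3) : open U -> vsm U Z -> vsm U (fun q => Z q *m A).
Proof.
move=> oU sZ k; under eq_fun do rewrite mxE; apply: csm_sum => // j.
by apply: csmM => //; exact: csm_cst.
Qed.

Lemma dv_eq U s Z W p : open U -> (forall p, U p -> Z p = W p) -> U p ->
  dv s Z p = dv s W p.
Proof.
move=> oU ZW Up; apply/rowP => k; rewrite !(mxE, dvE).
by apply: (ds_eq s oU _ Up) => q Uq; rewrite ZW.
Qed.

Lemma dvD U s Z W p : vsm U Z -> vsm U W -> U p ->
  dv s (fun q => Z q + W q) p = dv s Z p + dv s W p.
Proof.
move=> sZ sW Up; apply/rowP => k; rewrite !(mxE, dvE).
under [X in ds s X]eq_fun do rewrite mxE; exact: (dsD s (sZ k) (sW k) Up).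
Qed.

Lemma dvZ U s c Z p : csm U c -> vsm U Z -> U p ->
  dv s (fun q => c q *: Z q) p = ds s c p *: Z p + c p *: dv s Z p.
Proof.
move=> sc sZ Up; apply/rowP => k; rewrite !(mxE, dvE).
under [X in ds s X]eq_fun do rewrite mxE; exact: (dsM s sc (sZ k) Up).
Qed.

Lemma dv_mulmx U s Z (A : 'M[C]_3) p : open U -> vsm U Z -> U p ->
  dv s (fun q => Z q *m A) p = dv s Z p *m A.
Proof.
move=> oU sZ Up; apply/rowP => k; rewrite !(mxE, dvE).
under [X in ds s X]eq_fun do rewrite mxE.
rewrite (ds_sum s _ oU _ Up) => [|j].
  apply: eq_bigr => j _; rewrite !(mxE, dvE) (dsM s (sZ j) (csm_cst U _) Up).
  by rewrite ds_cst mulr0 addr0.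
by apply: csmM => //; exact: csm_cst.
Qed.

Lemma dv_comm U s t Z p : open U -> vsm U Z -> U p ->
  dv s (dv t Z) p = dv t (dv s Z) p.
Proof.
move=> oU sZ Up; apply/rowP => k; rewrite !(mxE, dvE).
have E a : (fun q => dv a Z q 0 k) = ds a (fun q => Z q 0 k).
  by apply/funext => q; rewrite dvE.
rewrite !E; exact: (ds_comm s t oU (sZ k) Up).
Qed.

Lemma ds_dot U s Z W p : open U -> vsm U Z -> vsm U W -> U p ->
  ds s (fun q => ⟨Z q, W q⟩) p = ⟨dv s Z p, W p⟩ + ⟨Z p, dv (conjc s) W p⟩.
Proof.
move=> oU sZ sW Up; under [X in ds s X]eq_fun do rewrite dotE.
rewrite (ds_sum s _ oU _ Up) => [|k]; last by apply: csmM => //; apply: csmJ.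
rewrite !dotE -big_split; apply: eq_bigr => k _ /=; rewrite !(mxE, dvE).
by rewrite (dsM s (sZ k) (csmJ oU (sW k)) Up) (dsJ s (sW k) Up).
Qed.

Lemma nabE F s Z p : nab F s Z p = dv s Z p - ⟨dv s F p, F p⟩ *: Z p.
Proof. by rewrite nab.unlock. Qed.

Definition unit_on U F := [/\ open U, vsm U F & forall p, U p -> ⟨F p, F p⟩ = 1].

Section Connection.
Variables (U : set plane) (F : plane -> V).
Hypothesis UF : unit_on U F.
Local Notation nab := (nab F).

Lemma vsm_nab s Z : vsm U Z -> vsm U (nab s Z).
Proof.
case: UF => oU sF _ sZ.
have -> : nab s Z = (fun p => dv s Z p - ⟨dv s F p, F p⟩ *: Z p).
  by apply/funext => p; rewrite nabE.
apply: vsmD => //; first exact: vsm_dv.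
under eq_fun do rewrite -scaleNr; apply: vsmZ => //; apply: csmN => //.
by apply: csm_dot => //; exact: vsm_dv.
Qed.

(** Derivative of [⟨F, F⟩ = 1]. The connection form is imaginary on real directions; on a
    complexified direction [s] this relates its values at [s] and at the conjugate of [s]. *)
Lemma conn_skew s p : U p ->
  conjc ⟨dv (conjc s) F p, F p⟩ = - ⟨dv s F p, F p⟩.
Proof.
case: UF => oU sF F1 Up; apply/eqP; rewrite -addr_eq0 addrC dotJ.
rewrite -(ds_dot s oU sF sF Up) (ds_eq s oU (w := fun=> 1) _ Up) ?ds_cst //.
Qed.

Lemma nab_dot s Z W p : vsm U Z -> vsm U W -> U p ->
  ds s (fun q => ⟨Z q, W q⟩) p = ⟨nab s Z p, W p⟩ + ⟨Z p, nab (conjc s) W p⟩.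
Proof.
case: (UF) => oU sF F1 sZ sW Up; rewrite (ds_dot s oU sZ sW Up) !nabE.
rewrite (dotDl (dv s Z p)) (dotDr (Z p)) dotNl dotNr (dotZl _ (Z p)) (dotZr _ (Z p)).
rewrite (conn_skew s Up).
by move: ⟨_, _⟩ ⟨_, _⟩ ⟨_, _⟩ ⟨_, _⟩ => a b c d; ring.
Qed.

Lemma nab_eq s Z W p : (forall p, U p -> Z p = W p) -> U p ->
  nab s Z p = nab s W p.
Proof.
by case: UF => oU _ _ ZW Up; rewrite !nabE (dv_eq s oU ZW Up) ZW.
Qed.

Lemma nabZ s c Z p : csm U c -> vsm U Z -> U p ->
  nab s (fun q => c q *: Z q) p = ds s c p *: Z p + c p *: nab s Z p.
Proof.
move=> sc sZ Up; rewrite !nabE (dvZ s sc sZ Up) scalerBr addrA.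
by rewrite !scalerA mulrC.
Qed.

(** The commutator is multiplication by the curvature of the form [⟨dF, F⟩]. Once the second
    derivatives of [F] cancel, the curvature is a difference of products of horizontal parts, and
    the last hypothesis says that these products agree. *)
Lemma nab_comm s t Z p : vsm U Z -> U p ->
  ⟨nab t F p, nab (conjc s) F p⟩ = ⟨nab s F p, nab (conjc t) F p⟩ ->
  nab s (nab t Z) p = nab t (nab s Z) p.
Proof.
case: (UF) => oU sF F1 sZ Up flat.
have curv : ds s (fun q => ⟨dv t F q, F q⟩) p = ds t (fun q => ⟨dv s F q, F q⟩) p.
  rewrite !(ds_dot _ oU (vsm_dv _ oU sF) sF Up) (dv_comm s t oU sF Up).
  have sk a : ⟨F p, dv (conjc a) F p⟩ = - ⟨dv a F p, F p⟩.
    by rewrite -(conn_skew a Up) dotJ.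
  have := flat; rewrite !nabE (dot_hor _ _ (F1 p Up)) [RHS](dot_hor _ _ (F1 p Up)).
  rewrite (sk s) (sk t) => E; congr (_ + _).
  apply: (addIr (- (⟨dv t F p, F p⟩ * - ⟨dv s F p, F p⟩))).
  by rewrite E; congr (_ - _); rewrite !mulrN mulrC.
have ca a : csm U (fun q => ⟨dv a F q, F q⟩).
  by apply: csm_dot => //; exact: vsm_dv.
have E a b : nab a (nab b Z) p = dv a (dv b Z) p -
    (ds a (fun q => ⟨dv b F q, F q⟩) p *: Z p + ⟨dv b F p, F p⟩ *: dv a Z p
     + ⟨dv a F p, F p⟩ *: (dv b Z p - ⟨dv b F p, F p⟩ *: Z p)).
  have sb := vsm_dv b oU sZ; rewrite nabE nabE.
  have -> : nab b Z = (fun q => dv b Z q + (- 1) *: (⟨dv b F q, F q⟩ *: Z q)).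
    by apply/funext => q; rewrite nabE scaleN1r.
  have sc := vsmZ oU (ca b) sZ.
  rewrite (dvD a sb (vsmZ oU (csm_cst U (-1)) sc) Up) (dvZ a (csm_cst U (-1)) sc Up).
  by rewrite ds_cst scale0r add0r scaleN1r (dvZ a (ca b) sZ Up) [in RHS]opprD addrA.
have I (x y : C) (A B D : V) :
    x *: A + y *: (B - x *: D) = y *: B + x *: (A - y *: D).
  by rewrite !scalerBr !scalerA addrCA [x * y]mulrC.
by rewrite !E curv (dv_comm s t oU sZ Up) -!addrA I.
Qed.

End Connection.
End VectorCalculus.

(** * The moving frame of a minimal Lagrangian lift *)

Section Frame.
Variable R : realType.
Local Notation C := R[i].
Local Notation V := 'rV[C]_3.
Local Notation plane := (R * R)%type.
Variables (U : set plane) (F : plane -> V).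
Hypothesis UF : unit_on U F.

Local Notation P := (nab F (- ii) F).
Local Notation Q := (nab F ii F).

Lemma conji : conjc ii = - ii :> C.
Proof. by apply: complex_ext; rewrite /= ?oppr0. Qed.

Lemma conjNi : conjc (- ii) = ii :> C.
Proof. by rewrite -conji conjcK. Qed.

Lemma nab_hor s p : U p -> ⟨nab F s F p, F p⟩ = 0.
Proof. by case: UF => _ _ F1 Up; rewrite nabE dotDl dotNl dotZl F1 // mulr1 subrr. Qed.

Lemma nab_hor_r s p : U p -> ⟨F p, nab F s F p⟩ = 0.
Proof. by move=> Up; rewrite -dotJ nab_hor // conjc0. Qed.

(** Since [dlift e1 F = P + Q] and [dlift e2 F = i (P - Q)], conformality amounts to [⟨P, Q⟩ = 0]
    and the Lagrangian condition to [⟨Q, Q⟩ = ⟨P, P⟩]; given these, the map is an immersion where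
    [P] does not vanish. *)
Definition lag_on := forall p, U p ->
  [/\ ⟨P p, Q p⟩ = 0, ⟨Q p, Q p⟩ = ⟨P p, P p⟩ & ⟨P p, P p⟩ != 0].

Hypothesis lagF : lag_on.

Let oU : open U. Proof. by case: UF. Qed.
Let sF : vsm U F. Proof. by case: UF. Qed.
Let F1 p : U p -> ⟨F p, F p⟩ = 1. Proof. by case: UF => _ _; apply. Qed.
Let sP : vsm U P. Proof. exact: vsm_nab. Qed.
Let sQ : vsm U Q. Proof. exact: vsm_nab. Qed.

Lemma frame_PQ p : U p -> ⟨P p, Q p⟩ = 0.
Proof. by move=> /lagF []. Qed.

Lemma frame_QP p : U p -> ⟨Q p, P p⟩ = 0.
Proof. by move=> Up; rewrite -dotJ frame_PQ // conjc0. Qed.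

Lemma frame_QQ p : U p -> ⟨Q p, Q p⟩ = ⟨P p, P p⟩.
Proof. by move=> /lagF []. Qed.

Lemma frame_r p : U p -> ⟨P p, P p⟩ != 0.
Proof. by move=> /lagF []. Qed.

(** [⟨Q, Q⟩ = ⟨P, P⟩] is the flatness hypothesis of [nab_comm] for the directions z and conj z. With
    [Z := F] the result is [nab_z Q = nab_zbar P]. *)
Lemma frame_comm Z p : vsm U Z -> U p ->
  nab F (- ii) (nab F ii Z) p = nab F ii (nab F (- ii) Z) p.
Proof.
by move=> sZ Up; apply: (nab_comm UF sZ Up); rewrite conjNi conji frame_QQ.
Qed.

(** The frame matrix times its conjugate transpose is diagonal with entries 1, [⟨P, P⟩], [⟨P, P⟩],
    so pairing with the frame is injective. *)
Lemma frame_complete p X : U p ->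
  ⟨X, F p⟩ = 0 -> ⟨X, P p⟩ = 0 -> ⟨X, Q p⟩ = 0 -> X = 0.
Proof.
move=> Up XF XP XQ.
pose M : 'M[C]_3 := \matrix_(i < 3) (if i == ord0 then F p else if i == ord_max then Q p else P p).
pose N := (map_mx conjc M)^T.
have rowdot Y i : (Y *m N) 0 i = ⟨Y, row i M⟩.
  by rewrite dotE !mxE; apply: eq_bigr => k _; rewrite !mxE.
have [r0 d1 d2] : [/\ row ord0 M = F p, row 1 M = P p & row ord_max M = Q p].
  by split; rewrite rowK.
have XN : X *m N = 0.
  apply/rowP => i; rewrite rowdot [RHS]mxE.
  have : i \in [:: ord0; 1; ord_max] by case: i => [[|[|[|]]]].
  by rewrite !inE => /or3P[] /eqP ->; rewrite ?r0 ?d1 ?d2.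
pose d : 'rV[C]_3 := \row_i (if i == ord0 then 1 else ⟨P p, P p⟩).
have MN : M *m N = diag_mx d.
  apply/row_matrixP => i; rewrite row_mul; apply/rowP => j; rewrite rowdot !mxE.
  have oi : i \in [:: ord0; 1; ord_max] by case: i => [[|[|[|]]]].
  have oj : j \in [:: ord0; 1; ord_max] by case: j => [[|[|[|]]]].
  move: oi oj; rewrite !inE => /or3P[] /eqP -> /or3P[] /eqP ->;
   rewrite ?r0 ?d1 ?d2 /= ?mulr1n ?mulr0n ?F1 ?frame_PQ ?frame_QP ?frame_QQ //
     ?nab_hor ?nab_hor_r //.
have uN : N \in unitmx.
  suff : M *m N \in unitmx by rewrite unitmx_mul => /andP[].
  rewrite MN unitmxE det_diag unitfE; apply/prodf_neq0 => i _; rewrite mxE /=.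
  by case: ifP => _; [exact: oner_neq0|exact: frame_r].
by rewrite -(mulmxK uN X) XN mul0mx.
Qed.

Lemma frame_ext p X Y : U p -> ⟨X, F p⟩ = ⟨Y, F p⟩ -> ⟨X, P p⟩ = ⟨Y, P p⟩ ->
  ⟨X, Q p⟩ = ⟨Y, Q p⟩ -> X = Y.
Proof.
move=> Up a b c; apply/eqP; rewrite -subr_eq0; apply/eqP.
by apply: (frame_complete Up); rewrite dotDl dotNl ?a ?b ?c subrr.
Qed.

Let ds_const s (u : plane -> C) c p : (forall q, U q -> u q = c) -> U p -> ds s u p = 0.
Proof. by move=> uc Up; rewrite (ds_eq s oU (w := fun=> c) uc Up) ds_cst. Qed.

(** Here and in the next lemmas the components of second derivatives come from differentiating the
    orthogonality relations of the frame. *)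
Lemma nab_zbarP_F p : U p -> ⟨nab F ii P p, F p⟩ = - ⟨P p, P p⟩.
Proof.
move=> Up; apply/eqP; rewrite -addr_eq0; apply/eqP.
have := nab_dot UF ii sP sF Up.
by rewrite conji (ds_const _ (@nab_hor _) Up) => <-.
Qed.

Lemma nab_zbarP_Q p : U p -> ⟨nab F ii P p, Q p⟩ = - conjc ⟨nab F ii P p, P p⟩.
Proof.
move=> Up; apply/eqP; rewrite -addr_eq0 dotJ -[X in ⟨P p, X⟩](frame_comm sF Up); apply/eqP.
have := nab_dot UF ii sP sQ Up.
by rewrite conji (ds_const _ frame_PQ Up) => <-.
Qed.

Lemma nab_zP_F p : U p -> ⟨nab F (- ii) P p, F p⟩ = 0.
Proof.
move=> Up; have := nab_dot UF (- ii) sP sF Up.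
by rewrite (ds_const _ (@nab_hor _) Up) conjNi frame_PQ // addr0.
Qed.

Lemma nab_zbarQ_F p : U p -> ⟨nab F ii Q p, F p⟩ = 0.
Proof.
move=> Up; have := nab_dot UF ii sQ sF Up.
by rewrite (ds_const _ (@nab_hor _) Up) conji frame_QP // addr0.
Qed.

(** The harmonic map equation. Its content is that [nab_zbar P] has no component along [P] or [Q];
    the coefficient of [F] is already imposed by [nab_zbarP_F]. *)
Definition minimal_on := forall p, U p -> nab F ii P p = - ⟨P p, P p⟩ *: F p.
Hypothesis minF : minimal_on.

Definition psi q := ⟨nab F (- ii) P q, Q q⟩.
Local Notation r := (fun q => ⟨P q, P q⟩).

Let minQ p : U p -> nab F (- ii) Q p = - ⟨P p, P p⟩ *: F p.
Proof. by move=> Up; rewrite frame_comm // minF. Qed.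

(** Codazzi equation. With [r = ⟨P, P⟩], flatness turns [nab_zbar nab_z P] into [nab_z (- r F)],
    which lies in the span of [F] and [P] and is orthogonal to [Q]. The other term pairs [nab_z P],
    which has no [F] component, with [nab_z Q = - r F]. *)
Lemma psi_holomorphic p : U p -> ds ii psi p = 0.
Proof.
move=> Up; rewrite (nab_dot UF ii (vsm_nab UF _ sP) sQ Up) conji minQ //.
have sr : csm U (fun q => - ⟨P q, P q⟩) by apply: csmN => //; exact: csm_dot.
rewrite -(frame_comm sP Up).
rewrite (nab_eq UF (- ii) (W := fun q => - ⟨P q, P q⟩ *: F q) minF Up).
rewrite (nabZ F (- ii) sr sF Up) dotDl !dotZl dotZr (nab_zP_F Up).
by rewrite (frame_PQ Up) (nab_hor_r _ Up) !mulr0 !addr0.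
Qed.

Lemma nab_zP_P p : U p -> ⟨nab F (- ii) P p, P p⟩ = ds (- ii) r p.
Proof.
move=> Up; rewrite (nab_dot UF (- ii) sP sP Up) conjNi minF // dotZr.
by rewrite nab_hor // mulr0 addr0.
Qed.

Lemma nab_zbarQ_Q p : U p -> ⟨nab F ii Q p, Q p⟩ = ds ii r p.
Proof.
move=> Up; rewrite -(ds_eq ii oU frame_QQ Up) (nab_dot UF ii sQ sQ Up) conji minQ //.
by rewrite dotZr nab_hor // mulr0 addr0.
Qed.

Lemma nab_zbarQ_P p : U p -> ⟨nab F ii Q p, P p⟩ = - conjc (psi p).
Proof.
move=> Up; apply/eqP; rewrite -addr_eq0 dotJ; apply/eqP.
have := nab_dot UF ii sQ sP Up.
by rewrite conji (ds_const _ frame_QP Up) => <-.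
Qed.

Hypothesis psi0 : forall p, U p -> psi p = 0.

Lemma nab_zP p : U p -> nab F (- ii) P p = (ds (- ii) r p / r p) *: P p.
Proof.
move=> Up; apply: (frame_ext Up); rewrite dotZl.
- by rewrite (nab_zP_F Up) (nab_hor _ Up) mulr0.
- by rewrite (nab_zP_P Up) (divfK (frame_r Up)).
- by rewrite (frame_PQ Up) mulr0; exact: psi0.
Qed.

Lemma nab_zbarQ p : U p -> nab F ii Q p = (ds ii r p / r p) *: Q p.
Proof.
move=> Up; apply: (frame_ext Up); rewrite dotZl.
- by rewrite (nab_zbarQ_F Up) (nab_hor _ Up) mulr0.
- by rewrite (nab_zbarQ_P Up) (psi0 Up) conjc0 oppr0 (frame_QP Up) mulr0.
- by rewrite (nab_zbarQ_Q Up) (frame_QQ Up) (divfK (frame_r Up)).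
Qed.

(* [S = E E^T] for the unitary frame [E] with columns [F, (P + Q) / sqrt (2 r)]
   and [i (P - Q) / sqrt (2 r)]. *)
Definition sym_form j k q :=
  F q 0 j * F q 0 k + (P q 0 j * Q q 0 k + Q q 0 j * P q 0 k) / r q.

End Frame.

Section SymForm.
Variable R : realType.
Local Notation C := R[i].
Local Notation V := 'rV[C]_3.
Local Notation plane := (R * R)%type.
Variables (U : set plane) (F : plane -> V).
Hypotheses (UF : unit_on U F) (lagF : lag_on U F) (minF : minimal_on U F).
Hypothesis psi0 : forall p, U p -> psi F p = 0.
Local Notation P := (nab F (- ii) F).
Local Notation Q := (nab F ii F).
Local Notation r := (fun q => ⟨P q, P q⟩).

Let oU : open U. Proof. by case: UF. Qed.
Let sF : vsm U F. Proof. by case: UF. Qed.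
Let sP : vsm U P. Proof. exact: vsm_nab. Qed.
Let sQ : vsm U Q. Proof. exact: vsm_nab. Qed.
Let sr : csm U r. Proof. exact: csm_dot. Qed.

Lemma dot_gt0 (X : V) : ⟨X, X⟩ != 0 -> 0 < Re ⟨X, X⟩.
Proof.
move=> X0; have XX : X != 0 by apply: contraNneq X0 => ->; rewrite dot0l.
by have := @dotmx_is_dotmx _ 3 X XX; rewrite dotmx_dot ltcE => /andP[].
Qed.

Lemma csmV u : csm U u -> (forall p, U p -> 0 < Re (u p) /\ Im (u p) = 0) ->
  csm U (fun q => (u q)^-1).
Proof.
move=> su u0; have s := csm_rsqrt oU su u0.
apply: (csm_eq oU (u := fun q => rsqrt u q * rsqrt u q)); last exact: csmM.
move=> p /u0 [up im]; rewrite /rsqrt -rmorphM -invfM -expr2 sqr_sqrtr ?ltW //.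
by rewrite fmorphV; congr (_^-1); apply: complex_ext.
Qed.

Lemma csm_rV : csm U (fun q => (r q)^-1).
Proof.
apply: csmV sr _ => p Up; split; last exact: dot_real.
by apply: dot_gt0; exact: (frame_r lagF Up).
Qed.

Lemma ds_rV s p : U p -> ds s (fun q => (r q)^-1) p = - (ds s r p / r p / r p).
Proof.
move=> Up; have r0 := frame_r lagF Up.
have := dsM s sr csm_rV Up.
rewrite (ds_eq s oU (w := fun=> 1) _ Up) ?ds_cst => [|q Uq]; last first.
  exact: (mulfV (frame_r lagF Uq)).
move=> /eqP; rewrite eq_sym addrC addr_eq0 => /eqP E.
by rewrite -(mulKf r0 (ds s _ p)) E mulrN mulrC.
Qed.

Lemma csm_sym j k : csm U (sym_form F j k).
Proof.
apply: csmD => //; first exact: csmM.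
by apply: csmM => //; [apply: csmD => //; exact: csmM|exact: csm_rV].
Qed.

Lemma ds_coord s (Z : plane -> V) j p : ds s (fun q => Z q 0 j) p =
  nab F s Z p 0 j + ⟨dv s F p, F p⟩ * Z p 0 j.
Proof. by rewrite nabE !(mxE, dvE) subrK. Qed.

(** The covariant derivative of the form vanishes. Along z, the derivative of [F F^T] cancels
    against the contribution of [nab_z Q = - r F], and the derivative of [1 / r] cancels that of
    [nab_z P]; along conj z the roles of [P] and [Q] are exchanged. The connection form remains,
    twice because the form is quadratic. *)
Lemma ds_sym s j k p : s = ii \/ s = - ii -> U p ->
  ds s (sym_form F j k) p = 2 * ⟨dv s F p, F p⟩ * sym_form F j k p.
Proof.
move=> hs Up; have r0 := frame_r lagF Up.
rewrite (dsD s (csmM oU (sF j) (sF k)) (csmM oU (csmD oU (csmM oU (sP j) (sQ k))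
  (csmM oU (sQ j) (sP k))) csm_rV) Up).
rewrite (dsM s (csmD oU (csmM oU (sP j) (sQ k)) (csmM oU (sQ j) (sP k))) csm_rV Up).
rewrite (dsD s (csmM oU (sP j) (sQ k)) (csmM oU (sQ j) (sP k)) Up).
rewrite (dsM s (sF j) (sF k) Up) (dsM s (sP j) (sQ k) Up) (dsM s (sQ j) (sP k) Up).
rewrite (ds_rV s Up) (ds_coord s F j) (ds_coord s F k) (ds_coord s P j) (ds_coord s P k).
rewrite (ds_coord s Q j) (ds_coord s Q k) /sym_form.
move: (⟨dv s F p, F p⟩) => a.
have I (fj fk pj pk qj qk d x : C) : x != 0 ->
  (pj + a * fj) * fk + fj * (pk + a * fk) +
  (((d / x * pj + a * pj) * qk + pj * (- x * fk + a * qk) +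
   ((- x * fj + a * qj) * pk + qj * (d / x * pk + a * pk))) / x +
   (pj * qk + qj * pk) * - (d / x / x)) =
  2 * a * (fj * fk + (pj * qk + qj * pk) / x) by move=> x0; field.
have I' (fj fk pj pk qj qk d x : C) : x != 0 ->
  (qj + a * fj) * fk + fj * (qk + a * fk) +
  (((- x * fj + a * pj) * qk + pj * (d / x * qk + a * qk) +
   ((d / x * qj + a * qj) * pk + qj * (- x * fk + a * pk))) / x +
   (pj * qk + qj * pk) * - (d / x / x)) =
  2 * a * (fj * fk + (pj * qk + qj * pk) / x) by move=> x0; field.
have Zc (b : C) (X : V) l : (b *: X) 0 l = b * X 0 l by rewrite mxE.
case: hs => ->.
- rewrite (minF Up) (nab_zbarQ UF lagF minF psi0 Up) !Zc; exact: I'.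
- rewrite (nab_zP UF lagF minF psi0 Up) (frame_comm UF lagF sF Up) (minF Up) !Zc.
  exact: I.
Qed.

(** The logarithmic derivative of one factor is twice the connection form, that of the conjugate
    factor its opposite by [conn_skew]. *)
Lemma ds_sym_pair s j k l m p : s = ii \/ s = - ii -> U p ->
  ds s (fun q => sym_form F j k q * conjc (sym_form F l m q)) p = 0.
Proof.
move=> hs Up; have hs' : conjc s = ii \/ conjc s = - ii.
  by case: hs => ->; rewrite ?conji ?conjNi; [right|left].
rewrite (dsM s (csm_sym j k) (csmJ oU (csm_sym l m)) Up) (dsJ s (csm_sym l m) Up).
rewrite !ds_sym // !conjM (conn_skew UF s Up) conjc_nat.
by move: ⟨_, _⟩ (sym_form _ _ _ _) (conjc (sym_form _ _ _ _)) => *; ring.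
Qed.

End SymForm.

(** * Change of phase of the lift *)

Section Gauge.
Variable R : realType.
Local Notation C := R[i].
Local Notation V := 'rV[C]_3.
Local Notation plane := (R * R)%type.
Variables (U : set plane) (F G : plane -> V) (a : plane -> C).
Hypotheses (UF : unit_on U F) (UG : unit_on U G) (sa : csm U a).
Hypothesis FG : forall p, U p -> G p = a p *: F p.

Let oU : open U. Proof. by case: UF. Qed.
Let sF : vsm U F. Proof. by case: UF. Qed.

Lemma gauge_unit p : U p -> a p * conjc (a p) = 1.
Proof.
case: UF UG => _ _ F1 [_ _ G1] Up.
by rewrite -(G1 p Up) (FG Up) dotZl dotZr F1 // mulr1.
Qed.

(** The connection form of [G] exceeds that of [F] by [conj a da], which absorbs the derivative of
    the phase in [W]. *)
Lemma nab_gauge s Z W p : vsm U Z -> (forall p, U p -> W p = a p *: Z p) ->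
  U p -> nab G s W p = a p *: nab F s Z p.
Proof.
move=> sZ WZ Up; have a1 := gauge_unit Up; case: (UF) => _ _ F1.
rewrite !nabE (dv_eq s oU WZ Up) (dv_eq s oU FG Up) (dvZ s sa sZ Up) (dvZ s sa sF Up).
rewrite (FG Up) (WZ p Up) dotDl !dotZl !dotZr F1 // mulr1.
move: (ds s a p) (⟨dv s F p, F p⟩) => d b.
rewrite scalerBr !scalerA.
have -> : (d * conjc (a p) + a p * (conjc (a p) * b)) * a p =
  a p * conjc (a p) * d + a p * conjc (a p) * (a p * b) by ring.
by rewrite a1 !mul1r scalerDl opprD addrA [_ *: Z p + _]addrC addrK.
Qed.

Lemma nab_gauge1 s p : U p -> nab G s G p = a p *: nab F s F p.
Proof. exact: nab_gauge. Qed.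

Lemma dot_gauge (X Y : V) p : U p -> ⟨a p *: X, a p *: Y⟩ = ⟨X, Y⟩.
Proof. by move=> Up; rewrite dotZl dotZr mulrA gauge_unit // mul1r. Qed.

Lemma psi_gauge p : U p -> psi G p = psi F p.
Proof.
move=> Up; rewrite /psi (nab_gauge (- ii) (vsm_nab UF (- ii) sF) (nab_gauge1 (- ii)) Up).
by rewrite (nab_gauge1 ii Up) dot_gauge.
Qed.

Lemma sym_gauge j k p : U p -> sym_form G j k p = a p * a p * sym_form F j k p.
Proof.
move=> Up; rewrite /sym_form !(nab_gauge1 _ Up) dot_gauge // (FG Up).
have Zc (b : C) (X : V) l : (b *: X) 0 l = b * X 0 l by rewrite mxE.
have I (f f' x b u u' v v' : C) : b * f * (b * f') + (b * u * (b * v) + b * u' * (b * v')) / x =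
   b * b * (f * f' + (u * v + u' * v') / x) by ring.
rewrite !Zc; exact: I.
Qed.

Lemma sym_pair_gauge j k l m p : U p ->
  sym_form G j k p * conjc (sym_form G l m p) =
  sym_form F j k p * conjc (sym_form F l m p).
Proof.
move=> Up; have a1 := gauge_unit Up; rewrite !sym_gauge // !conjM.
move: (a p) (conjc (a p)) a1 => b c bc.
move: (sym_form _ _ _ _) (conjc (sym_form _ _ _ _)) => x y.
have -> : b * b * x * (c * c * y) = (b * c) * (b * c) * (x * y) by ring.
by rewrite bc !mul1r.
Qed.

End Gauge.

(** * Rotation of the parameter and of the values *)

Section Rotation.
Variable R : realType.
Local Notation C := R[i].
Local Notation V := 'rV[C]_3.
Local Notation plane := (R * R)%type.
Implicit Types (u : plane -> C) (U : set plane) (p v : plane).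
Variables c n : R.

Definition rot p : plane := (c * p.1 - n * p.2, n * p.1 + c * p.2).

Lemma rotD p v : rot (p + v) = rot p + rot v.
Proof.
case: p v => a b [x y]; congr pair; rewrite /= /GRing.add /=.
  by rewrite -[LHS]/(c * (a + x) - n * (b + y))
   -[RHS]/((c * a - n * b) + (c * x - n * y)); ring.
by rewrite -[LHS]/(n * (a + x) + c * (b + y))
   -[RHS]/((n * a + c * b) + (n * x + c * y)); ring.
Qed.

Lemma rotZ (h : R) v : rot (h *: v) = h *: rot v.
Proof.
case: v => a b; congr pair; rewrite /= /GRing.scale /=.
  by rewrite -[LHS]/(c * (h * a) - n * (h * b)) -[RHS]/(h * (c * a - n * b)); ring.
by rewrite -[LHS]/(n * (h * a) + c * (h * b)) -[RHS]/(h * (n * a + c * b)); ring.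
Qed.

Lemma derive_rot (f : plane -> R) v p : 'D_v (f \o rot) p = 'D_(rot v) f (rot p).
Proof.
have E : (fun h : R => h^-1 *: (((f \o rot) \o shift p) (h *: v) - (f \o rot) p)) =
    (fun h : R => h^-1 *: ((f \o shift (rot p)) (h *: rot v) - f (rot p))).
  by apply/funext => h; rewrite /= rotD rotZ.
by rewrite /derive E.
Qed.

Lemma cD_rot u v p : cD v (u \o rot) p = cD (rot v) u (rot p).
Proof. by rewrite /cD -!derive_rot. Qed.

Lemma differentiable_fst p : differentiable (fst : plane -> R) p.
Proof.
have lin : linear (fst : plane -> R) by [].
pose fL : {linear plane -> R} := HB.pack (fst : plane -> R) (GRing.isLinear.Build _ _ _ _ _ lin).
by apply: (@linear_differentiable _ _ _ fL) => x; exact: cvg_fst.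
Qed.

Lemma differentiable_snd p : differentiable (snd : plane -> R) p.
Proof.
have lin : linear (snd : plane -> R) by [].
pose fL : {linear plane -> R} := HB.pack (snd : plane -> R) (GRing.isLinear.Build _ _ _ _ _ lin).
by apply: (@linear_differentiable _ _ _ fL) => x; exact: cvg_snd.
Qed.

Lemma differentiable_rot p : differentiable rot p.
Proof.
have d1 := differentiable_fst p; have d2 := differentiable_snd p.
exact: (differentiable_pair (differentiableB (differentiableZ c d1) (differentiableZ n d2))
  (differentiableD (differentiableZ n d1) (differentiableZ c d2))).
Qed.

Lemma cdiff_rot u p : cdiff u (rot p) -> cdiff (u \o rot) p.
Proof.
move=> [a b]; have dr := differentiable_rot p.
by split; [exact: (differentiable_comp dr a)|exact: (differentiable_comp dr b)].
Qed.

Lemma sm_rot k U u : sm k U u -> sm k (rot @^-1` U) (u \o rot).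
Proof.
elim: k u => [|k IH] u [du Du]; first by split=> // p /du; exact: cdiff_rot.
split=> [p /du|v]; first exact: cdiff_rot.
have -> : cD v (u \o rot) = cD (rot v) u \o rot.
  by apply/funext => p; rewrite cD_rot.
exact: (IH _ (Du (rot v))).
Qed.

(** The condition [s * s = -1] selects the two Wirtinger derivatives, for which the chain rule
    reduces to a scalar: [c + i n] for the derivative along z, its conjugate for the one along conj
    z. *)
Lemma ds_rot U s u p : s * s = -1 -> csm U u -> U (rot p) ->
  ds s (u \o rot) p = (c%:C - s * n%:C) * ds s u (rot p).
Proof.
move=> s2 su Up; rewrite /ds !cD_rot.
have du := csm_cdiff su Up; rewrite (cD_linear (rot e1) du) (cD_linear (rot e2) du).
have -> : rot e1 = (c, n) by rewrite /rot /= !mulr1 !mulr0 subr0 addr0.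
have -> : rot e2 = (- n, c) by rewrite /rot /= !mulr1 !mulr0 sub0r add0r.
have I (x y h C0 N : C) : h * (C0 * x + N * y + s * (- N * x + C0 * y)) =
    (C0 - s * N) * (h * (x + s * y)) + h * N * y * (s * s + 1) by ring.
by rewrite rmorphN I s2 addNr mulr0 addr0.
Qed.

End Rotation.

Section RotatedLift.
Variable R : realType.
Local Notation C := R[i].
Local Notation V := 'rV[C]_3.
Local Notation plane := (R * R)%type.
Implicit Types (s : C) (u : plane -> C) (U : set plane) (p v : plane) (Z F : plane -> V).
Variables (c n : R) (A : 'M[C]_3).
Hypothesis dotA : forall X Y : V, ⟨X *m A, Y *m A⟩ = ⟨X, Y⟩.
Local Notation rot := (rot c n).
Local Notation turn Z := (fun q => Z (rot q) *m A).

Lemma rot_cvg p : rot q @[q --> p] --> rot p.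
Proof. exact: differentiable_continuous (differentiable_rot c n p). Qed.

Lemma open_rot U : open U -> open (rot @^-1` U).
Proof. by move=> oU; apply: open_comp => // p _; exact: rot_cvg. Qed.

Lemma csm_rot U u : csm U u -> csm (rot @^-1` U) (u \o rot).
Proof. by move=> su k; apply: sm_rot. Qed.

Lemma vsm_rot U Z : open U -> vsm U Z -> vsm (rot @^-1` U) (turn Z).
Proof.
move=> oU sZ; have sR : vsm (rot @^-1` U) (Z \o rot) by move=> k; exact: (csm_rot (sZ k)).
exact: vsm_mulmx (open_rot oU) sR.
Qed.

Lemma dv_rot U s Z p : s * s = -1 -> open U -> vsm U Z -> U (rot p) ->
  dv s (turn Z) p = (c%:C - s * n%:C) *: (dv s Z (rot p) *m A).
Proof.
move=> s2 oU sZ Up; have sR : vsm (rot @^-1` U) (Z \o rot).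
  by move=> k; exact: (csm_rot (sZ k)).
rewrite (dv_mulmx s A (open_rot oU) sR Up) scalemxAl; congr (_ *m A).
by apply/rowP => k; rewrite !(mxE, dvE) -(ds_rot s2 (sZ k) Up).
Qed.

Lemma nab_rot U F s Z p : s * s = -1 -> open U -> vsm U F -> vsm U Z -> U (rot p) ->
  nab (turn F) s (turn Z) p = (c%:C - s * n%:C) *: (nab F s Z (rot p) *m A).
Proof.
move=> s2 oU sF sZ Up.
rewrite !nabE (dv_rot s2 oU sZ Up) (dv_rot s2 oU sF Up) dotZl dotA mulmxBl scalerBr.
by rewrite -scalemxAl scalerA.
Qed.

Lemma unit_on_rot U F : unit_on U F -> unit_on (rot @^-1` U) (turn F).
Proof.
case=> oU sF F1; split; [exact: open_rot|exact: vsm_rot|].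
by move=> p Up; rewrite dotA F1.
Qed.

(** Both derivatives along z contribute [c + i n]. The derivative along conj z contributes the
    conjugate, but stands in the antilinear slot of the product. *)
Lemma psi_rot U F p : unit_on U F -> U (rot p) ->
  psi (turn F) p = (c +i* n) ^+ 3 * psi F (rot p).
Proof.
move=> UF Up; have UG := unit_on_rot UF; case: (UF) => oU sF F1.
have i2 : ii * ii = -1 :> C by rewrite -expr2 sqr_i.
have Ni2 : - ii * - ii = -1 :> C by rewrite mulrNN.
have E1 : c%:C - - ii * n%:C = c +i* n.
  by apply: complex_ext; rewrite /= ?mul0r ?mul1r ?mulr0; ring.
have E2 : conjc (c%:C - ii * n%:C) = c +i* n.
  by apply: complex_ext; rewrite /= ?mul0r ?mul1r ?mulr0; ring.
have sP := vsm_nab UF (- ii) sF.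
rewrite /psi (nab_rot i2 oU sF sF Up) dotZr E2.
have E q : (rot @^-1` U) q -> nab (turn F) (- ii) (turn F) q =
    (c +i* n) *: (nab F (- ii) F (rot q) *m A).
  by move=> Uq; rewrite (nab_rot Ni2 oU sF sF Uq) E1.
rewrite (nab_eq UG (- ii) E Up).
rewrite (nabZ (turn F) (- ii) (csm_cst _ _) (vsm_rot oU sP) Up) ds_cst scale0r add0r.
rewrite (nab_rot Ni2 oU sF sP Up) E1 dotZl dotZl dotA.
by rewrite !exprS expr0 mulr1 !mulrA.
Qed.

End RotatedLift.

(** * Vanishing gradients and punctured neighbourhoods *)

Section Constancy.
Variable R : realType.
Local Notation C := R[i].
Local Notation plane := (R * R)%type.
Implicit Types (u : plane -> C) (U : set plane) (p v : plane).

Lemma cst_of_cD0 u : (forall p, cdiff u p) -> (forall v p, cD v u p = 0) ->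
  forall p q, u p = u q.
Proof.
move=> du Du p q.
have E (f : plane -> R) : (forall x, differentiable f x) ->
    (forall v x, 'D_v f x = 0) -> f p = f q.
  move=> df Df; pose v := q - p.
  have -> : f p = f (p + 0 *: v) by rewrite scale0r addr0.
  have -> : f q = f (p + 1 *: v) by rewrite scale1r /v addrC subrK.
  apply: (@is_derive_0_is_cst _ (fun t : R => f (p + t *: v))) => t.
  by have := line_is_derive (v := v) (df (p + t *: v)); rewrite Df.
apply: complex_ext.
  apply: (E (fun x => Re (u x))) => [x|v x]; first by case: (du x).
  exact: (congr1 (fun z : C => Re z) (Du v x)).
apply: (E (fun x => Im (u x))) => [x|v x]; first by case: (du x).
exact: (congr1 (fun z : C => Im z) (Du v x)).
Qed.

(** Continuity at an isolated exception. It serves at the origin, where [z^3 psi = 0] carries no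
    information, and at the last pole of the sphere. *)
Lemma eq0_of_punctured U u : open U -> U 0 -> cdiff u 0 ->
  (forall p, U p -> p != 0 -> u p = 0) -> u 0 = 0.
Proof.
move=> oU U0 [dR dI] u0.
have E (f : plane -> R) : differentiable f 0 ->
    (forall p, U p -> p != 0 -> f p = 0) -> f 0 = 0.
  move=> /differentiable_continuous cf f0; apply/eqP/negPn/negP => f00.
  have a0 : 0 < `|f 0| by rewrite normr_gt0.
  have N1 : \forall q \near (0 : plane), U q by exact: open_nbhs_nbhs.
  have N2 : \forall q \near (0 : plane), `|f 0 - f q| < `|f 0|.
    by move/cvgrPdist_lt : cf; apply.
  have /nbhs_ballP[d /= d0 Hd] : \forall q \near (0 : plane),
      U q /\ `|f 0 - f q| < `|f 0| by near=> q; split; near: q.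
  have [|Uq] := Hd (d / 2, 0).
    split; rewrite -ball_normE /= sub0r normrN ?normr0 // gtr0_norm ?divr_gt0 //.
    by rewrite ltr_pdivrMr // mulr_natr mulr2n ltrDl.
  rewrite (f0 (d / 2, 0) Uq) ?subr0 ?ltxx //; apply/eqP => -[] /eqP.
  by rewrite mulf_eq0 gt_eqF // invr_eq0 pnatr_eq0.
apply: complex_ext.
  by apply: (E (fun x => Re (u x))) => // p Up p0; rewrite u0.
by apply: (E (fun x => Im (u x))) => // p Up p0; rewrite u0.
Unshelve. all: by end_near. Qed.

End Constancy.

(** * The second fundamental form in a unit lift *)

Section LocalGeometryOfLift.
Variable R : realType.
Local Notation C := R[i].
Local Notation V := 'rV[C]_3.
Local Notation plane := (R * R)%type.
Implicit Types (p v w : plane).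
Variables (g : plane -> CP2 R) (U : set plane) (F : plane -> V).
Hypothesis gF_lift : local_lift g U F.
Local Notation P := (nab F (- ii) F).
Local Notation Q := (nab F ii F).
Local Notation X := (dlift e1 F).
Local Notation Y := (dlift e2 F).
Local Notation cplx v := (v.1 +i* v.2).

Lemma unit_on_lift : unit_on U F.
Proof.
case: gF_lift => oU sF F1; split=> //; first exact/vsmP.
by move=> p /F1 []; rewrite dotmx_dot.
Qed.

Let oU : open U. Proof. by case: unit_on_lift. Qed.
Let sF : vsm U F. Proof. by case: unit_on_lift. Qed.
Let F1 p : U p -> ⟨F p, F p⟩ = 1. Proof. by case: unit_on_lift => _ _; apply. Qed.
Let sP : vsm U P. Proof. exact: (vsm_nab unit_on_lift). Qed.
Let sQ : vsm U Q. Proof. exact: (vsm_nab unit_on_lift). Qed.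

Lemma dv_scale s (b : C) Z p : vsm U Z -> U p ->
  dv s (fun q => b *: Z q) p = b *: dv s Z p.
Proof.
move=> sZ Up; apply: etrans (dvZ s (csm_cst U b) sZ Up) _.
by rewrite ds_cst scale0r add0r.
Qed.

Lemma vderiveE v Z p : vsm U Z -> U p ->
  vderive v Z p = cplx v *: dv (- ii) Z p + conjc (cplx v) *: dv ii Z p.
Proof.
move=> sZ Up; apply/rowP => k; rewrite !(mxE, dvE).
have du := csm_cdiff (sZ k) Up.
rewrite -[LHS]/(cD v (fun q => Z q 0 k) p) (cD_linear v du).
have [-> ->] := cD_ds (fun q => Z q 0 k) p.
have E : cplx v = (v.1)%:C + ii * (v.2)%:C.
  by apply: complex_ext; rewrite /= ?mul0r ?mul1r ?mulr0; ring.
have E' : conjc (cplx v) = (v.1)%:C - ii * (v.2)%:C.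
  by apply: complex_ext; rewrite /= ?mul0r ?mul1r ?mulr0; ring.
rewrite E' E.
have I (a b j x y : C) : a * (x + y) + b * (- j * (x - y)) =
  (a + j * b) * y + (a - j * b) * x by ring.
exact: I.
Qed.

Lemma dliftE v p : U p -> dlift v F p = cplx v *: P p + conjc (cplx v) *: Q p.
Proof.
move=> Up; rewrite /dlift /hor dotmx_dot (vderiveE v sF Up) dotDl !dotZl !nabE.
rewrite !scalerBr !scalerA [in LHS]scalerDl opprD.
by rewrite addrACA.
Qed.

Lemma hor_nab (Z : V) p : U p -> ⟨hor (F p) Z, P p⟩ = ⟨Z, P p⟩ /\
  ⟨hor (F p) Z, Q p⟩ = ⟨Z, Q p⟩.
Proof.
move=> Up; rewrite /hor dotmx_dot !dotDl !dotNl !dotZl.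
by rewrite !(nab_hor_r unit_on_lift _ Up) !mulr0 !subr0.
Qed.

(** The second covariant derivative of [F] along [v] and [w], expanded in the complex directions,
    with its component along [F] still present. *)
Definition hess v w p : V :=
  (cplx v * cplx w) *: nab F (- ii) P p + (cplx v * conjc (cplx w)) *: nab F (- ii) Q p
  + (conjc (cplx v) * cplx w) *: nab F ii P p
  + (conjc (cplx v) * conjc (cplx w)) *: nab F ii Q p.

Lemma cov_identity (A B A' B' S T : V) (n n' w w' a a' : C) :
  n *: (w *: A + w' *: B) + n' *: (w *: A' + w' *: B')
    - (n * a + n' * a') *: (w *: S + w' *: T) =
  (n * w) *: (A - a *: S) + (n * w') *: (B - a *: T) +
  (n' * w) *: (A' - a' *: S) + (n' * w') *: (B' - a' *: T).
Proof.
have I (x y x' y' s t : C) : n * (w * x + w' * y) + n' * (w * x' + w' * y')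
    - (n * a + n' * a') * (w * s + w' * t) =
  n * w * (x - a * s) + n * w' * (y - a * t) +
  n' * w * (x' - a' * s) + n' * w' * (y' - a' * t) by ring.
by apply/rowP => k; rewrite !mxE I.
Qed.

(** The term by which [cov] corrects for a lift that is not horizontal is exactly the connection
    term of [nab]. *)
Lemma covE v w p : U p -> cov v w F p = hor (F p) (hess v w p).
Proof.
move=> Up; have cc c := csm_cst U (c : C).
have s1 := vsmZ oU (cc (cplx w)) sP; have s2 := vsmZ oU (cc (conjc (cplx w))) sQ.
have sW := vsmD oU s1 s2.
have D : dlift w F p = cplx w *: P p + conjc (cplx w) *: Q p by exact: dliftE.
have sL : vsm U (dlift w F).
  exact: (vsm_eq oU (fun q Uq => esym (dliftE w Uq)) sW).
have dL s : dv s (dlift w F) p = cplx w *: dv s P p + conjc (cplx w) *: dv s Q p.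
  apply: etrans (dv_eq s oU (fun q Uq => dliftE w Uq) Up) _.
  apply: etrans (dvD s s1 s2 Up) _.
  by congr (_ + _); [exact: dv_scale sP Up|exact: dv_scale sQ Up].
rewrite /cov (vderiveE v sL Up) 2!dL D (dotmx_dot (vderive v F p)) (vderiveE v sF Up).
have horL : hor (F p) (cplx w *: P p + conjc (cplx w) *: Q p) =
    cplx w *: P p + conjc (cplx w) *: Q p.
  rewrite /hor dotmx_dot dotDl !dotZl !(nab_hor unit_on_lift _ Up).
  by rewrite !mulr0 addr0 scale0r subr0.
(* [dlift w F p] is already horizontal; putting it under [hor] lets one projection cover both
   terms. *)
rewrite -[in X in _ - _ *: X]horL.
have horB (b : C) (S T : V) : hor (F p) S - b *: hor (F p) T = hor (F p) (S - b *: T).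
  have I (x y z t f : C) : x - z * f - b * (y - t * f) = x - b * y - (z - b * t) * f by ring.
  by rewrite /hor 3!dotmx_dot (dotDl S) dotNl dotZl; apply/rowP => k; rewrite !mxE I.
rewrite horB dotDl !dotZl; congr (hor _ _); rewrite /hess !nabE.
exact: cov_identity.
Qed.

End LocalGeometryOfLift.

(** * The geometric hypotheses expressed in the frame *)

Section MinimalLagrangian.
Variable R : realType.
Local Notation C := R[i].
Local Notation V := 'rV[C]_3.
Local Notation plane := (R * R)%type.
Implicit Types (p v w : plane).
Variables (g : plane -> CP2 R) (U : set plane) (F : plane -> V).
Hypothesis gF_lift : local_lift g U F.
Local Notation P := (nab F (- ii) F).
Local Notation Q := (nab F ii F).
Local Notation X := (dlift e1 F).
Local Notation Y := (dlift e2 F).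
Local Notation r := (fun q => ⟨P q, P q⟩).
Let UF := unit_on_lift gF_lift.

Lemma fs_metricE (A B : V) : fs_metric A B = Re ⟨A, B⟩.
Proof. by rewrite -dotmx_dot. Qed.

Lemma kaehlerE (A B : V) : kaehler A B = Im ⟨A, B⟩.
Proof. by rewrite -dotmx_dot. Qed.

Lemma dlift_e1 p : U p -> X p = P p + Q p.
Proof.
move=> Up; rewrite (dliftE gF_lift _ Up) (_ : e1.1 +i* e1.2 = 1) //.
by rewrite conjc1 !scale1r.
Qed.

Lemma dlift_e2 p : U p -> Y p = ii *: (P p - Q p).
Proof.
move=> Up; rewrite (dliftE gF_lift _ Up) (_ : e2.1 +i* e2.2 = ii) //.
by rewrite conji scaleNr [RHS]scalerBr.
Qed.

Lemma dot_XY p : U p ->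
  ⟨X p, X p⟩ = ⟨P p, P p⟩ + ⟨Q p, Q p⟩ + ⟨P p, Q p⟩ + conjc ⟨P p, Q p⟩ /\
  ⟨Y p, Y p⟩ = ⟨P p, P p⟩ + ⟨Q p, Q p⟩ - ⟨P p, Q p⟩ - conjc ⟨P p, Q p⟩ /\
  ⟨X p, Y p⟩ = - ii * (⟨P p, P p⟩ - ⟨Q p, Q p⟩ - ⟨P p, Q p⟩ + conjc ⟨P p, Q p⟩).
Proof.
move=> Up; rewrite dlift_e1 // dlift_e2 //.
have i2 : ii * - ii = 1 :> C by rewrite mulrN -expr2 sqr_i opprK.
move: (P p) (Q p) => A B.
rewrite (dotDl A B) (dotDr A A) (dotDr B A) (dotZl ii) !(dotZr ii) !conji mulrA i2 mul1r.
rewrite (dotDl A B) (dotDl A (- B)) (dotDr A A (- B)) (dotDr (- B)) !dotNl (dotDr B A (- B)) !dotNr.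
rewrite -(dotJ A B); move: ⟨A, A⟩ ⟨B, B⟩ ⟨A, B⟩ (conjc _) => a b c c'.
by split; [ring|split; [ring|move: (ii : C) => j; ring]].
Qed.

Lemma lag_on_lift : immersive g -> conformal g -> isotropic g -> lag_on U F.
Proof.
move=> gi gc gl p Up; have [cE cF] := gc _ _ _ gF_lift Up.
have Li := gl _ _ _ gF_lift Up e1 e2; have [XX [YY XY]] := dot_XY Up.
have {}cE := etrans (esym (congr1 (fun x => Re x) XX))
  (etrans (etrans (esym (fs_metricE _ _)) (etrans cE (fs_metricE _ _)))
    (congr1 (fun x => Re x) YY)).
have {}cF := etrans (esym (congr1 (fun x => Re x) XY)) (etrans (esym (fs_metricE _ _)) cF).
have {}Li := etrans (esym (congr1 (fun x => Im x) XY)) (etrans (esym (kaehlerE _ _)) Li).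
have Pr := dot_real (P p); have Qr := dot_real (Q p).
have [cPQ eQP] : ⟨P p, Q p⟩ = 0 /\ ⟨Q p, Q p⟩ = ⟨P p, P p⟩.
  move: cE cF Li Pr Qr; move: ⟨_, _⟩ ⟨_, _⟩ ⟨_, _⟩ => [a a'] [b b'] [c c'] /=.
  by move=> h1 h2 h3 h4 h5; split; congr Complex; lra.
split=> //; apply/eqP => PP.
have P0 := dot_eq0 PP; have Q0 : Q p = 0 by apply: dot_eq0; rewrite eQP.
have := gi _ _ _ gF_lift Up e1; rewrite dlift_e1 // P0 Q0 addr0 => /(_ erefl) [] /eqP.
by rewrite oner_eq0.
Qed.


Hypothesis lagF : lag_on U F.

Lemma metric_of_lift p : U p -> exists m : R,
  [/\ m != 0, gE F p = m, gG F p = m & gF F p = 0] /\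
  [/\ ⟨X p, X p⟩ = m%:C, ⟨Y p, Y p⟩ = m%:C & ⟨X p, Y p⟩ = 0].
Proof.
move=> Up; have [XX [YY XY]] := dot_XY Up.
have r0 := frame_r lagF Up; have rr := dot_real (P p).
have PQ := frame_PQ lagF Up; have QQ := frame_QQ lagF Up.
have E1 : ⟨P p, P p⟩ + ⟨Q p, Q p⟩ + ⟨P p, Q p⟩ + conjc ⟨P p, Q p⟩ =
    (2 * Re ⟨P p, P p⟩)%:C.
  rewrite PQ QQ conjc0 !addr0 mulrDl mul1r.
  by apply: complex_ext; rewrite ?cReD ?cImD //= rr addr0.
have E2 : ⟨P p, P p⟩ + ⟨Q p, Q p⟩ - ⟨P p, Q p⟩ - conjc ⟨P p, Q p⟩ =
    (2 * Re ⟨P p, P p⟩)%:C by rewrite -E1 PQ conjc0 !subr0 !addr0.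
have E3 : - ii * (⟨P p, P p⟩ - ⟨Q p, Q p⟩ - ⟨P p, Q p⟩ + conjc ⟨P p, Q p⟩) = 0.
  by rewrite PQ QQ conjc0 subr0 addr0 subrr mulr0.
have {}XX := etrans XX E1; have {}YY := etrans YY E2; have {}XY := etrans XY E3.
exists (2 * Re ⟨P p, P p⟩); split; split=> //.
- by rewrite mulf_neq0 ?pnatr_eq0 // gt_eqF // dot_gt0.
- exact: etrans (fs_metricE _ _) (congr1 (fun x => Re x) XX).
- exact: etrans (fs_metricE _ _) (congr1 (fun x => Re x) YY).
- exact: etrans (fs_metricE _ _) (congr1 (fun x => Re x) XY).
Qed.

(** The metric coefficients and the tangent vectors become independent variables, so that the values
    [m], [m], [0] of the coefficients can be substituted for a conformal metric. *)
Definition tangent_coef1 (E G f : R) (A B Z : V) : R :=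
  (G * fs_metric Z A - f * fs_metric Z B) / (E * G - f ^+ 2).
Definition tangent_coef2 (E G f : R) (A B Z : V) : R :=
  (E * fs_metric Z B - f * fs_metric Z A) / (E * G - f ^+ 2).
Definition tangent_defect (E G f : R) (A B Z : V) : V :=
  Z - ((tangent_coef1 E G f A B Z)%:C *: A + (tangent_coef2 E G f A B Z)%:C *: B).

Lemma normal_partE p Z : normal_part F p Z =
  tangent_defect (gE F p) (gG F p) (gF F p) (X p) (Y p) Z.
Proof. by []. Qed.

Lemma tangent_defect0 (m a b : R) (A B : V) : m != 0 -> ⟨A, A⟩ = m%:C ->
  ⟨B, B⟩ = m%:C -> ⟨A, B⟩ = 0 ->
  tangent_defect m m 0 A B (a%:C *: A + b%:C *: B) = 0.
Proof.
move=> m0 AA BB AB; have BA : ⟨B, A⟩ = 0 by rewrite -dotJ AB conjc0.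
rewrite /tangent_defect /tangent_coef1 /tangent_coef2 !fs_metricE !dotDl !dotZl AA BB AB BA !mulr0 add0r addr0.
rewrite -!rmorphM /= !mul0r !subr0 expr0n subr0.
have K (c : R) : m * (c * m) / (m * m) = c by field.
by rewrite !K subrr.
Qed.

Lemma normal_part_tangent (a b : R) p : U p ->
  normal_part F p (a%:C *: X p + b%:C *: Y p) = 0.
Proof.
move=> Up; have [m [[m0 E G f] [XX YY XY]]] := metric_of_lift Up.
by rewrite normal_partE E G f; exact: tangent_defect0.
Qed.

Definition abstract_mean_curvature (E G f : R) (A B c11 c12 c22 : V) : V :=
  ((2 * (E * G - f ^+ 2))^-1)%:C *:
    (G%:C *: tangent_defect E G f A B c11 - (2 * f)%:C *: tangent_defect E G f A B c12
     + E%:C *: tangent_defect E G f A B c22).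

Lemma mean_curvatureE p : mean_curvature F p =
  abstract_mean_curvature (gE F p) (gG F p) (gF F p) (X p) (Y p)
    (cov e1 e1 F p) (cov e1 e2 F p) (cov e2 e2 F p).
Proof. by []. Qed.

Lemma abstract_mean_curvature0 (m : R) (A B c11 c12 c22 : V) : m != 0 ->
  abstract_mean_curvature m m 0 A B c11 c12 c22 = 0 ->
  exists a b : R, c11 + c22 = a%:C *: A + b%:C *: B.
Proof.
move=> m0 /eqP; rewrite /abstract_mean_curvature scaler_eq0 => /orP[|].
  rewrite expr0n subr0 -[0]/((0 : R)%:C) => /eqP /complexI /eqP.
  by rewrite invr_eq0 !mulf_eq0 pnatr_eq0 (negbTE m0).
rewrite mulr0 scale0r subr0 -scalerDr scaler_eq0 => /orP[/eqP/complexI/eqP|].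
  by rewrite (negbTE m0).
rewrite /tangent_defect; move: (tangent_coef1 _ _ _ _ _ c11) (tangent_coef1 _ _ _ _ _ c22).
move: (tangent_coef2 _ _ _ _ _ c11) (tangent_coef2 _ _ _ _ _ c22) => b b' a a'.
rewrite addrACA -opprD subr_eq0 => /eqP H.
exists (a + a'), (b + b').
by rewrite H !rmorphD !scalerDl; exact: addrACA.
Qed.

(** For a conformal metric the trace of [hess] is [4 nab_zbar P], so up to [F] this vector is a real
    combination of [dlift e1 F] and [dlift e2 F]. Such a combination has the form [c P + conj c Q]:
    its products with [P] and [Q] are conjugate. By [nab_zbarP_Q] they are also opposite up to
    conjugation, so both vanish. *)
Lemma minimal_on_lift : zero_mean_curvature g -> minimal_on U F.
Proof.
move=> gm p Up; have [m [[m0 E G f] _]] := metric_of_lift Up.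
have MC := etrans (esym (mean_curvatureE p)) (gm _ _ _ gF_lift Up).
rewrite E G f in MC.
have [a [b]] := abstract_mean_curvature0 m0 MC.
rewrite !(covE gF_lift _ _ Up) dlift_e1 // dlift_e2 // => {MC} H.
have ii2 : ii * ii = -1 :> C by rewrite -expr2 sqr_i.
have h : hess F e1 e1 p + hess F e2 e2 p = 4 *: nab F ii P p.
  have [_ sF _] := UF; rewrite /hess (_ : e1.1 +i* e1.2 = 1) // (_ : e2.1 +i* e2.2 = ii) //.
  rewrite (frame_comm UF lagF sF Up) conjc1 conji mulrNN mulrN mulNr ii2 opprK !mul1r.
  move: (nab _ _ _ _) (nab _ _ _ _) (nab _ _ _ _) => x y z.
  have I (a1 a2 a3 : C) : a1 + a2 + a2 + a3 + (-1 * a1 + a2 + a2 + -1 * a3) = 4 * a2 by ring.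
  by apply/rowP => k; rewrite !scale1r !mxE I.
have dotZ (S : V) : ⟨hor (F p) (hess F e1 e1 p) + hor (F p) (hess F e2 e2 p), S⟩ =
   a%:C * (⟨P p, S⟩ + ⟨Q p, S⟩) + b%:C * (ii * (⟨P p, S⟩ - ⟨Q p, S⟩)).
  rewrite H (dotDl (a%:C *: _)) (dotZl a%:C) (dotZl b%:C) (dotZl ii).
  by rewrite (dotDl (P p) (Q p)) (dotDl (P p) (- Q p)) dotNl.
have horP T := hor_nab gF_lift T Up.
have ZP : 4 * ⟨nab F ii P p, P p⟩ = a%:C * ⟨P p, P p⟩ + b%:C * (ii * ⟨P p, P p⟩).
  rewrite -dotZl -h dotDl -(horP _).1 -(horP (hess F e2 e2 p)).1 -dotDl dotZ.
  by rewrite (frame_QP lagF Up) addr0 subr0.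
have ZQ : 4 * ⟨nab F ii P p, Q p⟩ = a%:C * ⟨P p, P p⟩ + b%:C * (ii * - ⟨P p, P p⟩).
  rewrite -dotZl -h dotDl -(horP _).2 -(horP (hess F e2 e2 p)).2 -dotDl dotZ.
  by rewrite (frame_PQ lagF Up) (frame_QQ lagF Up) add0r sub0r.
have zQ := nab_zbarP_Q UF lagF Up.
have w0 : ⟨nab F ii P p, P p⟩ = 0.
  have := congr1 conjc ZP; rewrite conjM conjc_nat conjD 3!conjM conji !conjc_real (dotJ (P p) (P p)).
  move: ZQ; rewrite zQ => ZQ E1.
  have : 8 * conjc ⟨nab F ii P p, P p⟩ = 0.
    have -> : 8 * conjc ⟨nab F ii P p, P p⟩ = 4 * conjc ⟨nab F ii P p, P p⟩ -
       4 * (- conjc ⟨nab F ii P p, P p⟩) by ring.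
    by rewrite ZQ E1 (_ : - ii * _ = ii * - ⟨P p, P p⟩) ?subrr // mulNr mulrN.
  by move/eqP; rewrite mulf_eq0 pnatr_eq0 /= conjc_eq0 => /eqP.
rewrite w0 conjc0 oppr0 in zQ.
apply: (frame_ext UF lagF Up); rewrite dotZl.
- by rewrite (nab_zbarP_F UF Up); case: UF => _ _ F1; rewrite (F1 _ Up) mulr1.
- by rewrite w0 (nab_hor_r UF _ Up) mulr0.
- by rewrite zQ (nab_hor_r UF _ Up) mulr0.
Qed.

Hypotheses (minF : minimal_on U F) (psi0 : forall p, U p -> psi F p = 0).

Lemma tangent_combination (c : C) p : U p ->
  c *: P p + conjc c *: Q p = (Re c)%:C *: X p + (Im c)%:C *: Y p.
Proof.
move=> Up; rewrite (dlift_e1 Up) (dlift_e2 Up).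
have E : c = (Re c)%:C + (Im c)%:C * ii.
  by apply: complex_ext; rewrite ?cReD ?cImD ?cReM ?cImM /=; ring.
have E' : conjc c = (Re c)%:C - (Im c)%:C * ii.
  by rewrite {1}E conjD conjM !conjc_real conji mulrN.
rewrite E' {1}E; move: (Re c)%:C (Im c)%:C (ii : C) (P p) (Q p) => a b j A B.
have I (x y : C) : (a + b * j) * x + (a - b * j) * y = a * (x + y) + b * (j * (x - y)).
  by ring.
by apply/rowP => k; rewrite !mxE I.
Qed.

(** When [psi] vanishes, [nab_z P] and [nab_zbar Q] are multiples of [P] and [Q] with conjugate
    coefficients, and the mixed derivatives are multiples of [F], which [hor] removes. What is left
    has the form [c P + conj c Q], a real tangent vector. *)
Lemma second_fundamental_form0 v w p : U p -> second_fundamental_form v w F p = 0.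
Proof.
move=> Up; rewrite /second_fundamental_form (covE gF_lift _ _ Up).
have [oU sF F1] := UF.
(* The two Wirtinger derivatives of the real function [r] are conjugate. *)
have kk : ds ii r p = conjc (ds (- ii) r p).
  have sr : csm U r by apply: csm_dot => //; exact: (vsm_nab UF).
  have E : (fun q => conjc ⟨P q, P q⟩) = r by apply/funext => q; exact: dotJ.
  apply: etrans (etrans (dsJ ii sr Up) _); first by rewrite E.
  by rewrite conji.
have rr : conjc ⟨P p, P p⟩ = ⟨P p, P p⟩ by rewrite dotJ.
have horF (a b c d : C) : hor (F p) (a *: P p + b *: F p + c *: F p + d *: Q p) =
    a *: P p + d *: Q p.
  rewrite /hor dotmx_dot !dotDl !dotZl !(nab_hor UF _ Up) (F1 p Up).
  have I (x y z : C) : a * x + b * y + c * y + d * z -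
      (a * 0 + b * 1 + c * 1 + d * 0) * y = a * x + d * z by ring.
  by apply/rowP => k; rewrite !mxE I.
rewrite /hess (nab_zP UF lagF minF psi0 Up) (nab_zbarQ UF lagF minF psi0 Up).
rewrite (frame_comm UF lagF sF Up) (minF Up) !scalerA horF kk.
set c := _ * _ * (_ / _).
rewrite (_ : conjc (v.1 +i* v.2) * conjc (w.1 +i* w.2) * _ = conjc c); last first.
  by rewrite /c (conjM (_ * _) (_ / _)) (conjM (v.1 +i* v.2)) (conjM (ds _ _ _))
    conjc_inv rr.
by rewrite (tangent_combination _ Up); exact: normal_part_tangent.
Qed.

End MinimalLagrangian.

(** * Holomorphic functions with rotational symmetry *)

Section Angular.
Variable R : realType.
Local Notation C := R[i].
Local Notation plane := (R * R)%type.
Implicit Types (u : plane -> C) (U : set plane) (p v : plane).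

Definition zc p : C := p.1 +i* p.2.

Lemma cD_zc v p : cD v zc p = v.1 +i* v.2.
Proof.
have D1 : 'D_v (fst : plane -> R) p = v.1.
  have lin : linear (fst : plane -> R) by [].
  pose fL : {linear plane -> R} := HB.pack (fst : plane -> R) (GRing.isLinear.Build _ _ _ _ _ lin).
  rewrite deriveE; last exact: differentiable_fst.
  by rewrite (@diff_lin _ _ _ fL) // => x; exact: cvg_fst.
have D2 : 'D_v (snd : plane -> R) p = v.2.
  have lin : linear (snd : plane -> R) by [].
  pose fL : {linear plane -> R} := HB.pack (snd : plane -> R) (GRing.isLinear.Build _ _ _ _ _ lin).
  rewrite deriveE; last exact: differentiable_snd.
  by rewrite (@diff_lin _ _ _ fL) // => x; exact: cvg_snd.
exact: (congr2 (@Complex R) D1 D2).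
Qed.

Lemma csm_zc U : csm U zc.
Proof.
have d p : cdiff zc p by split; [exact: differentiable_fst|exact: differentiable_snd].
case=> [|n]; first by split.
split=> // v; have -> : cD v zc = (fun=> v.1 +i* v.2).
  by apply/funext => p; rewrite cD_zc.
exact: sm_cst.
Qed.

Lemma angular_derivative0 (f : plane -> R) p : differentiable f p ->
  (forall t, f (rot (cos t) (sin t) p) = f p) ->
  'D_(- p.2, p.1) f p = 0.
Proof.
move=> df inv; pose g1 (t : R) := cos t * p.1 - sin t * p.2.
pose g2 (t : R) := sin t * p.1 + cos t * p.2.
have dg1 : is_derive (0 : R) 1 g1 (- p.2).
  apply: is_derive_eq; rewrite sin0 cos0.
  by rewrite /GRing.scale /= ?(oppr0, mulr0, mulr1, add0r, sub0r, addr0).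
have dg2 : is_derive (0 : R) 1 g2 p.1.
  apply: is_derive_eq; rewrite sin0 cos0.
  by rewrite /GRing.scale /= ?(oppr0, mulr0, mulr1, add0r, sub0r, addr0).
have d1 : differentiable g1 0 by apply/derivable1_diffP; case: dg1.
have d2 : differentiable g2 0 by apply/derivable1_diffP; case: dg2.
pose gam t : plane := (g1 t, g2 t).
have dgam : differentiable gam 0 by exact: differentiable_pair.
have gam0 : gam 0 = p.
  rewrite /gam /g1 /g2 sin0 cos0 !mul1r !mul0r subr0 add0r.
  by case: (p).
have Dgam : 'd gam 0 1 = (- p.2, p.1) :> plane.
  rewrite (diff_pair d1 d2) -!deriveE //.
  by congr pair; [case: dg1|case: dg2].
have df' : differentiable f (gam 0) by rewrite gam0.
have fg : f \o gam = cst (f p) by apply/funext => t; rewrite -[RHS](inv t).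
have : 'd (f \o gam) 0 (1 : R) = 0 by rewrite fg diff_cst.
have -> : 'd (f \o gam) 0 (1 : R) = 'd f (gam 0) ('d gam 0 (1 : R)).
  by rewrite (diff_comp dgam df').
by rewrite Dgam gam0 deriveE.
Qed.

Lemma angular_cD u p : cdiff u p -> (forall t, u (rot (cos t) (sin t) p) = u p) ->
  (p.1)%:C * cD e2 u p = (p.2)%:C * cD e1 u p.
Proof.
move=> du inv; have [dR dI] := du.
have : cD (- p.2, p.1) u p = 0.
  apply: (congr2 (@Complex R)).
    by apply: (angular_derivative0 dR) => t; rewrite inv.
  by apply: (angular_derivative0 dI) => t; rewrite inv.
rewrite (cD_linear _ du) /= rmorphN mulNr addrC => /eqP; rewrite subr_eq0 => /eqP.
by [].
Qed.

(* A holomorphic function that is invariant under rotations is constant; here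
   it is [z ^ 3 * u], which vanishes at the origin. *)
Lemma cube_mul_eq0 u : (forall p, cdiff u p) -> (forall p, ds ii u p = 0) ->
  (forall t p, (cos t +i* sin t) ^+ 3 * u (rot (cos t) (sin t) p) = u p) ->
  forall p, u p = 0.
Proof.
move=> du hu inv; pose z2 p := zc p * zc p; pose h p := zc p * (z2 p * u p).
have dz p : cdiff zc p by exact: (csm_cdiff (csm_zc setT)).
have dz2 p : cdiff z2 p by exact: cdiffM.
have dzu p : cdiff (fun q => z2 q * u q) p by exact: cdiffM.
have dh p : cdiff h p by exact: cdiffM.
have zr t p : zc (rot (cos t) (sin t) p) = (cos t +i* sin t) * zc p.
  by apply: complex_ext; rewrite ?cReM ?cImM /=; ring.
have hinv t p : h (rot (cos t) (sin t) p) = h p.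
  rewrite /h /z2 zr -[in RHS](inv t p); move: (cos t +i* sin t) (zc p) (u _) => x y v.
  by ring.
have hhol p : cD e1 h p + ii * cD e2 h p = 0.
  have Dh w : cD w h p = cD w zc p * (z2 p * u p) + zc p *
      ((cD w zc p * zc p + zc p * cD w zc p) * u p + z2 p * cD w u p).
    apply: etrans (cDM w (dz p) (dzu p)) _; congr (_ + _ * _).
    apply: etrans (cDM w (dz2 p) (du p)) _; congr (_ * _ + _).
    exact: (cDM w (dz p) (dz p)).
  rewrite !Dh !cD_zc /z2.
  have := hu p; rewrite /ds => /eqP; rewrite mulf_eq0 invr_eq0 pnatr_eq0 /= => /eqP E.
  rewrite (_ : (e1 : plane).1 +i* (e1 : plane).2 = 1) // (_ : (e2 : plane).1 +i* (e2 : plane).2 = ii) //.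
  have ii2 : ii * ii = -1 :> C by rewrite -expr2 sqr_i.
  move: (cD e1 u p) (cD e2 u p) (zc p) (u p) ii2 E; move: (ii : C) => j a b z v jj E.
  have -> : 1 * (z * z * v) + z * ((1 * z + z * 1) * v + z * z * a) +
    j * (j * (z * z * v) + z * ((j * z + z * j) * v + z * z * b)) =
    3 * z * z * v * (1 + j * j) + z * z * z * (a + j * b) by ring.
  by rewrite E jj subrr !mulr0 addr0.
have h0 v p : cD v h p = 0.
  rewrite (cD_linear _ (dh p)).
  have A := angular_cD (dh p) (fun t => hinv t p); have B := hhol p.
  (* The angular equation [x h_y = y h_x] and [h_x = - i h_y] combine to [z h_y = 0]. At [z = 0]
     this is void, and the gradient vanishes because [h] has a multiple zero. *)
  have [z0|z0] := eqVneq (zc p) 0.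
    have Z w : cD w h p = 0.
      by apply: etrans (cDM w (dz p) (dzu p)) _; rewrite /z2 z0 !mul0r mulr0 addr0.
    by rewrite !Z !mulr0 addr0.
  have E1 : cD e1 h p = - ii * cD e2 h p.
    by apply/eqP; rewrite mulNr -addr_eq0; apply/eqP.
  have E2 : cD e2 h p = 0.
    have : zc p * cD e2 h p = 0.
      have -> : zc p = (p.1)%:C + (p.2)%:C * ii.
        by apply: complex_ext; rewrite ?cReD ?cImD ?cReM ?cImM /=; ring.
      by rewrite mulrDl A E1 mulNr mulrN mulrA addNr.
    by move/eqP; rewrite mulf_eq0 (negbTE z0) => /eqP.
  by rewrite E1 E2 !mulr0 addr0.
have hz p : h p = 0.
  by rewrite (cst_of_cD0 dh h0 p 0) /h (_ : zc 0 = 0) // mul0r.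
have off p : p != 0 -> u p = 0.
  move=> p0; have z0 : zc p != 0.
    apply: contra p0 => /eqP [a b]; apply/eqP.
    by case: p a b => x y /= -> ->.
  have /eqP := hz p; rewrite /h /z2 !mulf_eq0 (negbTE z0) /=.
  by move/eqP.
move=> p; have [->|] := eqVneq p 0; last exact: off.
by apply: (@eq0_of_punctured _ setT) => //; [exact: openT|move=> q _; exact: off].
Qed.

End Angular.

(** * Maps equivariant under rotations of the plane *)

Section GlobalPlane.
Variable R : realType.
Local Notation C := R[i].
Local Notation V := 'rV[C]_3.
Local Notation plane := (R * R)%type.
Implicit Types (u : plane -> C) (U : set plane) (p v : plane) (F G : plane -> V).
Variable g : plane -> CP2 R.

Lemma local_lift_sub U U' F : open U' -> U' `<=` U -> local_lift g U F -> local_lift g U' F.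
Proof.
move=> oU' UU [oU sF F1]; split=> // [|p /UU]; last exact: F1.
by apply/vsmP; apply: vsm_subset UU _; exact/vsmP.
Qed.

Lemma lifts_gauge U F G : local_lift g U F -> local_lift g U G ->
  exists2 a : plane -> C, csm U a & forall p, U p -> G p = a p *: F p.
Proof.
move=> hF hG; have [oU sF F1] := unit_on_lift hF; have [_ sG _] := unit_on_lift hG.
exists (fun p => ⟨G p, F p⟩); first exact: csm_dot.
move=> p Up; case: hF => _ _ /(_ p Up) [_ eF]; case: hG => _ _ /(_ p Up) [_ eG].
have /vlineP [k Gk] : G p \in <[F p]>%VS by rewrite -eF eG memv_line.
by rewrite Gk dotZl F1 // mulr1.
Qed.

Hypothesis smooth_g : smooth_map g.

(** The value at [p] is computed in a lift chosen around [p]; on the overlap any other lift differs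
    from it by a smooth phase, to which [E] is insensitive. *)
Lemma descend (E : (plane -> V) -> plane -> C) :
  (forall U F G a, unit_on U F -> unit_on U G -> csm U a ->
    (forall p, U p -> G p = a p *: F p) -> forall p, U p -> E G p = E F p) ->
  exists u, forall U F p, local_lift g U F -> U p -> u p = E F p.
Proof.
move=> inv; have /choice [Fs HF] p : exists F, exists2 U, U p & local_lift g U F.
  by have [U [F [Up hF]]] := smooth_g p; exists F, U.
exists (fun p => E (Fs p) p) => U G p hG Up; have [U' U'p hF] := HF p.
have oW : open (U `&` U') by apply: openI; [case: hG|case: hF].
have hG' := local_lift_sub oW (@subIsetl _ U U') hG.
have hF' := local_lift_sub oW (@subIsetr _ U U') hF.
have [a sa ha] := lifts_gauge hF' hG'.
by rewrite (inv _ _ _ _ (unit_on_lift hF') (unit_on_lift hG') sa ha).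
Qed.

Lemma descend_cdiff (E : (plane -> V) -> plane -> C) u :
  (forall U F p, local_lift g U F -> U p -> u p = E F p) ->
  (forall U F, local_lift g U F -> csm U (E F)) -> forall p, exists U F,
  [/\ local_lift g U F, U p, cdiff u p & forall s, ds s u p = ds s (E F) p].
Proof.
move=> uE sE p; have [U [F [Up hF]]] := smooth_g p.
have oU : open U by case: hF.
have eE q : U q -> E F q = u q by move=> Uq; rewrite (uE U F).
exists U, F; split=> // [|s].
  exact: (csm_cdiff (csm_eq oU eE (sE _ _ hF)) Up).
by apply: (ds_eq s oU _ Up) => q Uq; rewrite eE.
Qed.

Hypotheses (imm_g : immersive g) (conf_g : conformal g) (iso_g : isotropic g).
Hypothesis min_g : zero_mean_curvature g.

Lemma lag_lift U F : local_lift g U F -> lag_on U F.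
Proof. by move=> hF; exact: (lag_on_lift hF imm_g conf_g iso_g). Qed.

Lemma min_lift U F : local_lift g U F -> minimal_on U F.
Proof. by move=> hF; exact: (minimal_on_lift hF (lag_lift hF) min_g). Qed.

Definition preserves_dot (A : 'M[C]_3) := forall X Y : V, ⟨X *m A, Y *m A⟩ = ⟨X, Y⟩.

Hypothesis rot_g : forall t, exists2 A, preserves_dot A &
  forall p (X : V), sval (g (rot (cos t) (sin t) p)) = <[X]>%VS ->
    sval (g p) = <[X *m A]>%VS.

(** The matrix [A] brings the value at the rotated point back to the value at [p], so the rotated
    lift is again a lift of the same map [g]. *)
Lemma lift_rot t A U F : preserves_dot A -> (forall p (X : V),
    sval (g (rot (cos t) (sin t) p)) = <[X]>%VS -> sval (g p) = <[X *m A]>%VS) ->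
  local_lift g U F ->
  local_lift g (rot (cos t) (sin t) @^-1` U) (fun q => F (rot (cos t) (sin t) q) *m A).
Proof.
move=> dA hA hF; have [oW sW W1] := unit_on_rot (cos t) (sin t) dA (unit_on_lift hF).
split=> //; first exact/vsmP.
move=> p Up; split; first by rewrite dotmx_dot W1.
by apply: hA; case: hF => _ _ /(_ _ Up) [].
Qed.

Lemma psi_eq0 U F p : local_lift g U F -> U p -> psi F p = 0.
Proof.
move=> hF Up; have [u uE] := descend (E := @psi R) (fun U F G a UF UG sa FG p Up =>
  psi_gauge UF UG sa FG Up).
rewrite -(uE U F) //.
have sE U' F' : local_lift g U' F' -> csm U' (psi F').
  move=> hF'; have UF := unit_on_lift hF'; have [oU' sF' _] := UF.
  by apply: csm_dot => //; do !apply: (vsm_nab UF).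
have dE := descend_cdiff uE sE.
apply: cube_mul_eq0 => [q|q|t q].
- by have [U' [F' []]] := dE q.
- have [U' [F' [hF' U'q _ ->]]] := dE q.
  exact: (psi_holomorphic (unit_on_lift hF') (lag_lift hF') (min_lift hF') U'q).
(* [F'] computes [u] at the rotated point and its pull-back computes [u] at [q]; [psi_rot] compares
   the two. *)
have [A dA hA] := rot_g t; have [U' [F' [U'q hF']]] := smooth_g (rot (cos t) (sin t) q).
rewrite (uE _ _ _ hF' U'q) (uE _ _ _ (lift_rot dA hA hF') U'q).
by rewrite (psi_rot dA (unit_on_lift hF') U'q).
Qed.

Lemma sff_eq0 : zero_second_fundamental_form g.
Proof.
move=> U F p hF Up v w.
exact: (second_fundamental_form0 hF (lag_lift hF) (min_lift hF)
  (fun q Uq => psi_eq0 hF Uq) v w Up).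
Qed.

(** The two lifts may have disjoint domains: the product descends to a function on the whole plane,
    and its gradient is zero there. *)
Lemma sym_pair_cst U F p U' F' p' j k l m : local_lift g U F -> U p ->
  local_lift g U' F' -> U' p' ->
  sym_form F j k p * conjc (sym_form F l m p) =
  sym_form F' j k p' * conjc (sym_form F' l m p').
Proof.
move=> hF Up hF' Up'.
pose E F p := sym_form F j k p * conjc (sym_form F l m p).
have [u uE] := descend (E := E) (fun U F G a UF UG sa FG p Up =>
  sym_pair_gauge UF UG sa FG j k l m Up).
have sE V' G : local_lift g V' G -> csm V' (E G).
  move=> hG; have UG := unit_on_lift hG; have [oV _ _] := UG.
  by apply: csmM => //; [|apply: csmJ => //]; exact: (csm_sym UG (lag_lift hG)).
have dE := descend_cdiff uE sE.
rewrite -/(E F p) -/(E F' p') -(uE _ _ _ hF Up) -(uE _ _ _ hF' Up').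
apply: cst_of_cD0 => [q|v q]; first by have [V' [G []]] := dE q.
have [V' [G [hG Vq du dsu]]] := dE q.
have z s : s = ii \/ s = - ii -> ds s u q = 0.
  move=> hs; rewrite dsu.
  exact: (ds_sym_pair (unit_on_lift hG) (lag_lift hG) (min_lift hG)
    (fun q Uq => psi_eq0 hG Uq) j k l m hs Vq).
have [E1 E2] := cD_ds u q.
rewrite (cD_linear _ du) E1 E2 (z ii (or_introl erefl)) (z (- ii) (or_intror erefl)).
by rewrite addr0 subrr !mulr0 addr0.
Qed.

End GlobalPlane.

(** * The real form that contains the image *)

Section RealForm.
Variable R : realType.
Local Notation C := R[i].
Local Notation V := 'rV[C]_3.
Local Notation plane := (R * R)%type.
Implicit Types (X Y : V) (A B M : 'M[C]_3).

Definition adj m n (M : 'M[C]_(m, n)) : 'M[C]_(n, m) := (map_mx conjc M)^T.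
Definition unitary A := A *m adj A = 1%:M.

Lemma adjK m n (M : 'M[C]_(m, n)) : adj (adj M) = M.
Proof. by apply/matrixP => i j; rewrite !mxE conjcK. Qed.

Lemma adjM m n l (M : 'M[C]_(m, n)) (N : 'M[C]_(n, l)) : adj (M *m N) = adj N *m adj M.
Proof. by rewrite /adj map_mxM trmx_mul. Qed.

Lemma dot_adj X Y : ⟨X, Y⟩ = (X *m adj Y) 0 0.
Proof. by rewrite dotE !mxE; apply: eq_bigr => k _; rewrite !mxE. Qed.

Lemma unitary_adj A : unitary A -> unitary (adj A).
Proof. by move=> /mulmx1C; rewrite /unitary adjK. Qed.

Lemma unitary_preserves A : unitary A -> preserves_dot A.
Proof. by move=> uA X Y; rewrite !dot_adj adjM mulmxA -(mulmxA X) uA mulmx1. Qed.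

Lemma unitaryM A B : unitary A -> unitary B -> unitary (A *m B).
Proof. by move=> uA uB; rewrite /unitary adjM mulmxA -(mulmxA A) uB mulmx1. Qed.

Lemma unitary_conj A : unitary A -> unitary (map_mx conjc A).
Proof.
move=> uA; rewrite /unitary; have -> : adj (map_mx conjc A) = map_mx conjc (adj A).
  by apply/matrixP => i j; rewrite !mxE.
by rewrite -map_mxM uA map_mx1.
Qed.

Definition rows3 X0 X1 X2 : 'M[C]_3 :=
  \matrix_(i < 3) (if i == ord0 then X0 else if i == ord_max then X2 else X1).

Lemma rows3_unitary X0 X1 X2 :
  ⟨X0, X0⟩ = 1 -> ⟨X1, X1⟩ = 1 -> ⟨X2, X2⟩ = 1 ->
  ⟨X0, X1⟩ = 0 -> ⟨X0, X2⟩ = 0 -> ⟨X1, X2⟩ = 0 -> unitary (rows3 X0 X1 X2).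
Proof.
move=> d0 d1 d2 h01 h02 h12; apply/matrixP => i j.
have -> : (rows3 X0 X1 X2 *m adj (rows3 X0 X1 X2)) i j =
    ⟨row i (rows3 X0 X1 X2), row j (rows3 X0 X1 X2)⟩.
  by rewrite dot_adj !mxE; apply: eq_bigr => k _; rewrite !mxE.
have [h10 h20 h21] : [/\ ⟨X1, X0⟩ = 0, ⟨X2, X0⟩ = 0 & ⟨X2, X1⟩ = 0].
  by rewrite -(dotJ X0 X1) -(dotJ X0 X2) -(dotJ X1 X2) h01 h02 h12 conjc0.
rewrite !rowK mxE.
have oi : i \in [:: ord0; 1; ord_max] by case: i => [[|[|[|]]]].
have oj : j \in [:: ord0; 1; ord_max] by case: j => [[|[|[|]]]].
by move: oi oj; rewrite !inE => /or3P[] /eqP -> /or3P[] /eqP ->.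
Qed.

Lemma rows3_gram X0 X1 X2 j k : ((rows3 X0 X1 X2)^T *m rows3 X0 X1 X2) j k =
  X0 0 j * X0 0 k + X1 0 j * X1 0 k + X2 0 j * X2 0 k.
Proof. by rewrite mxE !big_ord_recl big_ord0 addr0 addrA !mxE /=. Qed.

Section Frame.
Variables (g : plane -> CP2 R) (U : set plane) (F : plane -> V).
Hypotheses (hF : local_lift g U F) (lagF : lag_on U F).
Local Notation P := (nab F (- ii) F).
Local Notation Q := (nab F ii F).
Let UF := unit_on_lift hF.

Lemma conj_sym k p : U p -> \sum_j conjc (F p 0 j) * sym_form F j k p = F p 0 k.
Proof.
move=> Up; have [_ _ F1] := UF.
have -> : \sum_j conjc (F p 0 j) * sym_form F j k p =
    ⟨F p, F p⟩ * F p 0 k + (⟨P p, F p⟩ * Q p 0 k + ⟨Q p, F p⟩ * P p 0 k) / ⟨P p, P p⟩.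
  rewrite !(dotE _ (F p)) !mulr_suml -big_split mulr_suml -big_split.
  have I (a b x y z t h e : C) : a * (b * x + (y * z + t * e) / h) =
      b * a * x + (y * a * z + t * a * e) / h by ring.
  by apply: eq_bigr => j _; rewrite /sym_form I.
by rewrite !(nab_hor UF _ Up) (F1 p Up) mul1r !mul0r addr0 mul0r addr0.
Qed.

(** An explicit Takagi factorization. The factor [ii] in the last row turns the sum of the squares
    of [P + Q] and [i (P - Q)] into a difference, in which only the mixed products of [P] and [Q]
    survive. *)
Lemma sym_unitary p : U p -> exists2 M, unitary M &
  forall j k, (M^T *m M) j k = sym_form F j k p.
Proof.
move=> Up; have [_ _ F1] := UF; have r0 := frame_r lagF Up.
have rr := dot_real (P p); pose m := Re ⟨P p, P p⟩; have m0 : 0 < m := dot_gt0 r0.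
have rm : ⟨P p, P p⟩ = m%:C by apply: complex_ext.
(* Both [P + Q] and [P - Q] have squared length [2 ⟨P, P⟩]. *)
pose s : R := (Num.sqrt (2 * m))^-1.
have ss : s%:C * s%:C * (2 * ⟨P p, P p⟩) = 1.
  rewrite rm -(rmorph_nat (real_complex R) 2) -!rmorphM /=.
  rewrite /s -invfM -expr2 sqr_sqrtr ?mulr_ge0 ?ltW // mulVf //.
  by rewrite mulf_neq0 ?pnatr_eq0 // gt_eqF.
have ii2 : ii * ii = -1 :> C by rewrite -expr2 sqr_i.
have PQ := frame_PQ lagF Up; have QP := frame_QP lagF Up; have QQ := frame_QQ lagF Up.
have PF s' := nab_hor UF s' Up; have FP s' := nab_hor_r UF s' Up.
exists (rows3 (F p) (s%:C *: (P p + Q p)) (s%:C *: (ii *: (P p - Q p)))).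
  apply: rows3_unitary.
  - exact: F1.
  - rewrite dotZl dotZr conjc_real (dotDl (P p)) (dotDr (P p)) (dotDr (Q p)) PQ QP QQ.
    by rewrite addr0 add0r -ss mulr_natl mulr2n mulrA.
  - have D : ⟨P p - Q p, P p - Q p⟩ = 2 * ⟨P p, P p⟩.
      rewrite (dotDl (P p)) (dotDr (P p)) (dotDr (- Q p)) !dotNl !dotNr PQ QP QQ.
      by rewrite oppr0 addr0 opprK add0r mulr_natl mulr2n.
    rewrite (dotZl s%:C) (dotZl ii) (dotZr s%:C) (dotZr ii) conjc_real conji D.
    have I (x d j : C) : x * (j * (x * (- j * d))) = x * x * d * - (j * j) by ring.
    by rewrite I ss ii2 opprK mulr1.
  - by rewrite dotZr (dotDr (F p)) !FP addr0 mulr0.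
  - by rewrite !dotZr (dotDr (F p)) dotNr !FP subr0 !mulr0.
  - rewrite !dotZl !dotZr (dotDl (P p)) (dotDr (P p)) (dotDr (Q p)) !dotNr PQ QP QQ.
    by rewrite oppr0 addr0 add0r subrr !mulr0.
have rV : ⟨P p, P p⟩^-1 = s%:C * s%:C * 2.
  by apply: (mulIf r0); rewrite (mulVf r0) -(mulrA (_ * _) 2) ss.
move=> j k; rewrite rows3_gram /sym_form rV !mxE.
have I (f f' a b a' b' x y : C) :
    f * f' + x * (a + b) * (x * (a' + b')) + x * (y * (a - b)) * (x * (y * (a' - b'))) =
    f * f' + (a * b' + b * a') * (x * x * 2)
      + x * x * (a - b) * (a' - b') * (1 + y * y) by ring.
by rewrite I ii2 subrr mulr0 addr0.
Qed.


End Frame.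
End RealForm.

Section RealImage.
Variable R : realType.
Local Notation C := R[i].
Local Notation V := 'rV[C]_3.
Local Notation plane := (R * R)%type.
Implicit Types (X Y : V) (A B M : 'M[C]_3).

(** The products [X_j conj X_k] do not see the phase of [X], so this is a condition on the spanned
    line; being a polynomial identity, it also passes to limits. *)
Definition real_line X := forall j k, conjc (X 0 j * conjc (X 0 k)) = X 0 j * conjc (X 0 k).

Lemma real_line_of_conj X (c : C) : X = c *: map_mx conjc X -> real_line X.
Proof.
move=> E j k; have Xi i : X 0 i = c * conjc (X 0 i) by rewrite {1}E !mxE.
by rewrite conjM conjcK {1}(Xi k) [in RHS](Xi j) mulrA [conjc _ * c]mulrC.
Qed.

Lemma neq0_coord X : X != 0 -> exists k, X 0 k != 0.
Proof.
move=> X0; apply: contrapT => H; move/eqP: X0; apply; apply/rowP => k.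
rewrite [RHS]mxE; apply/eqP; apply: contrapT => /negP Xk; by apply: H; exists k.
Qed.

Lemma open_neq0 (U : set plane) (u : plane -> C) : open U -> csm U u ->
  open [set q | U q /\ u q != 0].
Proof.
move=> oU su; rewrite openE => q [Uq uq].
have sm : csm U (fun q => u q * conjc (u q)) by apply: csmM => //; exact: csmJ.
have [/differentiable_continuous cf _] := csm_cdiff sm Uq.
have N0 : Re (u q * conjc (u q)) != 0.
  have : u q * conjc (u q) != 0 by rewrite mulf_neq0 // conjc_eq0.
  apply: contraNneq => H; apply/eqP; apply: complex_ext => //.
  by rewrite cImM cImJ cReJ mulrN mulrC addNr.
have N1 : \forall q \near q, U q by exact: open_nbhs_nbhs.
have N2 := cvgr_neq0 _ cf N0.
suff : \forall x \near q, U x /\ u x != 0 by [].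
near=> x; split; first by near: x.
have : Re (u x * conjc (u x)) != 0 by near: x; exact: N2.
by apply: contraNneq => ->; rewrite mul0r.
Unshelve. all: by end_near. Qed.

Section Plane.
Variable g : plane -> CP2 R.
Hypotheses (smooth_g : smooth_map g) (imm_g : immersive g) (conf_g : conformal g).
Hypotheses (iso_g : isotropic g) (min_g : zero_mean_curvature g).
Hypothesis rot_g : forall t, exists2 A, preserves_dot A &
  forall p (X : V), sval (g (rot (cos t) (sin t) p)) = <[X]>%VS ->
    sval (g p) = <[X *m A]>%VS.

(* With [S] as in [sym_form], [conj F *m S = F]; since [S] is constant up to a
   phase and [S = M^T M] at one point, the coordinates of [F] in the basis of
   the rows of [M] are real up to a common phase. *)
Lemma real_frame : exists2 A, unitary A &
  forall U F p, local_lift g U F -> U p -> real_line (F p *m A).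
Proof.
have [U0 [F0 [Up0 hF0]]] := smooth_g 0.
have lag U F (h : local_lift g U F) := lag_lift imm_g conf_g iso_g h.
have [M uM MS] := sym_unitary hF0 (lag _ _ hF0) Up0.
exists (adj M); first exact: unitary_adj.
move=> U F p hF Up; have [_ _ F01] := unit_on_lift hF0.
pose S0 := M^T *m M.
have S0E j k : S0 j k = sym_form F0 j k 0 by exact: MS.
have /existsP[l /existsP[m lm]] : [exists l, exists m, S0 l m != 0].
  apply: contraT; rewrite negb_exists => /forallP H.
  have Z : F0 0 = 0.
    apply/rowP => k; rewrite [RHS]mxE -(conj_sym hF0 k Up0) big1 // => j _.
    rewrite -S0E; move: (H j); rewrite negb_exists => /forallP /(_ k).
    by rewrite negbK => /eqP ->; rewrite mulr0.
  by move: (F01 _ Up0); rewrite Z dot0l => /esym/eqP; rewrite oner_eq0.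
(* Freezing the second factor at the nonzero entry [(l, m)] turns constancy of the products into
   proportionality of [sym_form F] at [p] and [S0]. *)
have T j k : sym_form F j k p * conjc (sym_form F l m p) = S0 j k * conjc (S0 l m).
  rewrite !S0E.
  exact: (sym_pair_cst smooth_g imm_g conf_g iso_g min_g rot_g j k l m hF Up hF0 Up0).
have s0 : conjc (sym_form F l m p) != 0.
  have : sym_form F l m p * conjc (sym_form F l m p) != 0.
    by rewrite T mulf_neq0 // conjc_eq0.
  by rewrite mulf_eq0 negb_or => /andP[].
pose c := conjc (S0 l m) / conjc (sym_form F l m p).
have SE j k : sym_form F j k p = c * S0 j k.
  by rewrite /c mulrAC [conjc (S0 l m) * _]mulrC -T mulfK.
have FE : F p = c *: (map_mx conjc (F p) *m S0).
  apply/rowP => k; rewrite -(conj_sym hF k Up) !mxE mulr_sumr.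
  by apply: eq_bigr => j _; rewrite mxE SE mulrCA.
(* From [F = c conj F M^T M] and unitarity of [M], the vector [F adj M] equals [c conj F M^T], which
   is [c] times its own conjugate. *)
apply: (@real_line_of_conj _ c).
have -> : map_mx conjc (F p *m adj M) = map_mx conjc (F p) *m M^T.
  rewrite map_mxM; congr (_ *m _); apply/matrixP => i j.
  by rewrite !mxE /= conjcK.
by rewrite {1}FE -scalemxAl /S0 -!mulmxA uM mulmx1.
Qed.

(** A unit lift [K] with real coordinates in a unitary basis satisfies [⟨dK, K⟩ = ⟨K, dK⟩], and the
    sum of the two is the derivative of the constant 1. *)
Lemma horizontal_lift_exists p : exists U F, horizontal_lift g U F /\ U p.
Proof.
have [A uA HA] := real_frame; have dA := unitary_preserves uA.
have [U [F [Up hF]]] := smooth_g p; have [oU sF F1] := unit_on_lift hF.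
pose H q := F q *m A.
have sH : vsm U H by exact: vsm_mulmx.
have H1 q : U q -> ⟨H q, H q⟩ = 1 by move=> Uq; rewrite dA F1.
have [j Hj] : exists j, H p 0 j != 0.
  apply: neq0_coord; apply: contra_eq_neq (H1 p Up) => ->.
  by rewrite dot0l eq_sym oner_eq0.
pose u q := H q 0 j; pose U' := [set q | U q /\ u q != 0].
have oU' : open U' by exact: open_neq0 (sH j).
have U'U : U' `<=` U by move=> q [].
have hF' := local_lift_sub oU' U'U hF; have [_ sF' F1'] := unit_on_lift hF'.
have su : csm U' u by exact: csm_subset U'U (sH j).
pose n q := u q * conjc (u q).
have sn : csm U' n by apply: csmM => //; exact: csmJ.
have nreal q : conjc (n q) = n q by rewrite /n conjM conjcK mulrC.
have n0 q : U' q -> 0 < Re (n q) /\ Im (n q) = 0.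
  move=> [_ uq]; split; last by rewrite /n cImM cImJ cReJ mulrN mulrC addNr.
  rewrite /n cReM cReJ cImJ mulrN opprK -!expr2.
  rewrite lt_neqAle addr_ge0 ?sqr_ge0 // andbT eq_sym paddr_eq0 ?sqr_ge0 //.
  rewrite !sqrf_eq0; apply: contra uq => /andP[/eqP a /eqP b].
  by apply/eqP; apply: complex_ext.
(* This phase makes the [j]-th coordinate of [F A] positive; [real_line] then makes the other
   coordinates real. *)
pose a q := conjc (u q) * rsqrt n q.
have sa : csm U' a by apply: csmM => //; [exact: csmJ|exact: csm_rsqrt].
have rn q : U' q -> rsqrt n q * rsqrt n q * n q = 1.
  move=> /n0 [nq iq]; rewrite (_ : n q = (Re (n q))%:C); last exact: complex_ext.
  rewrite /rsqrt -!rmorphM -invfM -expr2 sqr_sqrtr ?ltW // mulVf // gt_eqF //.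
have aa q : U' q -> a q * conjc (a q) = 1.
  move=> U'q; rewrite -(rn q U'q) /a conjM conjcK /rsqrt conjc_real /n.
  by move: (u q) (conjc _) (_%:C) => *; ring.
pose G q := a q *: F q.
have sG : vsm U' G by exact: vsmZ.
have G1 q : U' q -> ⟨G q, G q⟩ = 1.
  by move=> U'q; rewrite dotZl dotZr F1' // mulr1 aa.
have hG : local_lift g U' G.
  split=> //; first exact/vsmP.
  move=> q U'q; split; first by rewrite dotmx_dot G1.
  case: hF' => _ _ /(_ q U'q) [_ ->]; apply/eqP; rewrite eqEsubv.
  have a0 : a q != 0.
    by apply: contra_eq_neq (aa q U'q) => ->; rewrite mul0r eq_sym oner_eq0.
  rewrite -!memvE; apply/andP; split; apply/vlineP.
    by exists (a q)^-1; rewrite scalerA mulVf // scale1r.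
  by exists (a q).
pose K q := G q *m A.
have sK : vsm U' K by exact: vsm_mulmx.
have Kreal q k : U' q -> conjc (K q 0 k) = K q 0 k.
  move=> U'q; have -> : K q 0 k = rsqrt n q * (H q 0 k * conjc (u q)).
    by rewrite /K /G -scalemxAl mxE /a -/(H q); move: (H q 0 k) (u q) => x y; ring.
  rewrite conjM (HA _ _ _ hF (U'U _ U'q)); congr (_ * _).
  exact: conjc_real.
have hor s q : U' q -> ⟨dv s G q, G q⟩ = 0.
  move=> U'q; rewrite -dA -(dv_mulmx s A oU' sG U'q) -/(K q).
  have D : ds s (fun x => ⟨K x, K x⟩) q = 0.
    rewrite (ds_eq s oU' (w := fun=> 1) _ U'q) ?ds_cst // => x U'x.
    by rewrite dA G1.
  move: D; rewrite (ds_dot s oU' sK sK U'q).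
  have -> : ⟨K q, dv (conjc s) K q⟩ = ⟨dv s K q, K q⟩.
    rewrite !dotE; apply: eq_bigr => k _; rewrite !dvE (Kreal q k U'q) mulrC.
    congr (_ * _); rewrite -(dsJ _ (sK k) U'q).
    apply: (ds_eq s oU' _ U'q) => x U'x; exact: Kreal.
  by rewrite -mulr2n -mulr_natl => /eqP; rewrite mulf_eq0 pnatr_eq0 => /eqP.
exists U', G; split; last by split.
split=> // q U'q; rewrite dzE dzbarE.
by split; exact: etrans (dotmx_dot _ _) (hor _ _ U'q).
Qed.

Lemma hopf_psi U F p : horizontal_lift g U F -> U p ->
  @dotmx _ 3 (dz (dz F) p) (dzbar F p) = psi F p.
Proof.
move=> [hF horF] Up; have [oU sF F1] := unit_on_lift hF.
have h s q : s = ii \/ s = - ii -> U q -> ⟨dv s F q, F q⟩ = 0.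
  move=> hs /horF; rewrite dzE dzbarE => -[a b]; case: hs => ->.
    exact: etrans (esym (dotmx_dot _ _)) b.
  exact: etrans (esym (dotmx_dot _ _)) a.
have N s (Z : plane -> V) q : s = ii \/ s = - ii -> U q -> nab F s Z q = dv s Z q.
  by move=> hs Uq; rewrite nabE h // scale0r subr0.
have i1 : ii = ii :> C \/ ii = - ii :> C by left.
have i2 : - ii = ii :> C \/ - ii = - ii :> C by right.
apply: etrans (dotmx_dot _ _) _; rewrite !dzE dzbarE /psi.
rewrite (N _ _ _ i1 Up) (N _ _ _ i2 Up).
by rewrite (dv_eq (- ii) oU (fun q Uq => N _ F q i2 Uq) Up).
Qed.

Lemma hopf_eq0 : zero_hopf_differential g.
Proof.
have z := psi_eq0 smooth_g imm_g conf_g iso_g min_g rot_g.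
move=> p c; split=> [[U [F [hF Up ->]]]|->].
  by rewrite (hopf_psi hF Up); case: hF => hF _; exact: (z _ _ _ hF Up).
(* The value 0 has to be attained by some horizontal lift around [p]. *)
have [U [F [hF Up]]] := horizontal_lift_exists p.
exists U, F; split=> //; rewrite (hopf_psi hF Up).
by case: hF => hF _; rewrite (z _ _ _ hF Up).
Qed.

End Plane.
End RealImage.

(** * Isometries of the complex projective plane *)

Section Lines.
Variable R : realType.
Local Notation C := R[i].
Local Notation V := 'rV[C]_3.
Implicit Types (K L : CP2 R) (u v : V) (A : 'M[C]_3).

Lemma CP2_neq0 L u : sval L = <[u]>%VS -> u != 0.
Proof.
move=> E; have := svalP L; rewrite /= E dim_vline.
by case: (u != 0).
Qed.

Lemma vline_scale (k : C) u : k != 0 -> <[k *: u]>%VS = <[u]>%VS.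
Proof.
move=> k0; apply/eqP; rewrite eqEsubv -!memvE; apply/andP; split; apply/vlineP.
  by exists k.
by exists k^-1; rewrite scalerA mulVf // scale1r.
Qed.

Lemma CP2_pick L : vpick (sval L) != 0 /\ sval L = <[vpick (sval L)]>%VS.
Proof.
have d := eqP (svalP L); have n0 : vpick (sval L) != 0.
  by rewrite vpick0; apply/eqP => E; move: d; rewrite E dimv0.
split=> //; apply/eqP; rewrite eq_sym eqEdim -memvE memv_pick dim_vline n0.
by rewrite d.
Qed.

Lemma CP2_ext K L u : sval K = <[u]>%VS -> sval L = <[u]>%VS -> K = L.
Proof. by move=> EK EL; apply: val_inj; rewrite /= EK EL. Qed.

Lemma pick_line L u : sval L = <[u]>%VS ->
  exists2 k : C, k != 0 & vpick (sval L) = k *: u.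
Proof.
move=> E; have [n0 _] := CP2_pick L.
have /vlineP [k kE] : vpick (sval L) \in <[u]>%VS by rewrite -E memv_pick.
by exists k => //; apply: contraNneq n0 => k0; rewrite kE k0 scale0r.
Qed.

Lemma exists_line u : u != 0 -> exists L : CP2 R, sval L = <[u]>%VS.
Proof.
move=> u0; have d : \dim <[u]>%VS == 1%N by rewrite dim_vline u0.
by exists (exist (fun W : {vspace V} => \dim W == 1%N) _ d).
Qed.

Lemma rcM (a b : R) : (a * b)%:C = a%:C * b%:C.
Proof. exact: rmorphM. Qed.

Lemma rcB (a b : R) : (a - b)%:C = a%:C - b%:C.
Proof. exact: rmorphB. Qed.

(** This squared modulus and the squared length [nrm] keep the identities below polynomial. *)
Definition sqn (z : C) : R := Re z ^+ 2 + Im z ^+ 2.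

Lemma sqnE z : (sqn z)%:C = z * conjc z.
Proof. by apply: complex_ext; rewrite ?cReM ?cImM ?cReJ ?cImJ /sqn /=; ring. Qed.

Lemma sqnM (y z : C) : sqn (y * z) = sqn y * sqn z.
Proof. by rewrite /sqn cReM cImM; ring. Qed.

Lemma sqnJ (z : C) : sqn (conjc z) = sqn z.
Proof. by rewrite /sqn cReJ cImJ sqrrN. Qed.

Lemma sqn_ge0 (z : C) : 0 <= sqn z.
Proof. by rewrite addr_ge0 // sqr_ge0. Qed.

Lemma sqn_eq0 (z : C) : (sqn z == 0) = (z == 0).
Proof.
by rewrite /sqn paddr_eq0 ?sqr_ge0 // !sqrf_eq0 eq_complex.
Qed.

Definition nrm u : R := Re ⟨u, u⟩.

Lemma nrmE u : (nrm u)%:C = ⟨u, u⟩.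
Proof. by apply: complex_ext => //=; rewrite dot_real. Qed.

Lemma nrm_gt0 u : u != 0 -> 0 < nrm u.
Proof. by move=> u0; apply: dot_gt0; apply: contraNneq u0 => /dot_eq0 ->. Qed.

Lemma nrm_ge0 u : 0 <= nrm u.
Proof.
have [->|/nrm_gt0/ltW //] := eqVneq u 0.
by rewrite /nrm dot0l.
Qed.

Lemma nrmZ (k : C) u : nrm (k *: u) = sqn k * nrm u.
Proof.
by apply: complexI; rewrite rcM !nrmE sqnE dotZl dotZr mulrA.
Qed.

Lemma cauchy_schwarz u v : v != 0 -> sqn ⟨u, v⟩ <= nrm u * nrm v.
Proof.
move=> v0; have b0 := nrm_gt0 v0; pose w := ⟨v, v⟩ *: u - ⟨u, v⟩ *: v.
have E : nrm w = nrm v * (nrm u * nrm v - sqn ⟨u, v⟩).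
  apply: complexI; rewrite !(rcM, rcB) !nrmE sqnE /w.
  rewrite (dotDl (⟨v, v⟩ *: u)) (dotDr (_ *: u)) (dotDr (- _)) !dotNl !dotNr.
  rewrite !dotZl !dotZr (dotJ v v) -(dotJ u v).
  by move: ⟨u, u⟩ ⟨v, v⟩ ⟨u, v⟩ (conjc _) => a b c d; ring.
by have := nrm_ge0 w; rewrite E pmulr_rge0 // subr_ge0.
Qed.

Lemma fs_distE K L u v : sval K = <[u]>%VS -> sval L = <[v]>%VS ->
  fs_dist K L = acos (Num.sqrt (sqn ⟨u, v⟩ / (nrm u * nrm v))).
Proof.
move=> EK EL; have [k k0 kE] := pick_line EK; have [l l0 lE] := pick_line EL.
have un := nrm_gt0 (CP2_neq0 EK); have vn := nrm_gt0 (CP2_neq0 EL).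
have H (x y : V) : Re `|@dotmx _ 3 x y| / Num.sqrt (Re (@dotmx _ 3 x x) * Re (@dotmx _ 3 y y)) =
    Num.sqrt (sqn ⟨x, y⟩ / (nrm x * nrm y)).
  rewrite !dotmx_dot normc_def [RHS]sqrtrM ?sqn_ge0 // sqrtrV //.
  by rewrite mulr_ge0 // nrm_ge0.
rewrite /fs_dist H kE lE; congr (acos (Num.sqrt _)).
rewrite dotZl dotZr !sqnM sqnJ !nrmZ.
have k1 : sqn k != 0 by rewrite sqn_eq0.
have l1 : sqn l != 0 by rewrite sqn_eq0.
by field; rewrite k1 l1 !gt_eqF.
Qed.

(** By Cauchy-Schwarz the quotients lie in [[0, 1]], where [acos] of the square root is injective.
    Preserving the distance thus becomes preserving transition probabilities. *)
Lemma fs_dist_inj K L K' L' u v u' v' : sval K = <[u]>%VS -> sval L = <[v]>%VS ->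
  sval K' = <[u']>%VS -> sval L' = <[v']>%VS -> fs_dist K L = fs_dist K' L' ->
  sqn ⟨u, v⟩ / (nrm u * nrm v) = sqn ⟨u', v'⟩ / (nrm u' * nrm v').
Proof.
move=> EK EL EK' EL'; rewrite (fs_distE EK EL) (fs_distE EK' EL').
have B (x y : V) : x != 0 -> y != 0 -> 0 <= sqn ⟨x, y⟩ / (nrm x * nrm y) <= 1.
  move=> x0 y0; have xy : 0 < nrm x * nrm y by rewrite mulr_gt0 // nrm_gt0.
  apply/andP; split; first by apply: divr_ge0; [exact: sqn_ge0|exact: ltW].
  by rewrite (ler_pdivrMr _ _ xy) mul1r; exact: cauchy_schwarz.
have /andP[a0 a1] := B _ _ (CP2_neq0 EK) (CP2_neq0 EL).
have /andP[b0 b1] := B _ _ (CP2_neq0 EK') (CP2_neq0 EL').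
move: (_ / _) (_ / _) a0 a1 b0 b1 => a b a0 a1 b0 b1 /(congr1 cos).
have I (x : R) : 0 <= x -> x <= 1 -> cos (acos (Num.sqrt x)) = Num.sqrt x.
  move=> x0 x1; rewrite acosK // in_itv /= (le_trans _ (sqrtr_ge0 _)) ?lerN10 //=.
  by rewrite -[leRHS]sqrtr1 ler_sqrt.
by rewrite !I // => /(congr1 (fun x => x ^+ 2)); rewrite !sqr_sqrtr.
Qed.

(** The default [L] concerns matrices that kill the line; for unitary [A] the image is always a
    line, see [act_line]. *)
Definition act A L : CP2 R := insubd L (<[vpick (sval L) *m A]>%VS : {vspace V}).

Lemma mulmx_unitary_neq0 A u : unitary A -> u != 0 -> u *m A != 0.
Proof.
move=> uA; apply: contra => /eqP E; apply/eqP.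
by rewrite -[u]mulmx1 -uA mulmxA E mul0mx.
Qed.

Lemma act_line A L u : unitary A -> sval L = <[u]>%VS -> sval (act A L) = <[u *m A]>%VS.
Proof.
move=> uA E; have u0 := CP2_neq0 E; have [k k0 kE] := pick_line E.
rewrite /act kE -scalemxAl vline_scale // -[sval _]/(val _) insubdK //.
by rewrite unfold_in /= dim_vline mulmx_unitary_neq0.
Qed.

Lemma act_isometry A : unitary A -> fs_isometry (act A).
Proof.
move=> uA; have uA' := unitary_adj uA; have A1 : adj A *m A = 1%:M.
  by have := uA'; rewrite /unitary adjK.
have K1 B B' L : unitary B -> unitary B' -> B *m B' = 1%:M -> act B' (act B L) = L.
  move=> uB uB' BB; have [_ E] := CP2_pick L.
  apply: (CP2_ext (u := vpick (sval L))) => //.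
  by rewrite (act_line uB' (act_line uB E)) -mulmxA BB mulmx1.
split.
  split=> //.
    by move=> K L _ _ E; rewrite -(K1 A (adj A) K) // E K1.
  by move=> L _; exists (act (adj A) L) => //; rewrite K1.
move=> K L; have [_ EK] := CP2_pick K; have [_ EL] := CP2_pick L.
rewrite (fs_distE EK EL) (fs_distE (act_line uA EK) (act_line uA EL)).
by rewrite /nrm !(unitary_preserves uA).
Qed.

(** Multiplying [u] by the conjugate of a nonzero coordinate makes all its coordinates real. *)
Lemma RP2_of_real_line L u : sval L = <[u]>%VS -> real_line u -> RP2 L.
Proof.
move=> E ru; have [k uk] := neq0_coord (CP2_neq0 E).
pose x : 'rV[R]_3 := \row_j Re (u 0 j * conjc (u 0 k)).
have xE : map_mx (real_complex R) x = conjc (u 0 k) *: u.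
  apply/rowP => j; rewrite !mxE mulrC; apply: complex_ext => //=.
  have /(congr1 (fun z : C => Im z)) := ru j k; rewrite cImJ => /eqP.
  by rewrite eq_sym -addr_eq0 -mulr2n mulrn_eq0 mulrC => /eqP ->.
have uk' : conjc (u 0 k) != 0 by rewrite conjc_eq0.
exists x; last by rewrite xE vline_scale.
apply/eqP => x0; move: xE; rewrite x0 map_mx0 => /esym/eqP.
by rewrite scaler_eq0 (negbTE uk') (negbTE (CP2_neq0 E)).
Qed.

End Lines.

(** * Wigner's theorem for CP^2 *)

Section WignerCore.
Variable R : realType.
Local Notation C := R[i].
Local Notation V := 'rV[C]_3.
Implicit Types (u v w : V) (rho : V -> V).

(* The real and imaginary parts of [u_j * conj u_k]. *)
Definition rx (j k : 'I_3) u : R := Re (u 0 j) * Re (u 0 k) + Im (u 0 j) * Im (u 0 k).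
Definition ix (j k : 'I_3) u : R := Im (u 0 j) * Re (u 0 k) - Re (u 0 j) * Im (u 0 k).
Local Notation i0 := (ord0 : 'I_3).
Local Notation i1 := (1 : 'I_3).
Local Notation i2 := (ord_max : 'I_3).

Lemma big3 (T : nmodType) (f : 'I_3 -> T) : \sum_k f k = f i0 + f i1 + f i2.
Proof.
rewrite !big_ord_recl big_ord0 addr0 addrA.
by congr (_ + f _ + f _); apply: val_inj.
Qed.

(** This is the trace pairing of the Hermitian matrices [u_j conj u_k] and [w_j conj w_k]. For a
    fixed test vector [w] it is one linear equation in the entries of the matrix of [u]. *)
Lemma sqn_dotE u w : sqn ⟨u, w⟩ =
  rx i0 i0 u * rx i0 i0 w + rx i1 i1 u * rx i1 i1 w + rx i2 i2 u * rx i2 i2 w +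
  2 * (rx i0 i1 u * rx i0 i1 w + ix i0 i1 u * ix i0 i1 w +
       rx i0 i2 u * rx i0 i2 w + ix i0 i2 u * ix i0 i2 w +
       rx i1 i2 u * rx i1 i2 w + ix i1 i2 u * ix i1 i2 w).
Proof.
rewrite dotE big3 /sqn !(cReD, cImD) !cReM !cImM !cReJ !cImJ /rx /ix.
move: (Re (u 0 i0)) (Im (u 0 i0)) (Re (u 0 i1)) (Im (u 0 i1)) (Re (u 0 i2)) (Im (u 0 i2)).
move: (Re (w 0 i0)) (Im (w 0 i0)) (Re (w 0 i1)) (Im (w 0 i1)) (Re (w 0 i2)) (Im (w 0 i2)).
by move=> *; ring.
Qed.

(** Vanishing of 2 by 2 minors: the matrix of [u] has rank one. This and the next two identities
    recover entries of the images of the test vectors that the linear equations leave open. *)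
Lemma rank_one j k u : rx j k u ^+ 2 + ix j k u ^+ 2 = rx j j u * rx k k u.
Proof. by rewrite /rx /ix; ring. Qed.

Lemma rank_one_ix02 u : ix i0 i2 u * rx i1 i1 u =
  rx i0 i1 u * ix i1 i2 u + ix i0 i1 u * rx i1 i2 u.
Proof. by rewrite /rx /ix; ring. Qed.

Lemma rank_one_ix12 u : ix i1 i2 u * rx i0 i0 u =
  rx i0 i1 u * ix i0 i2 u - ix i0 i1 u * rx i0 i2 u.
Proof. by rewrite /rx /ix; ring. Qed.

Definition test_vector (x y z : C) : V :=
  \row_k (if k == i0 then x else if k == i1 then y else z).

Lemma tv0 x y z : test_vector x y z 0 i0 = x. Proof. by rewrite mxE. Qed.
Lemma tv1 x y z : test_vector x y z 0 i1 = y. Proof. by rewrite mxE. Qed.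
Lemma tv2 x y z : test_vector x y z 0 i2 = z. Proof. by rewrite mxE. Qed.

Lemma sqn_dot_tv u a0 b0 a1 b1 a2 b2 :
  sqn ⟨u, test_vector (a0 +i* b0) (a1 +i* b1) (a2 +i* b2)⟩ =
  rx i0 i0 u * (a0 * a0 + b0 * b0) + rx i1 i1 u * (a1 * a1 + b1 * b1) +
  rx i2 i2 u * (a2 * a2 + b2 * b2) +
  2 * (rx i0 i1 u * (a0 * a1 + b0 * b1) + ix i0 i1 u * (b0 * a1 - a0 * b1) +
       rx i0 i2 u * (a0 * a2 + b0 * b2) + ix i0 i2 u * (b0 * a2 - a0 * b2) +
       rx i1 i2 u * (a1 * a2 + b1 * b2) + ix i1 i2 u * (b1 * a2 - a1 * b2)).
Proof.
have E w : sqn ⟨u, w⟩ = rx i0 i0 u * rx i0 i0 w + rx i1 i1 u * rx i1 i1 w + rx i2 i2 u * rx i2 i2 w +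
  2 * (rx i0 i1 u * rx i0 i1 w + ix i0 i1 u * ix i0 i1 w +
       rx i0 i2 u * rx i0 i2 w + ix i0 i2 u * ix i0 i2 w +
       rx i1 i2 u * rx i1 i2 w + ix i1 i2 u * ix i1 i2 w) by exact: sqn_dotE.
by rewrite E; congr (_ * _ + _ * _ + _ * _ + 2 * (_ * _ + _ * _ + _ * _ + _ * _ + _ * _ + _ * _));
  rewrite /rx /ix ?tv0 ?tv1 ?tv2.
Qed.

Section TestVectorValues.
Variables a0 b0 a1 b1 a2 b2 : R.
Local Notation w := (test_vector (a0 +i* b0) (a1 +i* b1) (a2 +i* b2)).

Lemma rx_tv : [/\ rx i0 i0 w = a0 * a0 + b0 * b0, rx i1 i1 w = a1 * a1 + b1 * b1 &
  rx i2 i2 w = a2 * a2 + b2 * b2] /\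
  [/\ rx i0 i1 w = a0 * a1 + b0 * b1, rx i0 i2 w = a0 * a2 + b0 * b2 &
  rx i1 i2 w = a1 * a2 + b1 * b2].
Proof. by rewrite /rx tv0 tv1 tv2. Qed.

Lemma ix_tv : [/\ ix i0 i1 w = b0 * a1 - a0 * b1, ix i0 i2 w = b0 * a2 - a0 * b2 &
  ix i1 i2 w = b1 * a2 - a1 * b2].
Proof. by rewrite /ix tv0 tv1 tv2. Qed.

End TestVectorValues.

(** Equality up to a phase; it compares the Hermitian matrices, so that lengths are retained. *)
Definition same u v := forall j k, rx j k u = rx j k v /\ ix j k u = ix j k v.

Lemma same6 u v : rx i0 i0 u = rx i0 i0 v -> rx i1 i1 u = rx i1 i1 v ->
  rx i2 i2 u = rx i2 i2 v -> rx i0 i1 u = rx i0 i1 v -> ix i0 i1 u = ix i0 i1 v ->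
  rx i0 i2 u = rx i0 i2 v -> ix i0 i2 u = ix i0 i2 v ->
  rx i1 i2 u = rx i1 i2 v -> ix i1 i2 u = ix i1 i2 v -> same u v.
Proof.
move=> d0 d1 d2 r01 s01 r02 s02 r12 s12 j k.
have rC a b (x : V) : rx a b x = rx b a x by rewrite /rx; ring.
have iC a b (x : V) : ix a b x = - ix b a x by rewrite /ix; ring.
have iD a (x : V) : ix a a x = 0 by rewrite /ix; ring.
have oj : j \in [:: i0; i1; i2] by case: j => [[|[|[|]]]].
have ok : k \in [:: i0; i1; i2] by case: k => [[|[|[|]]]].
by move: oj ok; rewrite !inE => /or3P[] /eqP -> /or3P[] /eqP ->;
  split; rewrite ?iD // ?(rC i1 i0) ?(rC i2 i0) ?(rC i2 i1) ?(iC i1 i0) ?(iC i2 i0) ?(iC i2 i1)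
   ?r01 ?s01 ?r02 ?s02 ?r12 ?s12.
Qed.

Lemma same_scale u v : same u v -> exists2 c : C, c != 0 & u = c *: v.
Proof.
move=> suv; have E j k : u 0 j * conjc (u 0 k) = v 0 j * conjc (v 0 k).
  have [a b] := suv j k; apply: complex_ext.
    by rewrite !cReM !cReJ !cImJ !mulrN !opprK.
  by rewrite !cImM !cReJ !cImJ !mulrN ![- _ + _]addrC.
have [v0|v0] := eqVneq v 0.
  exists 1; first exact: oner_neq0.
  rewrite v0 scaler0; apply/rowP => j; move: (E j j); rewrite v0 !mxE mul0r => /eqP.
  by rewrite mulf_eq0 conjc_eq0 orbb => /eqP.
have [k vk] := neq0_coord v0.
have uk : u 0 k != 0.
  have : u 0 k * conjc (u 0 k) != 0 by rewrite E mulf_neq0 // conjc_eq0.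
  by rewrite mulf_eq0 negb_or => /andP[].
exists (conjc (v 0 k) / conjc (u 0 k)).
  by rewrite mulf_neq0 ?invr_eq0 ?conjc_eq0.
apply/rowP => j; rewrite mxE mulrAC [conjc _ * _]mulrC -E mulfK //.
by rewrite conjc_eq0.
Qed.

Lemma sum_sqr_eq0 (a b : R) : a ^+ 2 + b ^+ 2 = 0 -> a = 0 /\ b = 0.
Proof.
move=> /eqP; rewrite paddr_eq0 ?sqr_ge0 // !sqrf_eq0 => /andP[/eqP-> /eqP->].
by [].
Qed.

Lemma sqr_eq0 (a : R) : a ^+ 2 = 0 -> a = 0.
Proof. by move=> /eqP; rewrite sqrf_eq0 => /eqP. Qed.

(* All products [u_j * conj u_k] are determined by the [|<u, w>|] with [w] among
   e_k, (1,1,1), (1,1,0), (1,0,1), (0,1,1), (1,i,0), (1,i,i), (1,i,1); each of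
   these vectors is fixed up to phase because of the preceding ones, except that
   (1,i,0) may be sent to its conjugate. *)
Section Core.
Variable rho : V -> V.
Hypothesis rho_dot : forall u v, sqn ⟨rho u, rho v⟩ = sqn ⟨u, v⟩.
Hypothesis rho_coord : forall u k, rx k k (rho u) = rx k k u.
Local Notation tv a b c d e f := (test_vector (a +i* b) (c +i* d) (e +i* f)).
Hypothesis rho_111 : same (rho (tv 1 0 1 0 1 0)) (tv 1 0 1 0 1 0).

Lemma keeps w : same (rho w) w -> forall u, sqn ⟨rho u, w⟩ = sqn ⟨u, w⟩.
Proof.
move=> sw u; rewrite -(rho_dot u w) !sqn_dotE.
by do ! [rewrite (proj1 (sw _ _))|rewrite (proj2 (sw _ _))].
Qed.

Lemma rho_r01 u : rx i0 i1 (rho u) = rx i0 i1 u.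
Proof.
pose w := tv 1 0 1 0 0 0; have [[d0 d1 d2] [r01 r02 r12]] := rx_tv 1 0 1 0 0 0.
have [s01 s02 s12] := ix_tv 1 0 1 0 0 0; rewrite -/w in d0 d1 d2 r01 r02 r12 s01 s02 s12.
have K := keeps rho_111 w; rewrite !sqn_dot_tv !rho_coord d0 d1 d2 r01 r02 r12 in K.
have p01 := rank_one i0 i1 (rho w); rewrite !rho_coord d0 d1 in p01.
have p02 := rank_one i0 i2 (rho w); rewrite !rho_coord d0 d2 in p02.
have p12 := rank_one i1 i2 (rho w); rewrite !rho_coord d1 d2 in p12.
(* The last coordinate of the image vanishes, so rank one kills the entries that involve it. The
   pairing [K] with (1,1,1) then gives [rx i0 i1 = 1], and rank one once more gives
   [ix i0 i1 = 0]. *)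
have [q02 t02] : rx i0 i2 (rho w) = 0 /\ ix i0 i2 (rho w) = 0.
  by apply: sum_sqr_eq0; rewrite p02; ring.
have [q12 t12] : rx i1 i2 (rho w) = 0 /\ ix i1 i2 (rho w) = 0.
  by apply: sum_sqr_eq0; rewrite p12; ring.
have q01 : rx i0 i1 (rho w) = 1 by lra.
have t01 : ix i0 i1 (rho w) = 0 by apply: sqr_eq0; rewrite q01 in p01; lra.
have sw : same (rho w) w.
  by apply: same6; rewrite ?rho_coord // ?r01 ?r02 ?r12 ?s01 ?s02 ?s12
    ?q01 ?q02 ?q12 ?t01 ?t02 ?t12; ring.
have := keeps sw u; rewrite !sqn_dot_tv !rho_coord; lra.
Qed.

Lemma rho_r02 u : rx i0 i2 (rho u) = rx i0 i2 u.
Proof.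
pose w := tv 1 0 0 0 1 0; have [[d0 d1 d2] [r01 r02 r12]] := rx_tv 1 0 0 0 1 0.
have [s01 s02 s12] := ix_tv 1 0 0 0 1 0; rewrite -/w in d0 d1 d2 r01 r02 r12 s01 s02 s12.
have K := keeps rho_111 w; rewrite !sqn_dot_tv !rho_coord d0 d1 d2 r01 r02 r12 in K.
have p01 := rank_one i0 i1 (rho w); rewrite !rho_coord d0 d1 in p01.
have p02 := rank_one i0 i2 (rho w); rewrite !rho_coord d0 d2 in p02.
have p12 := rank_one i1 i2 (rho w); rewrite !rho_coord d1 d2 in p12.
have [q01 t01] : rx i0 i1 (rho w) = 0 /\ ix i0 i1 (rho w) = 0.
  by apply: sum_sqr_eq0; rewrite p01; ring.
have [q12 t12] : rx i1 i2 (rho w) = 0 /\ ix i1 i2 (rho w) = 0.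
  by apply: sum_sqr_eq0; rewrite p12; ring.
have q02 : rx i0 i2 (rho w) = 1 by lra.
have t02 : ix i0 i2 (rho w) = 0 by apply: sqr_eq0; rewrite q02 in p02; lra.
have sw : same (rho w) w.
  by apply: same6; rewrite ?rho_coord // ?r01 ?r02 ?r12 ?s01 ?s02 ?s12
    ?q01 ?q02 ?q12 ?t01 ?t02 ?t12; ring.
have := keeps sw u; rewrite !sqn_dot_tv !rho_coord; lra.
Qed.

Lemma rho_r12 u : rx i1 i2 (rho u) = rx i1 i2 u.
Proof.
pose w := tv 0 0 1 0 1 0; have [[d0 d1 d2] [r01 r02 r12]] := rx_tv 0 0 1 0 1 0.
have [s01 s02 s12] := ix_tv 0 0 1 0 1 0; rewrite -/w in d0 d1 d2 r01 r02 r12 s01 s02 s12.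
have K := keeps rho_111 w; rewrite !sqn_dot_tv !rho_coord d0 d1 d2 r01 r02 r12 in K.
have p01 := rank_one i0 i1 (rho w); rewrite !rho_coord d0 d1 in p01.
have p02 := rank_one i0 i2 (rho w); rewrite !rho_coord d0 d2 in p02.
have p12 := rank_one i1 i2 (rho w); rewrite !rho_coord d1 d2 in p12.
have [q01 t01] : rx i0 i1 (rho w) = 0 /\ ix i0 i1 (rho w) = 0.
  by apply: sum_sqr_eq0; rewrite p01; ring.
have [q02 t02] : rx i0 i2 (rho w) = 0 /\ ix i0 i2 (rho w) = 0.
  by apply: sum_sqr_eq0; rewrite p02; ring.
have q12 : rx i1 i2 (rho w) = 1 by lra.
have t12 : ix i1 i2 (rho w) = 0 by apply: sqr_eq0; rewrite q12 in p12; lra.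
have sw : same (rho w) w.
  by apply: same6; rewrite ?rho_coord // ?r01 ?r02 ?r12 ?s01 ?s02 ?s12
    ?q01 ?q02 ?q12 ?t01 ?t02 ?t12; ring.
have := keeps sw u; rewrite !sqn_dot_tv !rho_coord; lra.
Qed.

(** The only ambiguity of the normalized map: -1 is the value at (1,i,0) itself, 1 the value at its
    conjugate. The sign decides between unitary and antiunitary. *)
Lemma rho_orientation : let w := tv 1 0 0 1 0 0 in
  ix i0 i1 (rho w) = -1 \/ ix i0 i1 (rho w) = 1.
Proof.
move=> w; have [[d0 d1 _] [r01 _ _]] := rx_tv 1 0 0 1 0 0.
have p := rank_one i0 i1 (rho w); rewrite !rho_coord rho_r01 d0 d1 r01 in p.
have : (ix i0 i1 (rho w) + 1) * (ix i0 i1 (rho w) - 1) = 0.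
  have -> (x : R) : (x + 1) * (x - 1) = x ^+ 2 - 1 by ring.
  lra.
by move=> /eqP; rewrite mulf_eq0 => /orP[] /eqP h; [left|right]; lra.
Qed.

Hypothesis rho_1i0 : ix i0 i1 (rho (tv 1 0 0 1 0 0)) = -1.

Lemma rho_i01 u : ix i0 i1 (rho u) = ix i0 i1 u.
Proof.
pose w := tv 1 0 0 1 0 0; have [[d0 d1 d2] [r01 r02 r12]] := rx_tv 1 0 0 1 0 0.
have [s01 s02 s12] := ix_tv 1 0 0 1 0 0; rewrite -/w in d0 d1 d2 r01 r02 r12 s01 s02 s12.
have p02 := rank_one i0 i2 (rho w); rewrite !rho_coord d0 d2 in p02.
have p12 := rank_one i1 i2 (rho w); rewrite !rho_coord d1 d2 in p12.
have [_ t02] : rx i0 i2 (rho w) = 0 /\ ix i0 i2 (rho w) = 0.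
  by apply: sum_sqr_eq0; rewrite p02; ring.
have [_ t12] : rx i1 i2 (rho w) = 0 /\ ix i1 i2 (rho w) = 0.
  by apply: sum_sqr_eq0; rewrite p12; ring.
have sw : same (rho w) w.
  by apply: same6; rewrite ?rho_coord ?rho_r01 ?rho_r02 ?rho_r12 // ?s01 ?s02 ?s12
    ?t02 ?t12 ?rho_1i0; ring.
have := keeps sw u; rewrite !sqn_dot_tv !rho_coord rho_r01; lra.
Qed.

Lemma rho_i02 u : ix i0 i2 (rho u) = ix i0 i2 u.
Proof.
pose w := tv 1 0 0 1 0 1; have [[d0 d1 d2] [r01 r02 r12]] := rx_tv 1 0 0 1 0 1.
have [s01 s02 s12] := ix_tv 1 0 0 1 0 1; rewrite -/w in d0 d1 d2 r01 r02 r12 s01 s02 s12.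
have p12 := rank_one i1 i2 (rho w); rewrite !rho_coord rho_r12 d1 d2 r12 in p12.
have t12 : ix i1 i2 (rho w) = 0 by apply: sqr_eq0; lra.
(* For (1,i,i) this minor reduces to [ix i0 i2 = ix i0 i1], and the right-hand side is known by
   [rho_i01]. *)
have t02 := rank_one_ix02 (rho w).
rewrite rho_coord rho_r01 rho_r12 rho_i01 t12 d1 r01 r12 s01 in t02.
have sw : same (rho w) w.
  apply: same6; rewrite ?rho_coord ?rho_r01 ?rho_r02 ?rho_r12 ?rho_i01 // ?s02 ?s12 ?t12; lra.
have := keeps sw u; rewrite !sqn_dot_tv !rho_coord rho_r01 rho_r02 rho_r12 rho_i01; lra.
Qed.

Lemma rho_i12 u : ix i1 i2 (rho u) = ix i1 i2 u.
Proof.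
pose w := tv 1 0 0 1 1 0; have [[d0 d1 d2] [r01 r02 r12]] := rx_tv 1 0 0 1 1 0.
have [s01 s02 s12] := ix_tv 1 0 0 1 1 0; rewrite -/w in d0 d1 d2 r01 r02 r12 s01 s02 s12.
have t12 := rank_one_ix12 (rho w).
rewrite rho_coord rho_r01 rho_r02 rho_i01 rho_i02 d0 r01 r02 s01 s02 in t12.
have sw : same (rho w) w.
  apply: same6; rewrite ?rho_coord ?rho_r01 ?rho_r02 ?rho_r12 ?rho_i01 ?rho_i02 // ?s12; lra.
have := keeps sw u.
by rewrite !sqn_dot_tv !rho_coord rho_r01 rho_r02 rho_r12 rho_i01 rho_i02; lra.
Qed.

Lemma rho_same u : same (rho u) u.
Proof.
apply: same6; rewrite ?rho_coord ?rho_r01 ?rho_r02 ?rho_r12 //.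
- exact: rho_i01.
- exact: rho_i02.
- exact: rho_i12.
Qed.

End Core.

Lemma wigner_core rho :
  (forall u v, sqn ⟨rho u, rho v⟩ = sqn ⟨u, v⟩) ->
  (forall u k, rx k k (rho u) = rx k k u) ->
  same (rho (test_vector 1 1 1)) (test_vector 1 1 1) ->
  (forall u, same (rho u) u) \/ (forall u, same (rho u) (map_mx conjc u)).
Proof.
move=> H1 H2 H3; have [h|h] := rho_orientation H1 H2 H3.
  by left=> u; apply: rho_same.
right=> u; pose bar (x : V) : V := map_mx conjc x.
have rxb j k x : rx j k (bar x) = rx j k x by rewrite /rx !mxE !cReJ !cImJ; ring.
have ixb j k x : ix j k (bar x) = - ix j k x by rewrite /ix !mxE !cReJ !cImJ; ring.
have dotb x y : sqn ⟨bar x, bar y⟩ = sqn ⟨x, y⟩.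
  by rewrite !sqn_dotE !rxb !ixb !mulrNN.
(* Conjugation respects the three normalizations and reverses the sign at (1,i,0), which reduces to
   the first case. *)
have s : same (bar (rho u)) u.
  apply: (@rho_same (bar \o rho)) => [x y|x k||] /=.
  - by rewrite dotb H1.
  - by rewrite rxb H2.
  - move=> j k; have [a b] := H3 j k; rewrite rxb ixb; split=> //.
    rewrite b; suff -> : ix j k (test_vector 1 1 1) = 0 by rewrite oppr0.
    by rewrite /ix !mxE /=; do ! case: ifP => _ /=; ring.
  - by rewrite ixb h.
move=> j k; have [a b] := s j k; rewrite -/(bar u) rxb ixb; split.
  by rewrite -a rxb.
by rewrite -b ixb opprK.
Qed.
End WignerCore.

Section Isometries.
Variable R : realType.
Local Notation C := R[i].
Local Notation V := 'rV[C]_3.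
Implicit Types (K L : CP2 R) (u v : V) (A B : 'M[C]_3).

Lemma sqn1 : sqn (1 : C) = 1.
Proof. by apply: complexI; rewrite sqnE conjc1 mulr1. Qed.

Lemma sqn_dot_self u : sqn ⟨u, u⟩ = nrm u ^+ 2.
Proof. by rewrite /sqn dot_real expr0n addr0. Qed.

(** Representatives are rescaled to keep the length of the vector; the denominators in [fs_dist_inj]
    then agree and the numerators can be compared. *)
Lemma isometry_lift (T : CP2 R -> CP2 R) : fs_isometry T -> exists tau : V -> V,
  (forall L u, sval L = <[u]>%VS -> sval (T L) = <[tau u]>%VS) /\
  forall u v, sqn ⟨tau u, tau v⟩ = sqn ⟨u, v⟩.
Proof.
move=> [_ dT].
have /choice [tau H] (u : V) : exists w : V, [/\ (u = 0 -> w = 0), nrm w = nrm u &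
    forall L, sval L = <[u]>%VS -> sval (T L) = <[w]>%VS].
  have [->|u0] := eqVneq u 0.
    by exists 0; split=> // L /CP2_neq0; rewrite eqxx.
  have [L EL] := exists_line u0; have [w0 Ew] := CP2_pick (T L).
  set w := vpick _ in w0 Ew.
  pose s : R := Num.sqrt (nrm u / nrm w).
  have un := nrm_gt0 u0; have wn := nrm_gt0 w0.
  have s0 : 0 < s by rewrite sqrtr_gt0 divr_gt0.
  exists (s%:C *: w); split.
  - by move=> u00; move: u0; rewrite u00 eqxx.
  - rewrite nrmZ /sqn /= expr0n addr0 sqr_sqrtr ?divr_ge0 ?ltW //.
    by rewrite divfK // gt_eqF.
  - move=> L' EL'; rewrite (CP2_ext EL' EL) Ew vline_scale //.
    by rewrite -[0]/((0 : R)%:C) (inj_eq (@complexI R)) gt_eqF.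
exists tau; split=> [L u E|u v]; first by have [_ _] := H u; apply.
have [tu0 nu Tu] := H u; have [tv0 nv Tv] := H v.
have [u0|u0] := eqVneq u 0; first by rewrite (tu0 u0) u0 !dot0l.
have [v0|v0] := eqVneq v 0; first by rewrite (tv0 v0) v0 !dot0r.
have [K EK] := exists_line u0; have [L EL] := exists_line v0.
have := fs_dist_inj (Tu K EK) (Tv L EL) EK EL (dT K L).
rewrite nu nv => /(congr1 (fun x => x * (nrm u * nrm v))).
by rewrite !divfK // mulf_neq0 // gt_eqF // nrm_gt0.
Qed.

(** The images of the basis vectors form a unitary matrix [M]. In that basis the image of (1,1,1)
    has coordinates of modulus one, and [D] removes these phases. After [B = adj M *m D] the map
    satisfies the normalizations of [wigner_core]. *)
Lemma wigner (T : CP2 R -> CP2 R) : fs_isometry T -> exists2 A, unitary A &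
  (forall L u, sval L = <[u]>%VS -> sval (T L) = <[u *m A]>%VS) \/
  (forall L u, sval L = <[u]>%VS -> sval (T L) = <[map_mx conjc u *m A]>%VS).
Proof.
move=> /isometry_lift [tau [tauL taud]].
pose e k : V := delta_mx 0 k; pose f k := tau (e k).
have dot_e u k : ⟨u, e k⟩ = u 0 k.
  rewrite dotE (bigD1 k) //= big1 ?addr0 => [|j jk].
    by rewrite mxE !eqxx conjc1 mulr1.
  by rewrite mxE eqxx (negbTE jk) conjc0 mulr0.
have sqnf j k : sqn ⟨f j, f k⟩ = (j == k)%:R.
  rewrite taud dot_e mxE eqxx andTb eq_sym; case: (j == k); first by rewrite !mulr1n sqn1.
  by apply/eqP; rewrite sqn_eq0.
pose M : 'M[C]_3 := \matrix_(i < 3) f i.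
have mulM u k : (u *m adj M) 0 k = ⟨u, f k⟩.
  by rewrite dotE !mxE; apply: eq_bigr => j _; rewrite !mxE.
have uM : unitary M.
  apply/matrixP => i j; rewrite [RHS]mxE.
  have -> : (M *m adj M) i j = ⟨f i, f j⟩.
    by rewrite dotE !mxE; apply: eq_bigr => k _; rewrite !mxE.
  have := sqnf i j; have [<-|ij] := eqVneq i j; last first.
    by move/eqP; rewrite sqn_eq0 => /eqP.
  rewrite sqn_dot_self -nrmE => /eqP; rewrite -[1%:R]/(1 : R) sqrp_eq1 ?nrm_ge0 //.
  by move=> /eqP ->.
pose one : V := test_vector 1 1 1.
have [a aE] : exists a, a = tau one *m adj M by eexists.
have rxs (x : V) k : rx k k x = sqn (x 0 k) by rewrite /rx /sqn !expr2.
have rxM u k : rx k k (tau u *m adj M) = rx k k u.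
  by rewrite !rxs mulM taud dot_e.
have aa k : a 0 k * conjc (a 0 k) = 1.
  rewrite -sqnE aE -rxs rxM rxs (_ : one 0 k = 1); last first.
    by rewrite mxE; case: ifP => // _; case: ifP.
  by rewrite sqn1.
pose D : 'M[C]_3 := diag_mx (map_mx conjc a).
have uD : unitary D.
  apply/matrixP => i j.
  have -> : adj D = diag_mx a.
    apply/matrixP => k l; rewrite !mxE eq_sym; case: eqP => [->|_].
      by rewrite !mulr1n conjcK.
    by rewrite !mulr0n conjc0.
  rewrite mul_diag_mx !mxE; case: eqP => [->|_]; last by rewrite !mulr0n mulr0.
  by rewrite !mulr1n mulrC aa.
pose B := adj M *m D; have uB : unitary B by apply: unitaryM => //; exact: unitary_adj.
have mulB u k : (u *m B) 0 k = (u *m adj M) 0 k * conjc (a 0 k).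
  by rewrite mulmxA mul_mx_diag !mxE.
have [|||h|h] := @wigner_core _ (fun u => tau u *m B).
- by move=> u v; rewrite (unitary_preserves uB) taud.
- move=> u k; rewrite rxs mulB sqnM -rxs rxM sqnJ.
  have -> : sqn (a 0 k) = 1 by apply: complexI; rewrite sqnE aa.
  by rewrite mulr1.
- suff -> : tau one *m B = one by move=> j k.
  apply/rowP => k; rewrite mulB -aE aa mxE.
  by case: ifP => // _; case: ifP.
- exists (adj B); first exact: unitary_adj.
  left=> L u E; have [c c0 Ec] := same_scale (h u).
  rewrite (tauL _ _ E) -(vline_scale (u *m adj B) c0) scalemxAl -Ec -mulmxA uB.
  by rewrite mulmx1.
exists (adj B); first exact: unitary_adj.
right=> L u E; have [c c0 Ec] := same_scale (h u).
rewrite (tauL _ _ E) -(vline_scale (map_mx conjc u *m adj B) c0) scalemxAl -Ec -mulmxA uB.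
by rewrite mulmx1.
Qed.

(* Every element of the group is a square, hence unitary even if its root is
   antiunitary. *)
Lemma one_parameter_unitary (T : R -> CP2 R -> CP2 R) t : one_parameter_group T ->
  exists2 A, unitary A & forall L u, sval L = <[u]>%VS -> sval (T t L) = <[u *m A]>%VS.
Proof.
move=> [isoT _ TD _].
have Tt L : T t L = T (t / 2) (T (t / 2) L) by rewrite -TD -splitr.
have [A uA [hA|hA]] := wigner (isoT (t / 2)).
  exists (A *m A); first exact: unitaryM.
  by move=> L u E; rewrite Tt (hA _ _ (hA _ _ E)) mulmxA.
exists (map_mx conjc A *m A); first by apply: unitaryM => //; exact: unitary_conj.
move=> L u E; rewrite Tt (hA _ _ (hA _ _ E)) map_mxM mulmxA; congr (<[_ *m _ *m _]>)%VS.
by apply/matrixP => i j; rewrite !mxE /= conjcK.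
Qed.

End Isometries.

(** * The plane and the sphere *)

Section Conclusion.
Variable R : realType.
Local Notation C := R[i].
Local Notation V := 'rV[C]_3.
Local Notation plane := (R * R)%type.

Lemma real_lineZ (X : V) (k : C) : real_line X -> real_line (k *: X).
Proof.
move=> rX i j; rewrite !mxE !conjM conjcK.
have := rX i j; rewrite conjM conjcK => E.
have I (a b x y z t : C) : a * x * (b * y) = b * a * (x * y) by ring.
by rewrite (I _ _ _ _ 0 0) E; move: (X 0 i) (conjc (X 0 j)) (conjc k) => *; ring.
Qed.

Definition chart_conclusion (g : plane -> CP2 R) :=
  [/\ zero_hopf_differential g, zero_second_fundamental_form g &
   exists2 A, unitary A & forall U F p, local_lift g U F -> U p -> real_line (F p *m A)].

(** The function [e] accommodates both stereographic charts: in the one centred at the north pole,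
    rotating the parameter turns the sphere by the opposite angle. *)
Lemma equivariant_plane (g : plane -> CP2 R) (T : R -> CP2 R -> CP2 R) (e : R -> R) :
  smooth_map g -> immersive g -> conformal g -> isotropic g -> zero_mean_curvature g ->
  one_parameter_group T ->
  (forall t p, g (rot (cos t) (sin t) p) = T (e t) (g p)) -> chart_conclusion g.
Proof.
move=> sg ig cg lg mg hT eqv.
have rg t : exists2 A, preserves_dot A & forall p (X : V),
    sval (g (rot (cos t) (sin t) p)) = <[X]>%VS -> sval (g p) = <[X *m A]>%VS.
  (* The inverse element, since the matrix must lead from the rotated point back to [p]. *)
  have [A uA hA] := one_parameter_unitary (- e t) hT.
  exists A; first exact: unitary_preserves.
  move=> p X E; rewrite -(hA _ _ E) eqv.
  by case: hT => _ T0 TD _; rewrite -TD addNr T0.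
split; [exact: hopf_eq0|exact: sff_eq0|exact: real_frame].
Qed.

Lemma RP2_of_lift (g : plane -> CP2 R) U F p A : unitary A -> local_lift g U F -> U p ->
  real_line (F p *m A) -> RP2 (act A (g p)).
Proof.
move=> uA [_ _ /(_ p) F1] /F1 [_ E] rF.
exact: RP2_of_real_line (act_line uA E) rF.
Qed.

Lemma real_line_transfer (g g' : plane -> CP2 R) U F p U' F' p' A :
  local_lift g U F -> U p -> local_lift g' U' F' -> U' p' -> g p = g' p' ->
  real_line (F' p' *m A) -> real_line (F p *m A).
Proof.
move=> [_ _ /(_ p) F1] /F1 [_ E] [_ _ /(_ p') F1'] /F1' [_ E'] gg rF.
have /vlineP [k ->] : F p \in <[F' p']>%VS by rewrite -E' -gg E memv_line.
by rewrite -scalemxAl; exact: real_lineZ.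
Qed.

(** Reality is the vanishing of the smooth functions [conj n - n], so it extends over the origin. *)
Lemma real_line_punctured (g : plane -> CP2 R) U F A : local_lift g U F -> U 0 ->
  (forall p, U p -> p != 0 -> real_line (F p *m A)) -> real_line (F 0 *m A).
Proof.
move=> hF U0 rF j k; have [oU sF _] := unit_on_lift hF.
have sH := vsm_mulmx A oU sF.
pose n q := (F q *m A) 0 j * conjc ((F q *m A) 0 k).
have sn : csm U n by apply: csmM => //; exact: csmJ.
pose u q := conjc (n q) + - n q.
have su : csm U u by apply: csmD => //; [exact: csmJ|exact: csmN].
apply/eqP; rewrite -subr_eq0 -/(n 0) -/(u 0); apply/eqP.
apply: (eq0_of_punctured oU U0 (csm_cdiff su U0)) => p Up p0.
by rewrite /u /n (rF p Up p0) subrr.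
Qed.

Lemma stereo_rot (s : bool) (t : R) (p : plane) :
  stereo s (rot (cos t) (sin t) p) = rotz ((-1) ^+ s * t) (stereo s p).
Proof.
have ct := cos2Dsin2 t; apply: val_inj; case: p => x y; rewrite /= /stereo_coords /rotz_coords /rot /=.
set d := 1 + x ^+ 2 + y ^+ 2.
have -> : 1 + (cos t * x - sin t * y) ^+ 2 + (sin t * x + cos t * y) ^+ 2 = d.
  have -> : d = 1 + (cos t ^+ 2 + sin t ^+ 2) * (x ^+ 2 + y ^+ 2) by rewrite ct mul1r addrA.
  by ring.
have -> : (cos t * x - sin t * y) ^+ 2 + (sin t * x + cos t * y) ^+ 2 = x ^+ 2 + y ^+ 2.
  by rewrite -[RHS]mul1r -ct; ring.
have -> : (-1) ^+ s = (if s then -1 else 1) :> R by case: (s); rewrite ?expr1 ?expr0.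
by case: s; rewrite ?mulN1r ?mul1r ?cosN ?sinN; congr (_, _, _); rewrite ?mulN1r ?mul1r; ring.
Qed.

Lemma stereo_surj (q : S2 R) : (sval q).2 != 1 -> exists p, q = stereo false p.
Proof.
case: q => [[[x y] z]] /= hq z1; have /eqP sq := hq; rewrite /= in sq.
have w0 : 1 - z != 0 by rewrite subr_eq0 eq_sym.
exists (x / (1 - z), y / (1 - z)); apply: val_inj; rewrite /= /stereo_coords /= expr0 !mul1r.
have xy : x ^+ 2 + y ^+ 2 = (1 - z) * (1 + z) by lra.
have E : (x / (1 - z)) ^+ 2 + (y / (1 - z)) ^+ 2 = (1 + z) / (1 - z).
  rewrite !expr_div_n -mulrDl xy; field; exact: w0.
have -> : 1 + (x / (1 - z)) ^+ 2 + (y / (1 - z)) ^+ 2 = 2 / (1 - z).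
  by rewrite -addrA E; field.
rewrite E; congr (_, _, _); field; rewrite w0 //.
Qed.

Lemma north_pole (q : S2 R) : (sval q).2 = 1 -> q = stereo true (0, 0).
Proof.
case: q => [[[x y] z]] /= hq z1; have /eqP sq := hq; rewrite /= in sq.
have [x0 y0] : x = 0 /\ y = 0 by apply: sum_sqr_eq0; rewrite z1 in sq; lra.
apply: val_inj; rewrite /= x0 y0 z1 /stereo_coords /= expr0n /= !mulr0 !mul0r !addr0.
by rewrite add0r expr1 mulr0 divr1 mulrN1 opprK.
Qed.

Lemma stereo_not_north (p : plane) : p != 0 -> (sval (stereo true p)).2 != 1.
Proof.
case: p => x y; apply: contra => /eqP; rewrite /= expr1 mulN1r => E.
have d0 : 1 + x ^+ 2 + y ^+ 2 != 0.
  by rewrite lt0r_neq0 // -addrA ltr_pwDl // addr_ge0 // sqr_ge0.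
have {}E : x ^+ 2 + y ^+ 2 - 1 = - (1 + x ^+ 2 + y ^+ 2).
  by rewrite -(divfK d0 (x ^+ 2 + y ^+ 2 - 1)) -[_ / _]opprK E mulN1r.
by have [-> ->] : x = 0 /\ y = 0 by apply: sum_sqr_eq0; lra.
Qed.

End Conclusion.

Theorem theorem4p4 (R : realType) (M : rot_surface R)
    (hM : M = complex_plane R \/ M = round_sphere R) (f : M -> CP2 R)
    (f_conformal : conformal_immersion f)
    (f_equivariant : rotationally_equivariant f)
    (f_lagrangian : lagrangian f)
    (f_minimal : minimal f) :
  vanishing_cubic_hopf_differential f /\
  totally_geodesic f /\
  (exists Phi : CP2 R -> CP2 R, fs_isometry Phi /\ forall p : M, RP2 (Phi (f p))).
Proof.
case: f_equivariant => T hT eqv.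
case: hM => E; subst M.
  have Z i : chart_conclusion (f \o param i).
    have [sg ig cg] := f_conformal i.
    apply: (equivariant_plane (e := id) sg ig cg (f_lagrangian i) (f_minimal i) hT).
    move=> t p; rewrite -eqv /=; congr f.
    by apply: complex_ext; rewrite ?cReM ?cImM /=; ring.
  split; first by move=> i; case: (Z i).
  split; first by move=> i; case: (Z i).
  have [_ _ [A uA HA]] := Z tt; have [sg _ _] := f_conformal tt.
  exists (act A); split; first exact: act_isometry.
  move=> z; have -> : z = param (r := complex_plane R) tt (Re z, Im z) by case: z.
  have [U [F [Up hF]]] := sg (Re z, Im z).
  exact: (RP2_of_lift uA hF Up (HA _ _ _ hF Up)).
have Z i : chart_conclusion (f \o param i).
  have [sg ig cg] := f_conformal i.
  apply: (equivariant_plane (e := fun t => (-1) ^+ (i : bool) * t) sg ig cg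
    (f_lagrangian i) (f_minimal i) hT).
  by move=> t p; rewrite -eqv /= stereo_rot.
split; first by move=> i; case: (Z i).
split; first by move=> i; case: (Z i).
(* The matrix of the chart centred at the south pole is used for the whole sphere; this chart misses
   only the north pole. *)
have [_ _ [A uA HA]] := Z false; have [sg _ _] := f_conformal false.
have [sg' _ _] := f_conformal true.
exists (act A); split; first exact: act_isometry.
move=> q.
have south (q' : S2 R) : (sval q').2 != 1 -> RP2 (act A (f q')).
  move=> /stereo_surj [p ->]; have [U [F [Up hF]]] := sg p.
  exact: (RP2_of_lift uA hF Up (HA _ _ _ hF Up)).
have [q1|] := eqVneq (sval (q : S2 R)).2 1; last exact: south.
have -> : q = param (r := round_sphere R) true (0, 0) by exact: north_pole.
have [U [F [U0 hF]]] := sg' (0, 0).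
(* The lift around the pole belongs to the other chart, [A] to the first. Off the pole both charts
   describe the same lines, and [real_line_transfer] carries reality with respect to [A] over. *)
apply: (RP2_of_lift uA hF U0); apply: (real_line_punctured hF U0) => p Up p0.
have [p' E] := stereo_surj (stereo_not_north p0).
have [U' [F' [Up' hF']]] := sg p'.
apply: (real_line_transfer hF Up hF' Up') (HA _ _ _ hF' Up').
by rewrite /= E.
Qed.
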